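(* There exists a universal constant $C_1>0$ such that for every $C^2$-smooth Riemannian surface $M$, every point $p_0\in M$ and every $0<\alpha\le 1$, $$\rho_{\text{int}}(p_0,\alpha)\ \geq\ C_1\cdot \rho_{\text{ext}}(p_0,\alpha),$$ where $\rho_{\text{int}}(p_0,\alpha)$ and $\rho_{\text{ext}}(p_0,\alpha)$ are the intrinsic and extrinsic $\alpha$-regularity radii of $M$ at $p_0$.
   Context: Let $M$ be a $C^2$-smooth Riemannian surface with Riemannian distance $d_g$ and Gauss curvature function $K:M\to\mathbb{R}$, and let $0<\alpha\le 1$. For $p_0\in M$ and $\delta>0$ let $B=B_M(p_0,\delta)$ be the Riemannian disc of radius $\delta$ around $p_0$. Non-dimensional Hölder norm of curvature: $$\|K\|_{0,\alpha;B}=\sup_{p\in B}|K(p)|+(2\delta)^{\alpha}\sup_{p\ne q\in B}\frac{|K(p)-K(q)|}{d_g^{\alpha}(p,q)}.$$ Intrinsic regularity: $M$ is intrinsically $\alpha$-regular at $p_0$ to distance $\delta>0$ if the injectivity radius of all points of $B=B_M(p_0,\delta)$ is at least $2\delta$, and $\delta^2\cdot\|K\|_{0,\alpha;B}\le 1$. The intrinsic $\alpha$-regularity radius $\rho_{\text{int}}(p_0,\alpha)$ is the supremum of all such $\delta$. Euclidean norms: for a bounded open set $U\subseteq\mathbb{R}^2$ with Euclidean diameter $d$, an integer $k\ge 0$ and $f\in C^k(U)$, with $\beta$ ranging over two-dimensional multi-indices and $|x-y|$ the Euclidean distance, set $$\|D^kf\|_{0;U}=\max_{|\beta|=k}\sup_{x\in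 U}|D^\beta f(x)|,\qquad [D^kf]_{\alpha;U}=\max_{|\beta|=k}\sup_{x\ne y\in U}\frac{|D^\beta f(x)-D^\beta f(y)|}{|x-y|^\alpha},$$ $$\|f\|_{k;U}=\sum_{j=0}^k d^j\|D^jf\|_{0;U},\qquad \|f\|_{k,\alpha;U}=\|f\|_{k;U}+d^{k+\alpha}[D^kf]_{\alpha;U}.$$ Extrinsic regularity: $M$ is extrinsically $\alpha$-regular at $p_0$ to distance $\delta>0$ if the injectivity radius of all points of $B=B_M(p_0,\delta)$ is at least $2\delta$, and $B$ is isometric to a bounded open set $U\subseteq\mathbb{R}^2$ endowed with a Riemannian metric $g=\sum_{i,j=1}^2 g_{ij}\,dx^i dx^j$ such that $g_{ij}:U\to\mathbb{R}$ satisfy $g_{ij}(x_0)=\delta_{ij}$ and $\|g_{ij}-\delta_{ij}\|_{2,\alpha;U}\le 1$ for all $i,j\in\{1,2\}$, where $x_0\in U$ is the image of $p_0$ under the isometry and $\delta_{ij}$ is the Kronecker delta. The extrinsic $\alpha$-regularity radius $\rho_{\text{ext}}(p_0,\alpha)$ is the supremum of all such $\delta$. Both suprema are taken in $[0,\infty]$, with $\sup\emptyset=0$. *)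

(* Defs.v *)
From HB Require Import structures.
From mathcomp Require Import all_boot all_order all_algebra.
From mathcomp Require Import all_classical all_reals all_analysis.
Set Implicit Arguments.
Unset Strict Implicit.
Unset Printing Implicit Defensive.
Import Order.TTheory GRing.Theory Num.Theory.
Import numFieldNormedType.Exports.
Local Open Scope classical_set_scope.
Local Open Scope ring_scope.

Section Plane.
Context {R : realType}.

(* The library norm on row vectors is the sup norm (with the same topology). *)
Definition enorm (v : 'rV[R]_2) : R := Num.sqrt (\sum_i v 0 i ^+ 2).

Definition partial (i : 'I_2) (f : 'rV[R]_2 -> R) : 'rV[R]_2 -> R :=
  fun x => 'D_(delta_mx 0 i) f x.

(* [Ck k U f] is meant for an open [U]. *)
Fixpoint Ck (k : nat) (U : set 'rV[R]_2) (f : 'rV[R]_2 -> R) : Prop :=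
  (forall x, U x -> {for x, continuous f}) /\
  if k is k'.+1 then
    forall i : 'I_2, (forall x, U x -> derivable f x (delta_mx 0 i)) /\
                     Ck k' U (partial i f)
  else True.

Definition Ck_map (k : nat) (U : set 'rV[R]_2) (F : 'rV[R]_2 -> 'rV[R]_2) :=
  forall j : 'I_2, Ck k U (fun x => F x 0 j).

(* Row-vector convention, as for the library's [jacobian]: the differential of
   [F] at [x] sends [v] to [v *m jac F x]. *)
Definition jac (F : 'rV[R]_2 -> 'rV[R]_2) (x : 'rV[R]_2) : 'M[R]_2 :=
  \matrix_(i, j) partial i (fun y => F y 0 j) x.

(* The multi-index is (b1, b2). *)
Definition Dmulti (b1 b2 : nat) (f : 'rV[R]_2 -> R) : 'rV[R]_2 -> R :=
  iter b1 (partial 0) (iter b2 (partial 1) f).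

(* Supremum in [0, +oo], with the convention that the empty supremum is 0. *)
Definition esup0 (A : set (\bar R)) : \bar R := ereal_sup (0%E |` A).

Definition ediam (U : set 'rV[R]_2) : R :=
  sup [set enorm (z.1 - z.2) | z in U `*` U].

Definition Dsup (k : nat) (U : set 'rV[R]_2) (f : 'rV[R]_2 -> R) : \bar R :=
  \big[maxe/0%E]_(b < k.+1)
    esup0 [set `|Dmulti b (k - b) f x|%:E | x in U].

Definition Dholder (k : nat) (a : R) (U : set 'rV[R]_2) (f : 'rV[R]_2 -> R) :
    \bar R :=
  \big[maxe/0%E]_(b < k.+1)
    esup0 [set (`|Dmulti b (k - b) f z.1 - Dmulti b (k - b) f z.2|
                  / enorm (z.1 - z.2) `^ a)%:E
          | z in [set z : 'rV[R]_2 * 'rV[R]_2 | U z.1 /\ U z.2 /\ z.1 <> z.2]].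

Definition Ck_norm (k : nat) (U : set 'rV[R]_2) (f : 'rV[R]_2 -> R) : \bar R :=
  (\sum_(j < k.+1) (ediam U ^+ j)%:E * Dsup j U f)%E.

Definition Cka_norm (k : nat) (a : R) (U : set 'rV[R]_2)
    (f : 'rV[R]_2 -> R) : \bar R :=
  (Ck_norm k U f + (ediam U `^ (k%:R + a))%:E * Dholder k a U f)%E.

Definition qform (A : 'M[R]_2) (v : 'rV[R]_2) : R := (v *m A *m v^T) 0 0.

Definition riemannian_metric (U : set 'rV[R]_2) (g : 'rV[R]_2 -> 'M[R]_2) :=
  (forall i j : 'I_2, Ck 2 U (fun x => g x i j)) /\
  (forall x, U x -> (g x)^T = g x /\ forall v, v != 0 -> 0 < qform (g x) v).

Definition christoffel (g : 'rV[R]_2 -> 'M[R]_2) (k i j : 'I_2)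
    (x : 'rV[R]_2) : R :=
  2^-1 * \sum_l invmx (g x) k l *
    (partial i (fun y => g y j l) x + partial j (fun y => g y i l) x
     - partial l (fun y => g y i j) x).

(* Coefficient along the [l]-th coordinate field of
   Riem(X_i, X_j) X_k, where Riem(X, Y) = [nabla_X, nabla_Y] - nabla_[X, Y]. *)
Definition riemann (g : 'rV[R]_2 -> 'M[R]_2) (l i j k : 'I_2)
    (x : 'rV[R]_2) : R :=
  partial i (christoffel g l j k) x - partial j (christoffel g l i k) x
  + \sum_m (christoffel g l i m x * christoffel g m j k x
            - christoffel g l j m x * christoffel g m i k x).

(* <Riem(X_1, X_2) X_2, X_1> / det g; positive on round spheres. *)
Definition gauss_curvature_coord (g : 'rV[R]_2 -> 'M[R]_2)
    (x : 'rV[R]_2) : R :=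
  (\sum_l g x l 0 * riemann g l 0 1 1 x) / \det (g x).

End Plane.

(* A homeomorphism from an open subset of [T] onto an open subset of the plane;
   [cmap] and [cinv] are irrelevant outside [cdom] and [ccod]. *)
Record chart (R : realType) (T : topologicalType) := Chart {
  cdom : set T;
  ccod : set 'rV[R]_2;
  cmap : T -> 'rV[R]_2;
  cinv : 'rV[R]_2 -> T;
  cdom_open : open cdom;
  ccod_open : open ccod;
  cmap_cod : forall p, cdom p -> ccod (cmap p);
  cinv_dom : forall x, ccod x -> cdom (cinv x);
  cmapK : forall p, cdom p -> cinv (cmap p) = p;
  cinvK : forall x, ccod x -> cmap (cinv x) = x;
  cmap_continuous : forall p, cdom p -> {for p, continuous cmap};
  cinv_continuous : forall x, ccod x -> {for x, continuous cinv}
}.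

Section Charts.
Context {R : realType} {T : topologicalType}.

Definition overlap (c c' : chart R T) : set 'rV[R]_2 :=
  [set x | ccod c x /\ cdom c' (cinv c x)].

Definition transition (c c' : chart R T) : 'rV[R]_2 -> 'rV[R]_2 :=
  fun x => cmap c' (cinv c x).

Definition Ck_compatible (k : nat) (c c' : chart R T) :=
  Ck_map k (overlap c c') (transition c c') /\
  Ck_map k (overlap c' c) (transition c' c).

(* [g] in [c] and [g'] in [c'] are the coordinate expressions of the same
   metric tensor on the common part of the two charts. *)
Definition metric_compatible (c : chart R T) (g : 'rV[R]_2 -> 'M[R]_2)
    (c' : chart R T) (g' : 'rV[R]_2 -> 'M[R]_2) :=
  forall x, overlap c c' x ->
    g x = jac (transition c c') x *m g' (transition c c' x)
            *m (jac (transition c c') x)^T.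

End Charts.

(* C^3 transition maps are the natural smoothness class in which a metric tensor
   of class C^2 makes sense. Surfaces are not required to be connected or
   complete. *)
Record riemannian_surface (R : realType) := RiemannianSurface {
  surf_carrier :> topologicalType;
  surf_hausdorff : hausdorff_space surf_carrier;
  surf_second_countable : @second_countable surf_carrier;
  surf_index : Type;
  surf_chart : surf_index -> chart R surf_carrier;
  surf_cover : forall p : surf_carrier, exists i, cdom (surf_chart i) p;
  surf_C3 : forall i j, Ck_compatible 3 (surf_chart i) (surf_chart j);
  surf_metric : surf_index -> 'rV[R]_2 -> 'M[R]_2;
  surf_metric_C2 : forall i,
    riemannian_metric (ccod (surf_chart i)) (surf_metric i);
  surf_metric_compatible : forall i j,
    metric_compatible (surf_chart i) (surf_metric i)
                      (surf_chart j) (surf_metric j)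
}.

Section Surface.
Context {R : realType} (M : riemannian_surface R).

Definition index_at (p : M) : surf_index M := sval (cid (surf_cover p)).

Definition chart_at (p : M) : chart R M := surf_chart (index_at p).

(* The tangent space at [p] is identified with R^2 through [chart_at p]. *)
Definition tnorm (p : M) (v : 'rV[R]_2) : R :=
  Num.sqrt (qform (surf_metric (index_at p) (cmap (chart_at p) p)) v).

Definition velocity (c : R -> M) (t : R) : 'rV[R]_2 :=
  derive1 (fun s => cmap (chart_at (c t)) (c s)) t.

Definition gauss_curvature (p : M) : R :=
  gauss_curvature_coord (surf_metric (index_at p)) (cmap (chart_at p) p).

Definition C1_curve (c : R -> M) :=
  forall t, 0 <= t <= 1 -> {for t, continuous c} /\
    forall i, cdom (surf_chart i) (c t) ->
      let x := fun s => cmap (surf_chart i) (c s) in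
      (\forall s \near t, derivable x s 1) /\ {for t, continuous (derive1 x)}.

Definition curve_length (c : R -> M) : \bar R :=
  (\int[@lebesgue_measure R]_(t in `[0%R, 1%R]) (tnorm (c t) (velocity c t))%:E)%E.

(* A piecewise C^1 curve is given by its C^1 pieces c 0, ..., c n, each
   parametrised by [0, 1]. *)
Definition piecewise_C1 (p q : M) (n : nat) (c : nat -> R -> M) :=
  [/\ forall k, (k <= n)%N -> C1_curve (c k),
      c 0%N 0 = p, c n 1 = q &
      forall k, (k < n)%N -> c k 1 = c k.+1 0].

(* +oo when [p] and [q] lie in different components. *)
Definition rdist (p q : M) : \bar R :=
  ereal_inf [set L | exists n c, piecewise_C1 p q n c /\
                       L = (\sum_(k < n.+1) curve_length (c k))%E].

Definition rball (p : M) (r : R) : set M := [set q | (rdist p q < r%:E)%E].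

Definition geodesic (a b : R) (c : R -> M) :=
  forall t, a < t < b -> {for t, continuous c} /\
    forall i, cdom (surf_chart i) (c t) ->
      let x := fun s => cmap (surf_chart i) (c s) in
      [/\ derivable x t 1, derivable (derive1 x) t 1 &
          forall k : 'I_2,
            derive1 (derive1 x) t 0 k +
            \sum_l \sum_m christoffel (surf_metric i) k l m (x t)
                            * derive1 x t 0 l * derive1 x t 0 m = 0].

(* exp_p(v) is defined and equal to [q]. *)
Definition is_exp (p : M) (v : 'rV[R]_2) (q : M) :=
  exists a b c, [/\ a < 0, 1 < b & geodesic a b c] /\
    [/\ c 0 = p, velocity c 0 = v & c 1 = q].

Definition tball (p : M) (r : R) : set 'rV[R]_2 := [set v | tnorm p v < r].

(* exp_p is defined on the open ball of radius [r] in the tangent space and is a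
   C^1 diffeomorphism from it onto an open subset of [M]: its inverse is a chart
   with codomain that ball (for a metric of class C^2, exp is of class C^1). *)
Definition exp_diffeo (p : M) (r : R) :=
  exists n : chart R M,
    [/\ ccod n = tball p r,
        forall i, Ck_compatible 1 n (surf_chart i) &
        forall v, tball p r v -> is_exp p v (cinv n v)].

Definition injectivity_radius (p : M) : \bar R :=
  esup0 [set r%:E | r in [set r : R | 0 < r /\ exp_diffeo p r]].

Definition curvature_norm (a : R) (p0 : M) (delta : R) : \bar R :=
  let B := rball p0 delta in
  let sup := esup0 [set `|gauss_curvature p|%:E | p in B] in
  let holder :=
    esup0 [set (`|gauss_curvature z.1 - gauss_curvature z.2|
                  / fine (rdist z.1 z.2) `^ a)%:E
          | z in [set z : M * M | B z.1 /\ B z.2 /\ z.1 <> z.2]] in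
  (sup + ((2 * delta) `^ a)%:E * holder)%E.

Definition injectivity_condition (p0 : M) (delta : R) :=
  forall p, rball p0 delta p -> ((2 * delta)%:E <= injectivity_radius p)%E.

Definition intrinsically_regular (a : R) (p0 : M) (delta : R) :=
  [/\ 0 < delta, injectivity_condition p0 delta &
      ((delta ^+ 2)%:E * curvature_norm a p0 delta <= 1)%E].

Definition rho_int (p0 : M) (a : R) : \bar R :=
  esup0 [set delta%:E | delta in [set d | intrinsically_regular a p0 d]].

(* A Riemannian isometry from the open set [B] onto (U, g): a C^3 diffeomorphism
   (given as a chart with domain [B] and codomain [U]) matching the metrics.
   C^1 isometries between C^2 metrics are automatically of class C^3. *)
Definition isometry_onto (B : set M) (U : set 'rV[R]_2)
    (g : 'rV[R]_2 -> 'M[R]_2) (phi : chart R M) :=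
  [/\ cdom phi = B, ccod phi = U,
      forall i, Ck_compatible 3 phi (surf_chart i) &
      forall i, metric_compatible phi g (surf_chart i) (surf_metric i)].

Definition extrinsically_regular (a : R) (p0 : M) (delta : R) :=
  [/\ 0 < delta, injectivity_condition p0 delta &
      exists (U : set 'rV[R]_2) (g : 'rV[R]_2 -> 'M[R]_2) (phi : chart R M),
        [/\ open U, bounded_set U, riemannian_metric U g &
            isometry_onto (rball p0 delta) U g phi] /\
        g (cmap phi p0) = 1%:M /\
        forall i j : 'I_2,
          (Cka_norm 2 a U (fun x => g x i j - (i == j)%:R)%R <= 1)%E].

Definition rho_ext (p0 : M) (a : R) : \bar R :=
  esup0 [set delta%:E | delta in [set d | extrinsically_regular a p0 d]].

End Surface.

(* Main.v *)
(* Let [d] be the Euclidean diameter of the chart [U]. The Gauss curvature has an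
   expression in the metric coefficients and their first two derivatives, the same
   in every chart: writing the connection as matrices [A_i],
   [Riem_12 g = d_1 L_2 - d_2 L_1 - L_2 g^-1 L_1^T + L_1 g^-1 L_2^T] with [L_i = A_i g].
   Where [g] is close to the identity this bounds [d^2 K] and its Hölder seminorm
   (for the distance [|x - y| / d]) by a universal constant, and Riemannian and
   Euclidean distances are comparable there.

   It remains to find a Euclidean ball of radius comparable to [delta] in [U]; in
   particular [d] is then at least comparable to [delta], which the definition of
   extrinsic regularity does not say. This is where the injectivity radius enters:
   by the first variation formula (Gauss lemma) the Riemannian length of the
   logarithm grows along a Euclidean segment [x0 + t h] at a rate at most [4 |h|]. So
   as long as [4 |h| < delta] the segment stays in the image under exp of a compact
   subset of the ball of radius [delta], hence cannot leave [U]. The metric being only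
   C^2, exp is only C^1 and the first variation formula is obtained by comparing two
   geodesics issued from [x0] with Gronwall's inequality, without differentiating a
   family of geodesics. *)
From HB Require Import structures.
Require Import Defs.
From mathcomp Require Import all_boot all_order all_algebra.
From mathcomp Require Import all_classical all_reals all_analysis.
From mathcomp Require Import measurable_realfun.
From mathcomp Require Import ring lra.
Set Implicit Arguments.
Unset Strict Implicit.
Unset Printing Implicit Defensive.
Import Order.TTheory GRing.Theory Num.Theory.
Import numFieldNormedType.Exports.
Local Open Scope classical_set_scope.
Local Open Scope ring_scope.

(** * Calculus in the plane *)

Section Calculus.
Context {R : realType}.
Implicit Types (f : 'rV[R]_2 -> R) (U : set 'rV[R]_2) (x y v : 'rV[R]_2).

(** The hypothesis on the norms bounds the entries of g - 1 by 1 on U; this yields g <= 4 everywhere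
    but by itself no lower bound. A lower bound comes from the first derivatives, in a Euclidean
    ball contained in U of radius at most d / 16. The logarithm is therefore estimated with the
    upper bound alone. The constants of the first variation formula depend on the coercivity of g
    along one geodesic and are not controlled, which is harmless since they multiply a second order
    term. The lower bound then serves in the small ball: the Hölder quotient of the curvature has
    d_g in its denominator, so that |x - y| <= 2 d_g is the inequality to prove there. A curve
    joining two points could leave the chart; a continuity argument excludes it for short curves,
    because closed Euclidean balls of the chart are closed in M. The curvature at a point is defined
    in a chart of the atlas, whereas the estimates live in the isometry chart. Its invariance is
    obtained by commuting the third derivatives of a transition map, which is why that map is of
    class C^3. *)

Lemma sum2E (V : nmodType) (F : 'I_2 -> V) : \sum_i F i = F 0 + F 1.
Proof. by rewrite big_ord_recl big_ord1; congr (_ + F _); apply: val_inj. Qed.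

Lemma ord2P (P : 'I_2 -> Prop) : P 0 -> P 1 -> forall i, P i.
Proof.
by move=> P0 P1 i; have [->|->] : i = 0 \/ i = 1; last exact: P1;
  [case: i => -[|[|]]// ?; [left|right]; apply: val_inj|].
Qed.

Lemma rV2E v : v = v 0 0 *: delta_mx 0 0 + v 0 1 *: delta_mx 0 1.
Proof. by rewrite [LHS]row_sum_delta sum2E. Qed.

Lemma norm_coord v i : `|v 0 i| <= `|v|.
Proof.
rewrite [leRHS]/Num.Def.normr/= mx_normrE.
exact: (le_bigmax _ (fun i : 'I_1 * 'I_2 => `|v i.1 i.2|) (0, i)).
Qed.

Lemma norm_rV2_le v e : 0 <= e -> (`|v| <= e) = (`|v 0 0| <= e) && (`|v 0 1| <= e).
Proof.
move=> e0; apply/idP/andP => [ve|[v0 v1]].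
  by split; apply: le_trans ve; exact: norm_coord.
rewrite /Num.Def.normr/= mx_normrE bigmax_le// => -[i j] _ /=.
by rewrite (ord1 i); move: j; apply: ord2P.
Qed.

Lemma is_derive_line (W : normedModType R) (F : 'rV[R]_2 -> W) y v s :
  derivable F (y + s *: v) v ->
  is_derive s (1 : R) (fun r : R => F (y + r *: v)) ('D_v F (y + s *: v)).
Proof.
rewrite /derivable /derive => dF.
have E : (fun h : R => h^-1 *: ((F \o shift (y + s *: v)) (h *: v) - F (y + s *: v)))
  = (fun h : R => h^-1 *: (((fun r : R => F (y + r *: v)) \o shift s) (h *: (1 : R))
     - F (y + s *: v))).
  apply/funext => h /=; rewrite scalerDl /GRing.scale/= mulr1.
  by rewrite [h *: v + _]addrC -addrA [s *: v + _]addrC.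
by split; rewrite /derivable /derive -E.
Qed.


Lemma mvt_closed (F dF : R -> R) (a b : R) : a <= b ->
  (forall s, a <= s <= b -> is_derive s (1 : R) F (dF s)) ->
  exists2 c, a <= c <= b & F b - F a = dF c * (b - a).
Proof.
move=> ab dFE; have [||c] := @MVT_segment R F dF a b ab.
- by move=> s /[!in_itv]/= /andP[sa sb]; apply: dFE; rewrite !ltW.
- apply: derivable_within_continuous => s /[!in_itv]/= sab.
  by have [] := dFE s sab.
- by rewrite in_itv/= => cab ->; exists c.
Qed.

Lemma mvt_line f y v (h : R) :
  (forall s : R, 0 <= s <= 1 -> derivable f (y + (s * h) *: v) v) ->
  exists2 c : R, 0 <= c <= 1 &
    f (y + h *: v) - f y = h * 'D_v f (y + (c * h) *: v).
Proof.
move=> df.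
have dfE (s : R) : 0 <= s <= 1 -> is_derive s (1 : R) (fun s => f (y + (s * h) *: v))
    (h * 'D_v f (y + (s * h) *: v)).
  move=> s01; rewrite mulrC.
  apply: (@is_derive1_comp _ (fun r => f (y + r *: v)) (fun s => s * h)).
    exact: is_derive_line (df s s01).
  rewrite -[X in is_derive _ _ _ X]mulr1 mulrC.
  have -> : (fun s => s * h) = h \*: (id : R -> R) by apply/funext => r /=; rewrite mulrC.
  by apply: is_derive_eq; rewrite /GRing.scale/= mulr1 mul1r.
have [c c01] := mvt_closed ler01 dfE.
rewrite mul1r mul0r scale0r addr0 subr0 mulr1 => E.
by exists c.
Qed.

Definition lin2 (a b : R) (v : 'rV[R]_2) : R := v 0 0 * a + v 0 1 * b.

Lemma lin2_is_linear (a b : R) : linear (lin2 a b).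
Proof. by move=> k u v; rewrite /lin2 !mxE /GRing.scale/=; ring. Qed.

HB.instance Definition _ (a b : R) :=
  GRing.isLinear.Build R 'rV[R]_2 R *:%R (lin2 a b) (lin2_is_linear a b).

Lemma lin2_continuous (a b : R) : continuous (lin2 a b).
Proof.
move=> v; rewrite /lin2.
apply: (@continuousD _ _ _ (fun u : 'rV[R]_2 => u 0 0 * a) (fun u => u 0 1 * b));
  apply: continuousM;
  by [exact: coord_continuous|exact: cst_continuous].
Qed.

Lemma diff_epsP (V W : normedModType R) (F : V -> W) (x : V) (L : {linear V -> W}) :
  continuous L ->
  (forall e : R, 0 < e -> \forall h \near (0 : V),
     `|F (x + h) - F x - L h| <= e * `|h|) ->
  differentiable F x /\ 'd F x = L :> (V -> W).
Proof.
move=> Lc H.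
have E : F \o shift x = cst (F x) + L +o_ 0 id.
  apply/eqaddoP => _/posnumP[e] /=.
  near=> h.
  rewrite -![(_ + _ : _ -> _) _]/(_ + _) -![(- _ : _ -> _) _]/(- _) /=.
  rewrite -![(_ + _ : _ -> _) _]/(_ + _) opprD addrA [h + x]addrC.
  by near: h; apply: H.
have dE := diff_unique Lc E.
by split=> //; apply/diff_locallyP; rewrite dE.
Unshelve. all: by end_near. Qed.

Lemma partialE i f x : partial i f x = 'D_(delta_mx 0 i) f x.
Proof. by []. Qed.

(* Unfolding [partial] makes failing unification problems very slow. *)
Opaque partial.

(* The value at [x + h] is reached from [x] along two coordinate segments. *)
Lemma Ck1_differentiable U f x : open U -> Ck 1 U f -> U x ->
  differentiable f x /\
  'd f x = lin2 (partial 0 f x) (partial 1 f x) :> ('rV[R]_2 -> R).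
Proof.
move=> oU [_ fU] Ux; apply: diff_epsP => [|e e0]; first exact: lin2_continuous.
have e20 : 0 < e / 2 by rewrite divr_gt0.
have pc i : \forall y \near x, `|partial i f x - partial i f y| <= e / 2.
  have [_ [/(_ x Ux) ci _]] := fU i.
  by move/cvgrPdist_le : ci => /(_ _ e20).
have : \forall y \near x, [/\ U y, `|partial 0 f x - partial 0 f y| <= e / 2 &
    `|partial 1 f x - partial 1 f y| <= e / 2].
  have oUx : nbhs x U by exact: open_nbhs_nbhs.
  by apply: filterS3 oUx (pc 0) (pc 1) => y; split.
move=> /nbhs_ballP[r /= r0 rP].
have {}rP y : `|y - x| < r -> [/\ U y, `|partial 0 f x - partial 0 f y| <= e / 2 &
    `|partial 1 f x - partial 1 f y| <= e / 2].
  by move=> yx; apply: rP; rewrite -ball_normE /= distrC.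
near=> h.
have hr : `|h| < r.
  by near: h; apply/nbhs_ballP; exists r => //= h; rewrite -ball_normE /= sub0r normrN.
pose p (s t : R) := x + (s * h 0 0) *: delta_mx 0 0 + (t * h 0 1) *: delta_mx 0 1.
have pr s t : 0 <= s <= 1 -> 0 <= t <= 1 -> `|p s t - x| < r.
  move=> /andP[s0 s1] /andP[t0 t1]; apply: le_lt_trans hr.
  rewrite norm_rV2_le// /p !mxE /= !(mulr0, mulr1, addr0, add0r).
  rewrite !(addrAC _ _ (- _)) !subrr !add0r !normrM (ger0_norm s0) (ger0_norm t0).
  by apply/andP; split; [apply: le_trans (norm_coord h 0)|apply: le_trans (norm_coord h 1)];
    rewrite ler_piMl.
have d0 i y : `|y - x| < r -> derivable f y (delta_mx 0 i).
  by move=> /rP[Uy _ _]; have [/(_ y Uy) + _] := fU i.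
have [|c c01 E0] := @mvt_line f x (delta_mx 0 0) (h 0 0).
  move=> s s01; apply: d0; have := pr s 0 s01.
  by rewrite /p mul0r scale0r addr0; apply; rewrite lexx ler01.
have [|c' c'01 E1] := @mvt_line f (x + h 0 0 *: delta_mx 0 0) (delta_mx 0 1) (h 0 1).
  move=> s s01; apply: d0; have := pr 1 s.
  by rewrite /p mul1r; apply => //; rewrite lexx ler01.
have -> : f (x + h) - f x - lin2 (partial 0 f x) (partial 1 f x) h =
    h 0 0 * (partial 0 f (p c 0) - partial 0 f x)
    + h 0 1 * (partial 1 f (p 1 c') - partial 1 f x).
  rewrite [in f _](rV2E h) addrA -[f _ - _](subrKA (f (x + h 0 0 *: delta_mx 0 0))).
  rewrite E0 E1 /lin2 /p mul0r mul1r scale0r addr0 -!partialE.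
  move: (partial _ _ _) (partial _ _ _) (partial _ _ _) (partial _ _ _) => A B C D; ring.
have [_ b0 _] := rP _ (pr c 0 c01 (introT andP (conj (lexx 0) ler01))).
have [_ _ b1] := rP _ (pr 1 c' (introT andP (conj ler01 (lexx 1))) c'01).
move: b0 b1 (norm_coord h 0) (norm_coord h 1).
move: (partial _ _ _) (partial _ _ _) (partial _ _ _) (partial _ _ _) => A B C D b0 b1 n0 n1.
apply: (le_trans (ler_normD _ _)); rewrite !normrM.
by rewrite (splitr e) mulrDl; apply: lerD; rewrite mulrC; apply: ler_pM => //; rewrite distrC.
Unshelve. all: by end_near. Qed.

(** The mean value theorem is used twice: for f(x + h e_j + s e_i) - f(x + s e_i) as a function of
    s, then for the i-th partial derivative along e_j. *)
Lemma second_difference U f x i j (r h : R) : Ck 2 U f ->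
  (forall y, `|y - x| <= r -> U y) -> 0 < h -> h + h <= r ->
  exists2 y, `|y - x| <= h + h &
    f (x + h *: delta_mx 0 i + h *: delta_mx 0 j) - f (x + h *: delta_mx 0 i)
    - f (x + h *: delta_mx 0 j) + f x = h ^+ 2 * partial j (partial i f) y.
Proof.
move=> [_ fU] rU h0 hr.
have h00 := ltW h0.
have nd k : `|delta_mx 0 k : 'rV[R]_2| <= 1.
  rewrite norm_rV2_le// !mxE/=.
  by apply/andP; split; case: eqP; rewrite ?normr1 ?normr0 ?ler01.
have near_x (s t : R) : 0 <= s <= h -> 0 <= t <= h ->
    `|x + t *: delta_mx 0 j + s *: delta_mx 0 i - x| <= h + h.
  move=> /andP[s0 sh] /andP[t0 th].
  rewrite addrAC (addrAC x) subrr add0r (le_trans (ler_normD _ _))// !normrZ.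
  rewrite (ger0_norm t0) (ger0_norm s0).
  by apply: lerD; [apply: le_trans th|apply: le_trans sh]; rewrite ler_piMr.
have inU (s t : R) : 0 <= s <= h -> 0 <= t <= h ->
    U (x + t *: delta_mx 0 j + s *: delta_mx 0 i).
  by move=> sh th; apply: rU; rewrite (le_trans (near_x _ _ sh th)).
have [[di _] [_ dij]] := (fU i, fU i).
have [_ /(_ j)[dj cj]] := dij.
have z0h : 0 <= (0 : R) <= h by rewrite lexx.
have hhh : 0 <= h <= h by rewrite lexx andbT.
have dphi (s : R) : 0 <= s <= h -> is_derive s (1 : R)
   (fun s : R => f (x + h *: delta_mx 0 j + s *: delta_mx 0 i) - f (x + s *: delta_mx 0 i))
   (partial i f (x + h *: delta_mx 0 j + s *: delta_mx 0 i)
    - partial i f (x + s *: delta_mx 0 i)).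
  rewrite !partialE.
  move=> sh; apply: is_deriveB; apply: is_derive_line; apply: di; first exact: inU.
  by have := inU s 0 sh z0h; rewrite scale0r addr0.
have [c ch E0] := mvt_closed h00 dphi.
have dpsi (t : R) : 0 <= t <= h -> is_derive t (1 : R)
   (fun t : R => partial i f (x + c *: delta_mx 0 i + t *: delta_mx 0 j))
   (partial j (partial i f) (x + c *: delta_mx 0 i + t *: delta_mx 0 j)).
  rewrite partialE.
  by move=> th; apply: is_derive_line; apply: dj; rewrite addrAC; exact: inU.
have [c' c'h E1] := mvt_closed h00 dpsi.
exists (x + c' *: delta_mx 0 j + c *: delta_mx 0 i); first exact: near_x.
move: E0 E1; rewrite !scale0r !addr0 !subr0 => E0 E1.
rewrite (addrAC x (h *: delta_mx 0 i)) (addrAC x (c' *: _)) expr2 -mulrA [h * partial _ _ _]mulrC -E1.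
by rewrite (addrAC x (c *: _)) mulrC mulrBl -!mulrBl -E0; ring.
Qed.

(** The second difference is symmetric in i and j, so it is h^2 times a value of either mixed
    derivative close to x, and both are continuous at x. *)
Lemma schwarz U f x i j : open U -> Ck 2 U f -> U x ->
  partial i (partial j f) x = partial j (partial i f) x.
Proof.
move=> oU fU Ux; apply/eqP; rewrite -subr_eq0 -normr_le0; apply/ler_addgt0Pr => e e0; rewrite add0r.
have e20 : 0 < e / 2 by rewrite divr_gt0.
have pc k l : \forall y \near x, `|partial k (partial l f) x - partial k (partial l f) y| <= e / 2.
  have [_ /(_ l)[_ [_ /(_ k)[_ [c _]]]]] := fU.
  by move/cvgrPdist_le : (c x Ux) => /(_ _ e20).
have : \forall y \near x, [/\ U y,
    `|partial i (partial j f) x - partial i (partial j f) y| <= e / 2 &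
    `|partial j (partial i f) x - partial j (partial i f) y| <= e / 2].
  have oUx : nbhs x U by exact: open_nbhs_nbhs.
  by apply: filterS3 oUx (pc i j) (pc j i) => y; split.
move=> /nbhs_ballP[r /= r0 rP].
have {}rP y : `|y - x| < r -> [/\ U y,
    `|partial i (partial j f) x - partial i (partial j f) y| <= e / 2 &
    `|partial j (partial i f) x - partial j (partial i f) y| <= e / 2].
  by move=> yx; apply: rP; rewrite -ball_normE /= distrC.
pose h := r / 4.
have h0 : 0 < h by rewrite divr_gt0.
have hr : h + h < r by rewrite /h; lra.
have rU y : `|y - x| <= h + h -> U y by move=> /le_lt_trans/(_ hr)/rP[].
have [y1 y1h E1] := second_difference i j fU rU h0 (lexx _).
have [y2 y2h E2] := second_difference j i fU rU h0 (lexx _).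
have : partial j (partial i f) y1 = partial i (partial j f) y2.
  apply: (mulfI (lt0r_neq0 (exprn_gt0 2 h0))); apply: etrans (esym E1) (etrans _ E2).
  rewrite (addrAC x (h *: delta_mx 0 i)).
  move: (f _) (f _) (f _) (f _) => A B C D; ring.
have [_ _ b1] := rP _ (le_lt_trans y1h hr).
have [_ b2 _] := rP _ (le_lt_trans y2h hr).
move: b1 b2; move: (partial i (partial j f) x) (partial j (partial i f) x) => A B b1 b2 E.
move: b1; rewrite E; move: b2; move: (partial i (partial j f) y2) => C b2 b1.
have -> : A - B = (A - C) + (C - B) by ring.
apply: (le_trans (ler_normD _ _)); rewrite [leRHS](splitr e).
apply: lerD; first exact: b2.
rewrite distrC; exact: b1.
Qed.

Lemma Ck_S k U f : Ck k.+1 U f -> Ck k U f.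
Proof.
elim: k f => [|k IH] f [cf df]; split=> // i; split; first by have [] := df i.
by apply: IH; have [] := df i.
Qed.

Lemma Ck_le k l U f : (k <= l)%N -> Ck l U f -> Ck k U f.
Proof.
move=> /subnK <-; elim: (l - k)%N => // n IH; rewrite addSn => /Ck_S; exact: IH.
Qed.

Lemma Ck_partial k U f i : Ck k.+1 U f -> Ck k U (partial i f).
Proof. by move=> [_ /(_ i)[]]. Qed.

End Calculus.

(** * Differentiation of matrix-valued functions on the plane *)

Section MatrixCalculus.
Context {R : realType}.
Implicit Types (f : 'rV[R]_2 -> R) (U : set 'rV[R]_2) (x y v : 'rV[R]_2).

Lemma partial_diff f x i : differentiable f x -> partial i f x = 'd f x (delta_mx 0 i).
Proof. by move=> df; rewrite partialE deriveE. Qed.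

Lemma diff_partial f x v : differentiable f x -> 'd f x v = \sum_i v 0 i * partial i f x.
Proof.
by move=> df; rewrite {1}(rV2E v) linearD !linearZ sum2E /= !partial_diff.
Qed.

Lemma near_add0 (V : normedModType R) (x : V) (P : V -> Prop) :
  (\forall y \near x, P y) -> \forall h \near (0 : V), P (x + h).
Proof.
move=> /nbhs_ballP[r /= r0 H]; apply/nbhs_ballP; exists r => // h.
rewrite -ball_normE/= sub0r normrN => hr; apply: H.
by rewrite -ball_normE/= opprD addrA subrr sub0r normrN.
Qed.

Lemma diff_eps (V W : normedModType R) (F : V -> W) (x : V) (e : R) :
  differentiable F x -> 0 < e ->
  \forall h \near (0 : V), `|F (x + h) - F x - 'd F x h| <= e * `|h|.
Proof.
move=> /diff_locally /eqaddoP H e0.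
have {H} := H e e0; rewrite !near_simpl; apply: filterS => h.
rewrite -![(_ + _ : _ -> _) _]/(_ + _) -![(- _ : _ -> _) _]/(- _) /=.
by rewrite -![(_ + _ : _ -> _) _]/(_ + _) opprD addrA [h + x]addrC.
Qed.

Lemma near_eq_differentiable (V W : normedModType R) (f g : V -> W) (x : V) :
  (\forall y \near x, f y = g y) -> differentiable f x -> differentiable g x.
Proof.
move=> fg df.
have [|e e0|//] := @diff_epsP _ _ _ g x ('d f x); first exact: diff_continuous.
have fgx := nbhs_singleton fg.
move: (diff_eps df e0) (near_add0 fg); apply: filterS2 => h + E.
by rewrite fgx E.
Qed.

Definition mxdiff m n (F : 'rV[R]_2 -> 'M[R]_(m, n)) x :=
  forall a b, differentiable (fun y => F y a b) x.

Definition dM m n (i : 'I_2) (F : 'rV[R]_2 -> 'M[R]_(m, n)) x : 'M[R]_(m, n) :=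
  \matrix_(a, b) partial i (fun y => F y a b) x.

Lemma dME m n i (F : 'rV[R]_2 -> 'M[R]_(m, n)) x a b :
  dM i F x a b = partial i (fun y => F y a b) x.
Proof. by rewrite mxE. Qed.

Lemma diff_sum2 (f g : 'I_2 -> 'rV[R]_2 -> R) x i :
  (forall a, differentiable (f a) x) -> (forall a, differentiable (g a) x) ->
  differentiable (fun y => \sum_a f a y * g a y) x /\
  partial i (fun y => \sum_a f a y * g a y) x =
    \sum_a (partial i (f a) x * g a x + f a x * partial i (g a) x).
Proof.
move=> df dg.
have -> : (fun y => \sum_a f a y * g a y) = (f 0 * g 0) + (f 1 * g 1).
  by apply/funext => y; rewrite sum2E.
split; first by apply: differentiableD; apply: differentiableM.
have dv := diff_derivable.
rewrite !partialE deriveD ?deriveM//; do ?[by apply: dv|by apply: dv; apply: differentiableM].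
rewrite !sum2E -!partialE /GRing.scale/=.
move: (partial i _ x) (partial i _ x) (partial i _ x) (partial i _ x) => A B C D; ring.
Qed.

Lemma dM_mul (F G : 'rV[R]_2 -> 'M[R]_2) x : mxdiff F x -> mxdiff G x ->
  mxdiff (fun y => F y *m G y) x /\
  forall i, dM i (fun y => F y *m G y) x = dM i F x *m G x + F x *m dM i G x.
Proof.
move=> dF dG.
have H a b : (fun y => (F y *m G y) a b) = fun y => \sum_c F y a c * G y c b.
  by apply/funext => y; rewrite mxE.
have K a b i := @diff_sum2 (fun c y => F y a c) (fun c y => G y c b) x i (dF a) (fun c => dG c b).
split=> [a b|i]; first by rewrite H; have [] := K a b 0.
apply/matrixP => a b; rewrite !mxE H (K a b i).2 big_split /=.
by congr (_ + _); apply: eq_bigr => c _; rewrite mxE.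
Qed.

Lemma mxpartialB (F G : 'rV[R]_2 -> 'M[R]_2) x i : mxdiff F x -> mxdiff G x ->
  dM i (fun y => F y - G y) x = dM i F x - dM i G x.
Proof.
move=> dF dG; apply/matrixP => a b; rewrite !mxE !partialE -deriveB.
- by congr ('D_ _ _ _); apply/funext => y; rewrite !mxE.
- exact: diff_derivable.
- exact: diff_derivable.
Qed.

Lemma dM_tr (F : 'rV[R]_2 -> 'M[R]_2) x : mxdiff F x ->
  mxdiff (fun y => (F y)^T) x /\ forall i, dM i (fun y => (F y)^T) x = (dM i F x)^T.
Proof.
move=> dF.
have H a b : (fun y => ((F y)^T) a b) = fun y => F y b a by apply/funext => y; rewrite mxE.
split=> [a b|i]; first by rewrite H.
by apply/matrixP => a b; rewrite !mxE H.
Qed.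

Lemma near_dM m n (F G : 'rV[R]_2 -> 'M[R]_(m, n)) x : (\forall y \near x, F y = G y) ->
  (mxdiff F x -> mxdiff G x) /\ forall i, dM i F x = dM i G x.
Proof.
move=> FG; split=> [dF a b|i].
  apply: near_eq_differentiable (dF a b).
  by apply: filterS FG => y ->.
apply/matrixP => a b; rewrite !mxE !partialE; apply: near_eq_derive.
by apply: filterS FG => y ->.
Qed.

Lemma differentiable_rV (V : normedModType R) (Phi : V -> 'rV[R]_2) (x : V) :
  (forall a, differentiable (fun z => Phi z 0 a) x) -> differentiable Phi x.
Proof.
move=> dP.
have -> : Phi = (fun z => Phi z 0 0 *: delta_mx 0 0) \+ (fun z => Phi z 0 1 *: delta_mx 0 1).
  by apply/funext => z /=; rewrite -rV2E.
by apply: differentiableD; apply: differentiableZl.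
Qed.

Lemma diff_coord (V : normedModType R) (Phi : V -> 'rV[R]_2) (x v : V) a : differentiable Phi x ->
  differentiable (fun z => Phi z 0 a) x /\
  'd (fun z => Phi z 0 a) x v = ('d Phi x v) 0 a.
Proof.
move=> dP.
have dc : differentiable (fun u : 'rV[R]_2 => u 0 a) (Phi x) by exact: differentiable_coord.
have -> : (fun z => Phi z 0 a) = (fun u : 'rV[R]_2 => u 0 a) \o Phi by [].
split; first exact: differentiable_comp.
rewrite diff_comp//=.
have E : (fun u : 'rV[R]_2 => u 0 a) = lin2 (a == 0)%:R (a == 1)%:R.
  apply/funext => u; rewrite /lin2; move: a {dc}; apply: ord2P; rewrite /= !(mulr1, mulr0, add0r, addr0)//.
have /esym := congr1 (@^~ ('d Phi x v)) E.
by rewrite {1}E (diff_lin _ (@lin2_continuous _ _ _)).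
Qed.

Lemma partial_comp f (Phi : 'rV[R]_2 -> 'rV[R]_2) x :
  (forall a, differentiable (fun y => Phi y 0 a) x) -> differentiable f (Phi x) ->
  differentiable (f \o Phi) x /\
  forall i, partial i (f \o Phi) x = \sum_a jac Phi x i a * partial a f (Phi x).
Proof.
move=> /differentiable_rV dP df.
have dc : differentiable (f \o Phi) x by exact: differentiable_comp.
split=> // i; rewrite partial_diff// diff_comp//= diff_partial//.
apply: eq_bigr => a _; rewrite mxE; congr (_ * _).
have [da E] := diff_coord (delta_mx 0 i) a dP.
by rewrite partial_diff.
Qed.

Lemma dM_comp m n (F : 'rV[R]_2 -> 'M[R]_(m, n)) (Phi : 'rV[R]_2 -> 'rV[R]_2) x :
  (forall a, differentiable (fun y => Phi y 0 a) x) -> mxdiff F (Phi x) ->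
  mxdiff (fun y => F (Phi y)) x /\
  forall i, dM i (fun y => F (Phi y)) x = \sum_a jac Phi x i a *: dM a F (Phi x).
Proof.
move=> dP dF; split=> [a b|i].
  by have [] := partial_comp dP (dF a b).
apply/matrixP => a b; rewrite !mxE summxE.
have [_ /(_ i)] := partial_comp dP (dF a b).
by move=> ->; apply: eq_bigr => c _; rewrite !mxE.
Qed.

Lemma is_derive_comp_curve f (y : R -> 'rV[R]_2) (t : R) dy :
  is_derive t (1 : R) y dy -> differentiable f (y t) ->
  is_derive t (1 : R) (f \o y) (\sum_a dy 0 a * partial a f (y t)).
Proof.
move=> [dyt Ey] df.
have dy' : differentiable y t by apply/derivable1_diffP.
have dc : differentiable (f \o y) t by exact: differentiable_comp.
split; first exact: diff_derivable.
by rewrite deriveE// diff_comp//= diff_partial// -deriveE// Ey.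
Qed.

End MatrixCalculus.

(** * Algebraic identities for 2 x 2 matrices *)

Section MatrixAlgebra.
Context {R : realType}.
Implicit Types (A B G J S : 'M[R]_2) (v : 'rV[R]_2).

Definition adj2 A : 'M[R]_2 :=
  \matrix_(i, j) if i == j then A (1 - i) (1 - i) else - A i j.

Lemma matrix2P A B : A 0 0 = B 0 0 -> A 0 1 = B 0 1 -> A 1 0 = B 1 0 -> A 1 1 = B 1 1 -> A = B.
Proof.
move=> E00 E01 E10 E11; apply/matrixP => i j; move: i; apply: ord2P; by move: j; apply: ord2P.
Qed.

Lemma mulmx2E m n (A : 'M[R]_(m, 2)) (B : 'M[R]_(2, n)) i j :
  (A *m B) i j = A i 0 * B 0 j + A i 1 * B 1 j.
Proof. by rewrite mxE sum2E. Qed.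

Lemma det2E A : \det A = A 0 0 * A 1 1 - A 0 1 * A 1 0.
Proof.
rewrite (expand_det_row _ 0) sum2E /cofactor !det_mx11 !mxE /=.
have -> : lift 0 0 = 1 :> 'I_2 by apply: val_inj.
have -> : lift 1 0 = 0 :> 'I_2 by apply: val_inj.
by rewrite modn_small//= expr0 expr1; ring.
Qed.

Lemma qform2E A v : qform A v =
  A 0 0 * v 0 0 ^+ 2 + (A 0 1 + A 1 0) * (v 0 0 * v 0 1) + A 1 1 * v 0 1 ^+ 2.
Proof. by rewrite /qform !mulmx2E !mxE; ring. Qed.

Lemma mul_adj2 A : adj2 A *m A = (\det A)%:M.
Proof.
have e : 1 - 1 = 0 :> 'I_2 by apply: val_inj.
by rewrite det2E; apply: matrix2P; rewrite mulmx2E !mxE /= ?e ?subr0 ?mulr1n ?mulr0n; ring.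
Qed.

Lemma invmx2E A : \det A != 0 -> invmx A = (\det A)^-1 *: adj2 A.
Proof.
move=> dA.
have uA : A \in unitmx by rewrite unitmxE unitfE.
by rewrite -[RHS](mulmxK uA) -scalemxAl mul_adj2 scale_scalar_mx mulVf// mul1mx.
Qed.

Lemma posdef_det A : A^T = A -> (forall v, v != 0 -> 0 < qform A v) -> 0 < A 0 0 /\ 0 < \det A.
Proof.
move=> sA pA.
have A01 : A 0 1 = A 1 0 by rewrite -[in LHS]sA mxE.
have row2 (a b : R) : exists v : 'rV[R]_2, v 0 0 = a /\ v 0 1 = b.
  by exists (\row_j if j == 0 then a else b); rewrite !mxE.
have nz v : v 0 0 != 0 -> v != 0.
  by apply: contraNneq => ->; rewrite mxE.
have nz1 v : v 0 1 != 0 -> v != 0.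
  by apply: contraNneq => ->; rewrite mxE.
have A00 : 0 < A 0 0.
  have [v [v0 v1]] := row2 1 0.
  by have := pA v (nz v _); rewrite qform2E v0 v1 oner_eq0 expr1n !mulr0 expr0n !mulr0 !addr0 mulr1; apply.
split=> //.
(* On this vector the form takes the value [A 0 0] times the determinant. *)
have [v [v0 v1]] := row2 (- A 1 0) (A 0 0).
have := pA v (nz1 v _); rewrite qform2E v0 v1 (gt_eqF A00) => /(_ isT).
rewrite A01 det2E A01.
have -> : A 0 0 * (- A 1 0) ^+ 2 + (A 1 0 + A 1 0) * (- A 1 0 * A 0 0) + A 1 1 * A 0 0 ^+ 2
  = A 0 0 * (A 0 0 * A 1 1 - A 1 0 * A 1 0) by ring.
by rewrite pmulr_rgt0.
Qed.

(** In dimension two the antisymmetric matrices form a line, on which congruence by J acts as the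
    scalar det J. This reduces the comparison of lowered curvatures in two charts to that of two
    numbers. *)
Lemma congr_antisym J S : S^T = - S -> J *m S *m J^T = \det J *: S.
Proof.
move=> /matrixP aS.
have S00 : S 0 0 = 0 by have := aS 0 0; rewrite !mxE; lra.
have S11 : S 1 1 = 0 by have := aS 1 1; rewrite !mxE; lra.
have S10 : S 1 0 = - S 0 1 by have := aS 0 1; rewrite !mxE.
rewrite det2E; apply: matrix2P; rewrite mulmx2E !mulmx2E !mxE S00 S11 S10; ring.
Qed.

(* Koszul's formula: a torsion-free connection compatible with the metric is
   determined by the first derivatives [D] of the metric. *)
Lemma koszul (A D : 'I_2 -> 'M[R]_2) G : G^T = G ->
  (forall i, D i = A i *m G + G *m (A i)^T) -> (forall i j l, A i j l = A j i l) ->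
  forall i j l, (A i *m G) j l = 2^-1 * (D i j l + D j i l - D l i j).
Proof.
move=> sG cD tf i j l.
have DE a b c : D a b c = (A a *m G) b c + (A a *m G) c b.
  have -> : D a = A a *m G + (A a *m G)^T by rewrite trmx_mul sG cD.
  by rewrite mxE [X in _ + X]mxE.
have sS a b c : (A a *m G) b c = (A b *m G) a c by rewrite !mxE; apply: eq_bigr => m _; rewrite tf.
rewrite !DE (sS i l j) (sS j l i) (sS l j i) (sS j i l).
move: ((A i *m G) j l) ((A l *m G) i j) ((A j *m G) l i) => a b c.
by field.
Qed.

(** The curvature of a pulled back connection, as pure algebra: P stands for the connection
    matrices, Q for their derivatives, Jm for the Jacobian and S for the second derivatives of the
    change of coordinates. The terms in S cancel by symmetry; the rest is alternating in the two
    directions, whence the factor det Jm. *)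
Lemma pulled_curvature (Jm : 'M[R]_2) (S : 'I_2 -> 'I_2 -> 'I_2 -> R) (P : 'I_2 -> 'M[R]_2)
    (Q : 'I_2 -> 'I_2 -> 'M[R]_2) (B : 'I_2 -> 'M[R]_2) :
  (forall a, S 0 1 a = S 1 0 a) ->
  (forall i, B i = \sum_a Jm i a *: P a) ->
  \sum_a (S 0 1 a *: P a + Jm 1 a *: \sum_b Jm 0 b *: Q b a)
  - \sum_a (S 1 0 a *: P a + Jm 0 a *: \sum_b Jm 1 b *: Q b a)
  + B 1 *m B 0 - B 0 *m B 1
  = \det Jm *: (Q 0 1 - Q 1 0 + P 1 *m P 0 - P 0 *m P 1).
Proof.
move=> sS BE; rewrite !BE !sum2E !sS det2E.
apply/matrixP => k l; rewrite !(mxE, sum2E) /=.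
move: (S _ _ _) (S _ _ _) => s0 s1.
ring.
Qed.

End MatrixAlgebra.

(** * The Levi-Civita connection in coordinates *)

Section LeviCivita.
Context {R : realType} (U : set 'rV[R]_2) (g : 'rV[R]_2 -> 'M[R]_2).
Hypotheses (oU : open U) (gU : riemannian_metric U g).
Implicit Types x : 'rV[R]_2.

(* Row-vector convention: nabla_i X_j is the combination of the coordinate fields
   with coefficients the row [j] of [chrM i]; this reverses the order of the
   products in the curvature. *)
Definition chrM i x : 'M[R]_2 := \matrix_(j, l) christoffel g l i j x.

(* Christoffel symbols of the first kind, [chrM i x *m g x]. *)
Definition lowM i x : 'M[R]_2 := \matrix_(j, l)
  (2^-1 * (partial i (fun y => g y j l) x + partial j (fun y => g y i l) x
           - partial l (fun y => g y i j) x)).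

Definition riemM i j x : 'M[R]_2 :=
  dM i (chrM j) x - dM j (chrM i) x + chrM j x *m chrM i x - chrM i x *m chrM j x.

Lemma near_open x (P : 'rV[R]_2 -> Prop) : U x -> (forall y, U y -> P y) -> \forall y \near x, P y.
Proof.
move=> Ux UP; have oUx : nbhs x U by exact: open_nbhs_nbhs.
by apply: filterS oUx => y /UP.
Qed.

Lemma rmetric_sym x : U x -> (g x)^T = g x. Proof. by move=> /(gU.2 x)[]. Qed.

Lemma rmetric_symE x a b : U x -> g x a b = g x b a.
Proof. by move=> /rmetric_sym {1}<-; rewrite mxE. Qed.

Lemma rmetric_det x : U x -> 0 < \det (g x).
Proof. by move=> Ux; have [sg /(posdef_det sg)[]] := gU.2 x Ux. Qed.

Lemma rmetric_unit x : U x -> g x \in unitmx.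
Proof. by move=> Ux; rewrite unitmxE unitfE gt_eqF// rmetric_det. Qed.

Lemma rmetric_diff x a b : U x -> differentiable (fun y => g y a b) x.
Proof. by move=> Ux; have [] := Ck1_differentiable oU (Ck_S (gU.1 a b)) Ux. Qed.

Lemma rmetric_partial_diff x i a b : U x -> differentiable (partial i (fun y => g y a b)) x.
Proof. by move=> Ux; have [] := Ck1_differentiable oU (Ck_partial i (gU.1 a b)) Ux. Qed.

Lemma rmetric_partial_sym x i a b : U x ->
  partial i (fun y => g y a b) x = partial i (fun y => g y b a) x.
Proof.
move=> Ux; rewrite !partialE; apply: near_eq_derive.
by apply: near_open => // y Uy; exact: rmetric_symE.
Qed.

Lemma rmetric_schwarz x i j a b : U x ->
  partial i (partial j (fun y => g y a b)) x = partial j (partial i (fun y => g y a b)) x.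
Proof. exact: schwarz (gU.1 a b). Qed.

Lemma chrM_torsion_free x i j l : U x -> chrM i x j l = chrM j x i l.
Proof.
move=> Ux; rewrite !mxE /christoffel; congr (_ * _); apply: eq_bigr => m _.
by rewrite (rmetric_partial_sym m i j Ux) [X in X - _]addrC.
Qed.

Lemma chrME x i : U x -> chrM i x = lowM i x *m invmx (g x).
Proof.
move=> Ux; have -> : invmx (g x) = (invmx (g x))^T by rewrite trmx_inv rmetric_sym.
apply/matrixP => j l; rewrite !mxE /christoffel mulr_sumr; apply: eq_bigr => m _.
by rewrite !mxE; ring.
Qed.

Lemma chrM_low x i : U x -> chrM i x *m g x = lowM i x.
Proof. by move=> Ux; rewrite chrME// mulmxKV ?rmetric_unit. Qed.

(** Adding [lowM] to its transpose doubles the first term of Koszul's formula and cancels the two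
    others. *)
Lemma chrM_metric x i : U x -> dM i g x = chrM i x *m g x + g x *m (chrM i x)^T.
Proof.
move=> Ux; have -> : g x *m (chrM i x)^T = (lowM i x)^T.
  by rewrite -{1}(rmetric_sym Ux) -trmx_mul chrM_low.
rewrite chrM_low//; apply/matrixP => a b; rewrite !mxE.
rewrite (rmetric_partial_sym i b a Ux) (rmetric_partial_sym a i b Ux) (rmetric_partial_sym b i a Ux).
move: (partial _ _ x) (partial _ _ x) (partial _ _ x) => p q r; by field.
Qed.

Lemma lowM_diff x i : U x -> mxdiff (lowM i) x.
Proof.
move=> Ux a b.
have -> : (fun y => lowM i y a b) = fun y => 2^-1 * (partial i (fun y => g y a b) y
    + partial a (fun y => g y i b) y - partial b (fun y => g y i a) y).
  by apply/funext => y; rewrite mxE.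
have d := rmetric_partial_diff.
apply: differentiableM; first exact: differentiable_cst.
apply: differentiableB; last exact: d.
by apply: differentiableD; exact: d.
Qed.

Lemma dM_lowM x i j k l : U x -> dM i (lowM j) x k l =
  2^-1 * (partial i (partial j (fun y => g y k l)) x + partial i (partial k (fun y => g y j l)) x
          - partial i (partial l (fun y => g y j k)) x).
Proof.
move=> Ux; rewrite mxE.
have -> : (fun y => lowM j y k l) = 2^-1 \*: ((partial j (fun y => g y k l)
    + partial k (fun y => g y j l)) - partial l (fun y => g y j k)).
  by apply/funext => y; rewrite mxE.
have d m a b c : derivable (partial a (fun y => g y b c)) x (delta_mx 0 m).
  by apply: diff_derivable; exact: rmetric_partial_diff.
rewrite partialE deriveZ; last by apply: derivableB => //; apply: derivableD.
by rewrite deriveB//; [rewrite deriveD|apply: derivableD].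
Qed.

Lemma invmx_metric_diff x : U x -> mxdiff (fun y => invmx (g y)) x.
Proof.
move=> Ux.
have H : \forall y \near x, (\det (g y))^-1 *: adj2 (g y) = invmx (g y).
  by apply: near_open => // y Uy; rewrite invmx2E// gt_eqF// rmetric_det.
apply: (near_dM H).1 => a b.
have -> : (fun y => ((\det (g y))^-1 *: adj2 (g y)) a b) =
   (fun y => ((fun y => g y 0 0 * g y 1 1 - g y 0 1 * g y 1 0) y)^-1) * (fun y => adj2 (g y) a b).
  by apply/funext => y; rewrite mxE det2E.
have d a' b' := rmetric_diff a' b' Ux.
apply: differentiableM.
  apply: differentiableV; last by rewrite -det2E gt_eqF// rmetric_det.
  by apply: differentiableB; apply: differentiableM.
have -> : (fun y => adj2 (g y) a b) =
    if a == b then (fun y => g y (1 - a) (1 - a)) else - (fun y => g y a b).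
  by apply/funext => y; rewrite mxE; case: ifP.
by case: ifP => _ //; exact: differentiableN.
Qed.

Lemma chrM_diff x i : U x -> mxdiff (chrM i) x.
Proof.
move=> Ux; have H : \forall y \near x, lowM i y *m invmx (g y) = chrM i y.
  by apply: near_open => // y Uy; rewrite chrME.
apply: (near_dM H).1.
by have [] := dM_mul (lowM_diff i Ux) (invmx_metric_diff Ux).
Qed.

(** The product rule is applied to [chrM_low] and the derivative of g is replaced by [chrM_metric];
    the products of two connection matrices then cancel those of [riemM]. The inverse of g is no
    longer differentiated, and the second derivatives of g enter linearly. *)
Lemma riemM_low x i j : U x -> riemM i j x *m g x =
  dM i (lowM j) x - dM j (lowM i) x - lowM j x *m (chrM i x)^T + lowM i x *m (chrM j x)^T.
Proof.
move=> Ux.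
have E a b : dM a (chrM b) x *m g x =
    dM a (lowM b) x - chrM b x *m (chrM a x *m g x) - lowM b x *m (chrM a x)^T.
  have H : \forall y \near x, chrM b y *m g y = lowM b y.
    by apply: near_open => // y Uy; rewrite chrM_low.
  have dg : mxdiff g x by move=> c d; exact: rmetric_diff.
  rewrite -((near_dM H).2 a) (dM_mul (chrM_diff b Ux) dg).2 (chrM_metric a Ux) -(chrM_low b Ux).
  rewrite mulmxDr !mulmxA.
  move: (dM a _ x *m _) (_ *m chrM a x *m g x) (_ *m (chrM a x)^T) => X Y Z.
  by apply/matrixP => k l; rewrite !mxE; ring.
rewrite /riemM !(mulmxDl, mulNmx, E) -!mulmxA.
move: (chrM i x *m (_ *m _)) (chrM j x *m (_ *m _)) (_ *m (chrM i x)^T) (_ *m (chrM j x)^T) (dM i _ x) (dM j _ x).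
by move=> X Y Z W D D'; apply/matrixP => k l; rewrite !mxE; ring.
Qed.

(** Transposition exchanges the two quadratic terms, since L_b A_a^T = L_b g^-1 L_a^T. In the linear
    part the second derivatives of g_kl cancel by Schwarz, and what remains changes sign when k and
    l are exchanged. *)
Lemma riemM_antisym x i j : U x -> (riemM i j x *m g x)^T = - (riemM i j x *m g x).
Proof.
move=> Ux.
have T a b : (lowM b x *m (chrM a x)^T)^T = lowM a x *m (chrM b x)^T.
  rewrite trmx_mul trmxK (chrME a)// (chrME b)// trmx_mul trmx_inv rmetric_sym//.
  by rewrite mulmxA.
rewrite riemM_low//; apply/matrixP => a b.
move: (T i j) (T j i) (fun k l => @dM_lowM x i j k l Ux) (fun k l => @dM_lowM x j i k l Ux).
move: (lowM j x *m _) (lowM i x *m _) (dM _ (lowM j) x) (dM _ (lowM i) x).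
move=> X Y D D' XY YX DE DE'; rewrite -XY !mxE !DE !DE'.
rewrite (rmetric_schwarz j i)// (rmetric_schwarz j a)// (rmetric_schwarz j b)//.
rewrite (rmetric_schwarz j i a b)//.
move: (partial i _ x) (partial i _ x) (partial i _ x) (partial i _ x).
move: (partial b _ x) (partial a _ x) => *.
by ring.
Qed.

Lemma gauss_riemM x : gauss_curvature_coord g x = (riemM 0 1 x *m g x) 1 0 / \det (g x).
Proof.
rewrite /gauss_curvature_coord; congr (_ / _).
rewrite mxE; apply: eq_bigr => l _; rewrite mulrC; congr (_ * _).
rewrite /riemann /riemM !mxE sumrB.
have E i k : (fun y => chrM i y k l) = christoffel g l i k by apply/funext => y; rewrite mxE.
rewrite !E addrA; congr (_ + _ - _); apply: eq_bigr => m _; by rewrite !mxE mulrC.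
Qed.
End LeviCivita.

Lemma jac_entry (R : realType) (F : 'rV[R]_2 -> 'rV[R]_2) x i j :
  jac F x i j = partial i (fun y => F y 0 j) x.
Proof. by rewrite mxE. Qed.

Lemma chrM_entry (R : realType) (g : 'rV[R]_2 -> 'M[R]_2) i x j l :
  chrM g i x j l = christoffel g l i j x.
Proof. by rewrite mxE. Qed.

Lemma riemM_def (R : realType) (g : 'rV[R]_2 -> 'M[R]_2) i j x :
  riemM g i j x = dM i (chrM g j) x - dM j (chrM g i) x
                  + chrM g j x *m chrM g i x - chrM g i x *m chrM g j x.
Proof. by []. Qed.

Opaque dM jac chrM lowM riemM christoffel.

Lemma Ck_subset (R : realType) k (U O : set 'rV[R]_2) f : O `<=` U -> Ck k U f -> Ck k O f.
Proof.
move=> OU; elim: k f => [|k IH] f [cf df]; first by split=> // x /OU /cf.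
split=> [x /OU /cf//|i].
by have [dfi dfk] := df i; split=> [x /OU /dfi//|]; exact: IH.
Qed.

Lemma riemannian_metric_subset (R : realType) (U O : set 'rV[R]_2) g :
  O `<=` U -> riemannian_metric U g -> riemannian_metric O g.
Proof.
move=> OU [gC gP]; split=> [i j|x /OU /gP//]; exact: Ck_subset (gC i j).
Qed.

(** * Transformation laws of the connection and of the curvature *)

Section ChangeOfCoordinates.
Context {R : realType} (O U : set 'rV[R]_2) (g h : 'rV[R]_2 -> 'M[R]_2).
Context (Phi : 'rV[R]_2 -> 'rV[R]_2).
Hypotheses (oO : open O) (oU : open U).
Hypotheses (gO : riemannian_metric O g) (hU : riemannian_metric U h).
Hypotheses (PhiC : Ck_map 3 O Phi) (PhiU : forall x, O x -> U (Phi x)).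
Hypothesis gh : forall x, O x -> g x = jac Phi x *m h (Phi x) *m (jac Phi x)^T.
Implicit Types x : 'rV[R]_2.

Notation J := (jac Phi).

(** The pullback under Phi of the connection of h, seen as a matrix-valued one-form: the form index
    is transformed, the frame is not. *)
Definition pulled i x := \sum_a J x i a *: chrM h a (Phi x).

Lemma pulledE i x k l : pulled i x k l =
  J x i 0 * chrM h 0 (Phi x) k l + J x i 1 * chrM h 1 (Phi x) k l.
Proof. by rewrite /pulled sum2E mxE [X in X + _]mxE [X in _ + X]mxE. Qed.

Lemma Phi_diff x a : O x -> differentiable (fun y => Phi y 0 a) x.
Proof. by move=> Ox; have [] := Ck1_differentiable oO (@Ck_le _ 1 3 _ _ isT (PhiC a)) Ox. Qed.

Lemma jacE a b : (fun y => J y a b) = partial a (fun y => Phi y 0 b).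
Proof. by apply/funext => y; rewrite jac_entry. Qed.

Lemma jac_diff x : O x -> mxdiff J x.
Proof.
move=> Ox a b; rewrite (jacE a b).
by have [] := Ck1_differentiable oO (@Ck_le _ 1 2 _ _ isT (Ck_partial a (PhiC b))) Ox.
Qed.

Lemma dM_jac_sym x i a b : O x -> dM i J x a b = dM a J x i b.
Proof.
move=> Ox; rewrite [LHS]dME [RHS]dME (jacE a b) (jacE i b).
have H := @Ck_le _ 2 3 _ _ isT (PhiC b).
exact: (schwarz i a oO H Ox).
Qed.

Lemma dM_jacC x i j : O x -> dM j (dM i J) x = dM i (dM j J) x.
Proof.
move=> Ox; apply/matrixP => a b.
have E c : (fun y => dM c J y a b) = partial c (partial a (fun y => Phi y 0 b)).
  by apply/funext => y; rewrite dME (jacE a b).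
have H := schwarz j i oO (Ck_partial a (PhiC b)) Ox.
rewrite -(E i) -(E j) in H.
by rewrite [LHS]dME [RHS]dME.
Qed.

Lemma det_jac_neq0 x : O x -> \det (J x) != 0.
Proof.
move=> Ox; have := rmetric_det gO Ox; rewrite gh// !det_mulmx => /gt_eqF/negbT.
by rewrite !mulf_eq0 !negb_or => /andP[/andP[]].
Qed.

Lemma jac_unit x : O x -> J x \in unitmx.
Proof. by move=> Ox; rewrite unitmxE unitfE det_jac_neq0. Qed.

(* The transformation law of the Christoffel symbols: the right-hand side
   times [J^-1] is torsion-free and compatible with [g]. *)
Lemma chrM_change x i : O x -> chrM g i x *m J x = dM i J x + J x *m pulled i x.
Proof.
move=> Ox; have Ux := PhiU Ox.
pose B a := dM a J x + J x *m pulled a x.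
pose A a := B a *m invmx (J x).
have AJ a : A a *m J x = B a by rewrite mulmxKV// jac_unit.
have Btf a j l : B a j l = B j a l.
  rewrite /B; move: (dM_jac_sym a j l Ox); move: (dM a J x) (dM j J x) => D D' DE.
  rewrite [LHS]mxE [RHS]mxE DE; congr (_ + _).
  rewrite [LHS]mulmx2E [RHS]mulmx2E (pulledE a x 0) (pulledE a x 1) (pulledE j x 0) (pulledE j x 1).
  rewrite (chrM_torsion_free oU hU 1 0 l Ux).
  move: (J x j 0) (J x j 1) (J x a 0) (J x a 1) => *; ring.
have Atf a j l : A a j l = A j a l.
  by rewrite /A [LHS]mulmx2E [RHS]mulmx2E (Btf a j 0) (Btf a j 1).
have Ag a : dM a g x = A a *m g x + g x *m (A a)^T.
  have H : \forall y \near x, J y *m h (Phi y) *m (J y)^T = g y.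
    by apply: (near_open oO Ox) => y Oy; rewrite gh.
  have dJ := jac_diff Ox.
  have [dh dhE] := dM_comp (fun a => Phi_diff a Ox) (fun a b => rmetric_diff oU hU a b Ux).
  have [dJh dJhE] := dM_mul dJ dh.
  have [dJT dJTE] := dM_tr dJ.
  rewrite -((near_dM H).2 a) (dM_mul dJh dJT).2 dJhE dJTE dhE.
  have -> : \sum_a0 J x a a0 *: dM a0 h (Phi x) =
     pulled a x *m h (Phi x) + h (Phi x) *m (pulled a x)^T.
    rewrite /pulled !sum2E !(chrM_metric oU hU _ Ux) [(_ + _)^T]linearD /= ![(_ *: _)^T]linearZ /=.
    move: (chrM h 0 _) (chrM h 1 _) (h _) (J x a 0) (J x a 1) => C0 C1 H' j0 j1.
    rewrite !mulmxDl !mulmxDr -!scalemxAl -!scalemxAr !scalerDr addrACA//.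
  have -> : A a *m g x = B a *m h (Phi x) *m (J x)^T by rewrite gh// !mulmxA AJ.
  have -> : g x *m (A a)^T = J x *m h (Phi x) *m (B a)^T.
    by rewrite gh// -mulmxA -trmx_mul AJ.
  rewrite /B; move: (dM a J x) (J x) (h (Phi x)) (pulled a x) => D K H' P.
  rewrite [(D + _)^T]linearD /= trmx_mul !(mulmxDl, mulmxDr) !mulmxA -!addrA.
  by congr (_ + (_ + _)); rewrite addrC.
have E : A i *m g x = chrM g i x *m g x.
  have K := koszul (rmetric_sym gO Ox).
  apply/matrixP => j l; rewrite (K A (fun a => dM a g x))// (K (fun a => chrM g a x) (fun a => dM a g x))// => [a|a b c].
    exact: (chrM_metric oO gO).
  exact: (chrM_torsion_free oO gO).
have <- : A i = chrM g i x.
  by rewrite -[LHS](mulmxK (rmetric_unit gO Ox)) E mulmxK// (rmetric_unit gO).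
exact: AJ.
Qed.

Lemma pulled_diff x i : O x -> mxdiff (pulled i) x /\
  forall j, dM j (pulled i) x = \sum_a (dM j J x i a *: chrM h a (Phi x)
                               + J x i a *: \sum_b J x j b *: dM b (chrM h a) (Phi x)).
Proof.
move=> Ox; have Ux := PhiU Ox.
have dP a := @Phi_diff x a Ox.
have dh a := dM_comp dP (chrM_diff oU hU a Ux).
have dJ := jac_diff Ox i.
have E k l : (fun y => pulled i y k l) = fun y => \sum_a J y i a * chrM h a (Phi y) k l.
  by apply/funext => y; rewrite pulledE sum2E.
have D j k l := @diff_sum2 _ (fun a y => J y i a) (fun a y => chrM h a (Phi y) k l) x j
   dJ (fun a => (dh a).1 k l).
split=> [k l|j].
  rewrite (E k l).
  exact: (D 0 k l).1.
apply/matrixP => k l; have := (D j k l).2; rewrite -(E k l) -dME => ->.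
rewrite [RHS]summxE; apply: eq_bigr => a _.
have -> : partial j (fun y => chrM h a (Phi y) k l) x =
    (\sum_b J x j b *: dM b (chrM h a) (Phi x)) k l.
  by rewrite -((dh a).2 j) [RHS]dME.
rewrite -dME; move: (\sum_b _) (dM j J x) => X Z.
by rewrite [RHS]mxE [X in _ = X + _]mxE [X in _ = _ + X]mxE.
Qed.

(** The law [chrM_change] is a linear system for the derivatives of the Jacobian. Equating the two
    mixed second derivatives of J, which are third derivatives of Phi, gives its integrability
    condition; [pulled_curvature] identifies this condition with the stated relation. *)
Lemma riemM_change x : O x ->
  riemM g 0 1 x *m J x = \det (J x) *: (J x *m riemM h 0 1 (Phi x)).
Proof.
move=> Ox; have Ux := PhiU Ox.
have dJ := jac_diff Ox.
have dJE a : dM a J x = chrM g a x *m J x - J x *m pulled a x.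
  by rewrite chrM_change// addrK.
have E a b : dM b (dM a J) x = dM b (chrM g a) x *m J x + chrM g a x *m dM b J x
   - (dM b J x *m pulled a x + J x *m dM b (pulled a) x).
  have [d1 E1] := dM_mul (chrM_diff oO gO a Ox) dJ.
  have [d2 E2] := dM_mul dJ (pulled_diff a Ox).1.
  rewrite -E1 -E2 -mxpartialB//.
  apply: (near_dM _).2; apply: (near_open oO Ox) => y Oy.
  by rewrite chrM_change// addrK.
have H := dM_jacC 0 1 Ox.
have PC := @pulled_curvature _ (J x) (fun i j a => dM i J x j a)
  (fun a => chrM h a (Phi x)) (fun b a => dM b (chrM h a) (Phi x)) (fun i => pulled i x)
  (fun a => dM_jac_sym 0 1 a Ox) (fun i => erefl).
rewrite -(pulled_diff 1 Ox).2 -(pulled_diff 0 Ox).2 in PC.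
move: H; rewrite (E 0 1) (E 1 0) (dJE 0) (dJE 1) => H.
rewrite scalemxAr -[_ *: riemM h _ _ _]PC riemM_def.
move: H; move: (dM 1 (chrM g 0) x) (dM 0 (chrM g 1) x) (dM 1 (pulled 0) x) (dM 0 (pulled 1) x).
move: (chrM g 0 x) (chrM g 1 x) (pulled 0 x) (pulled 1 x) (J x) => A0 A1 B0 B1 K D10 D01 P10 P01.
rewrite !(mulmxDl, mulmxDr, mulmxN, mulNmx) !mulmxA.
move: (D10 *m K) (A0 *m A1 *m K) (A0 *m K *m B1) (A1 *m K *m B0) (K *m B1 *m B0) (K *m P10).
move: (D01 *m K) (A1 *m A0 *m K) (K *m B0 *m B1) (K *m P01).
move=> M1 M2 M3 M4 M5 M6 M7 M8 M9 M10 /matrixP H.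
by apply/matrixP => k l; move: (H k l); rewrite !mxE; lra.
Qed.

(** Lowering an index makes the curvature antisymmetric, so [congr_antisym] contributes a second
    factor det J. The resulting (det J)^2 is also the ratio of det g to det h. *)
Lemma gauss_curvature_change x : O x ->
  gauss_curvature_coord g x = gauss_curvature_coord h (Phi x).
Proof.
move=> Ox; have Ux := PhiU Ox.
rewrite !gauss_riemM.
have E : riemM g 0 1 x *m g x = \det (J x) ^+ 2 *: (riemM h 0 1 (Phi x) *m h (Phi x)).
  have RC := riemM_change Ox; have RA := riemM_antisym oU hU 0 1 Ux.
  rewrite (gh Ox); move: RC RA.
  move: (riemM g 0 1 x) (riemM h 0 1 (Phi x)) (h (Phi x)) (J x) => Rg Rh H K RC RA.
  by rewrite !mulmxA RC -!scalemxAl -(mulmxA K) congr_antisym// scalerA -expr2.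
rewrite E gh// !det_mulmx det_tr mxE.
have := det_jac_neq0 Ox; have := rmetric_det hU Ux.
move: (\det (J x)) (\det (h _)) (_ 1 0) => dJ dh c; rewrite lt0r => /andP[dh0 _] dJ0.
by field; rewrite dJ0 dh0.
Qed.
End ChangeOfCoordinates.

(** * Charts, geodesics and distance *)

Section Curves.
Context {R : realType}.

Lemma is_derive_rV (x : R -> 'rV[R]_2) (t : R) v :
  is_derive t (1 : R) x v <-> forall k, is_derive t (1 : R) (fun s => x s 0 k) (v 0 k).
Proof.
split=> [[dx E] k|H].
  have dk := (derivable_mxP x t 1).1 dx 0 k.
  by split=> //; rewrite -E (derive_mx dx) mxE.
have dx : derivable x t 1.
  by apply/derivable_mxP => i j; rewrite (ord1 i); have [] := H j.
split=> //; rewrite (derive_mx dx); apply/rowP => k; rewrite mxE.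
by have [_ ->] := H k.
Qed.

Lemma derive1_is_derive (x : R -> 'rV[R]_2) (t : R) : derivable x t 1 ->
  is_derive t (1 : R) x (derive1 x t).
Proof. by move=> dx; split; [exact: dx|exact: esym (derive1E x t)]. Qed.

Lemma is_derive_derive1 (V : normedModType R) (x : R -> V) (t : R) v :
  is_derive t (1 : R) x v -> derive1 x t = v.
Proof. by move=> [_ <-]; exact: derive1E. Qed.

Lemma qform_congr (A K : 'M[R]_2) v : qform (K *m A *m K^T) v = qform A (v *m K).
Proof. by rewrite /qform trmx_mul !mulmxA. Qed.

End Curves.

Section ChartOverlap.
Context {R : realType} {T : topologicalType}.
Implicit Types a b c : chart R T.

Lemma overlap_open a b : open (overlap a b).
Proof.
rewrite openE => x [ax bx]; rewrite /interior.
have oa : nbhs x (ccod a) by apply: open_nbhs_nbhs; split=> //; exact: ccod_open.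
have ob : nbhs x (cinv a @^-1` cdom b).
  apply: (cinv_continuous ax); apply: open_nbhs_nbhs; split=> //; exact: cdom_open.
by apply: filterS2 oa ob => y; split.
Qed.

Lemma overlap_cmap a b p : cdom a p -> cdom b p -> overlap a b (cmap a p).
Proof. by move=> ap bp; split; rewrite ?cmapK//; exact: cmap_cod. Qed.

Lemma transition_cmap a b p : cdom a p -> transition a b (cmap a p) = cmap b p.
Proof. by move=> ap; rewrite /transition cmapK. Qed.

Lemma near_cdom a (c : R -> T) (t : R) : {for t, continuous c} -> cdom a (c t) ->
  \forall s \near t, cdom a (c s).
Proof.
move=> cc ac; apply: (cc (cdom a)); apply: open_nbhs_nbhs; split=> //; exact: cdom_open.
Qed.

Lemma is_derive_transition a b (c : R -> T) (t : R) v :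
  Ck_map 1 (overlap a b) (transition a b) ->
  {for t, continuous c} -> cdom a (c t) -> cdom b (c t) ->
  is_derive t (1 : R) (fun s => cmap a (c s)) v ->
  is_derive t (1 : R) (fun s => cmap b (c s)) (v *m jac (transition a b) (cmap a (c t))).
Proof.
move=> ab1 cc act bct dx; apply/is_derive_rV => k.
have [df _] := Ck1_differentiable (@overlap_open a b) (ab1 k) (overlap_cmap act bct).
have := is_derive_comp_curve dx df.
have E : (\sum_a0 v 0 a0 * partial a0 (fun x => transition a b x 0 k) (cmap a (c t))) =
   (v *m jac (transition a b) (cmap a (c t))) 0 k.
  by rewrite mxE; apply: eq_bigr => l _; rewrite jac_entry.
rewrite E; apply: near_eq_is_derive.
by apply: filterS (near_cdom cc act) => s as_ /=; rewrite transition_cmap.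
Qed.

End ChartOverlap.

(** * Charts that could be added to the atlas *)

Section AdmissibleCharts.
Context {R : realType} (M : riemannian_surface R).
Implicit Types (a : chart R M) (g : 'rV[R]_2 -> 'M[R]_2).

(** Covers both the charts of the atlas and the isometry chart of extrinsic regularity, so that
    speed, curvature and the geodesic equation are treated once for all of them. *)
Definition admissible a g := [/\ riemannian_metric (ccod a) g,
  forall i, Ck_compatible 3 a (surf_chart i) &
  forall i, metric_compatible a g (surf_chart i) (surf_metric i)].

Lemma surf_chart_admissible (i : surf_index M) : admissible (surf_chart i) (surf_metric i).
Proof.
split=> [|j|j]; first exact: surf_metric_C2.
  exact: surf_C3.
exact: surf_metric_compatible.
Qed.

Lemma Ck_map_le k l U (F : 'rV[R]_2 -> 'rV[R]_2) : (k <= l)%N -> Ck_map l U F -> Ck_map k U F.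
Proof. by move=> kl FC j; exact: Ck_le (FC j). Qed.

Lemma cdom_chart_at (p : M) : cdom (chart_at p) p.
Proof. by rewrite /chart_at /index_at; case: cid. Qed.

Lemma tnorm_admissible a g (p : M) v : admissible a g -> cdom a p ->
  tnorm p (v *m jac (transition a (chart_at p)) (cmap a p)) = Num.sqrt (qform (g (cmap a p)) v).
Proof.
move=> [_ _ ag] ap; rewrite /tnorm (ag (index_at p) (cmap a p)); last first.
  by apply: overlap_cmap => //; exact: cdom_chart_at.
by rewrite qform_congr transition_cmap.
Qed.

Lemma speed_admissible a g (c : R -> M) (t : R) v : admissible a g ->
  {for t, continuous c} -> cdom a (c t) ->
  is_derive t (1 : R) (fun s => cmap a (c s)) v ->
  tnorm (c t) (velocity c t) = Num.sqrt (qform (g (cmap a (c t))) v).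
Proof.
move=> ag cc act dx; have [_ aC _] := ag.
rewrite -(tnorm_admissible v ag act); congr tnorm.
apply: is_derive_derive1.
apply: is_derive_transition => //; last exact: cdom_chart_at.
by apply: Ck_map_le (aC _).1.
Qed.

Lemma gauss_curvature_admissible a g (p : M) : admissible a g -> cdom a p ->
  gauss_curvature p = gauss_curvature_coord g (cmap a p).
Proof.
move=> [gU aC ag] ap; set i := index_at p.
have ip : cdom (surf_chart i) p := cdom_chart_at p.
have Ox := overlap_cmap ap ip.
have sub : overlap a (surf_chart i) `<=` ccod a by move=> ? [].
have PhiU x : overlap a (surf_chart i) x -> ccod (surf_chart i) (transition a (surf_chart i) x).
  by move=> [_ ix]; exact: cmap_cod.
rewrite (gauss_curvature_change (@overlap_open _ _ _ _) (@ccod_open _ _ (surf_chart i))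
  (riemannian_metric_subset sub gU) (surf_metric_C2 i) (aC i).1 PhiU (ag i) Ox).
by rewrite /gauss_curvature transition_cmap.
Qed.

End AdmissibleCharts.

(** The algebra that turns the geodesic equation into the Euler-Lagrange equation of half the
    energy. L stands for the Christoffel symbols of the first kind and D for the derivatives of the
    metric; contracted twice with v, only half of D_k survives. *)
Lemma geodesic_momentum (R : realType) (L D : 'I_2 -> 'M[R]_2) (v : 'rV[R]_2) :
  (forall m a b, L m a b = 2^-1 * (D m a b + D a m b - D b m a)) ->
  (forall m a b, D m a b = D m b a) -> forall k,
  (- (v *m (v 0 0 *: L 0 + v 0 1 *: L 1)) + v *m (v 0 0 *: D 0 + v 0 1 *: D 1)) 0 k =
  2^-1 * qform (D k) v.
Proof.
move=> LE DS k; rewrite qform2E !(mxE, sum2E) !LE (DS _ 1 0).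
by move: k; apply: ord2P; rewrite ?(DS _ 1 0); field.
Qed.

Transparent lowM.
Lemma lowM_entry (R : realType) (g : 'rV[R]_2 -> 'M[R]_2) m x a b :
  lowM g m x a b = 2^-1 * (dM m g x a b + dM a g x m b - dM b g x m a).
Proof. by rewrite mxE (dME m) (dME a) (dME b). Qed.
Opaque lowM.

Section ChartGeodesic.
Context {R : realType} (U : set 'rV[R]_2) (g : 'rV[R]_2 -> 'M[R]_2).
Hypotheses (oU : open U) (gU : riemannian_metric U g).
Context (y u : R -> 'rV[R]_2).

(** The connection matrix in the direction v; with it the geodesic equation for the velocity u reads
    u' = - u A(u). *)
Definition chrV (h : 'rV[R]_2 -> 'M[R]_2) x (v : 'rV[R]_2) : 'M[R]_2 := \sum_m v 0 m *: chrM h m x.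

Lemma is_derive_mulmx (F : 'rV[R]_2 -> 'M[R]_2) (t : R) u' v :
  is_derive t (1 : R) u u' -> is_derive t (1 : R) y v -> mxdiff F (y t) ->
  is_derive t (1 : R) (fun s => u s *m F (y s))
    (u' *m F (y t) + u t *m \sum_m v 0 m *: dM m F (y t)).
Proof.
move=> /is_derive_rV du dy dF; apply/is_derive_rV => k.
have dFk l := is_derive_comp_curve dy (dF l k).
have dprod := is_deriveD (is_deriveM (du 0) (dFk 0)) (is_deriveM (du 1) (dFk 1)).
have -> : (fun s => (u s *m F (y s)) 0 k) =
  (fun s => u s 0 0) * ((fun x => F x 0 k) \o y) + (fun s => u s 0 1) * ((fun x => F x 1 k) \o y).
  by apply/funext => s; rewrite mulmx2E.
apply: (is_derive_eq dprod); rewrite /GRing.scale/= [RHS]mxE !mulmx2E.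
have E l : (\sum_m v 0 m *: dM m F (y t)) l k = \sum_a v 0 a * partial a (fun x => F x l k) (y t).
  by rewrite summxE; apply: eq_bigr => m _; rewrite mxE dME.
rewrite (E 0) (E 1); move: (\sum_a _) (\sum_a _) => A B.
ring.
Qed.

Context (t : R).
Hypotheses (Uy : U (y t)) (dy : is_derive t (1 : R) y (u t)).
Hypothesis du : is_derive t (1 : R) u (- (u t *m chrV g (y t) (u t))).

Lemma momentum_is_derive k :
  is_derive t (1 : R) (fun s => (u s *m g (y s)) 0 k) (2^-1 * qform (dM k g (y t)) (u t)).
Proof.
have dg : mxdiff g (y t) by move=> a b; exact: (rmetric_diff oU gU a b Uy).
have /is_derive_rV/(_ k) H := is_derive_mulmx du dy dg.
apply: (is_derive_eq H).
rewrite mulNmx -mulmxA /chrV !sum2E mulmxDl -!scalemxAl !(chrM_low gU _ Uy).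
apply: (@geodesic_momentum _ (fun m => lowM g m (y t)) (fun m => dM m g (y t))) => m a b.
  exact: lowM_entry.
rewrite [LHS]dME [RHS]dME; exact: (rmetric_partial_sym oU gU m a b Uy).
Qed.

Lemma energy_is_derive : is_derive t (1 : R) (fun s => qform (g (y s)) (u s)) 0.
Proof.
have dg : mxdiff g (y t) by move=> a b; exact: (rmetric_diff oU gU a b Uy).
have /is_derive_rV dp := is_derive_mulmx du dy dg.
have /is_derive_rV du' := du.
have dq := is_deriveD (is_deriveM (dp 0) (du' 0)) (is_deriveM (dp 1) (du' 1)).
have -> : (fun s => qform (g (y s)) (u s)) =
  (fun s => (u s *m g (y s)) 0 0) * (fun s => u s 0 0)
  + (fun s => (u s *m g (y s)) 0 1) * (fun s => u s 0 1).
  by apply/funext => s; rewrite /qform mulmx2E ![(u s)^T _ _]mxE.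
apply: (is_derive_eq dq); rewrite /GRing.scale/=.
have -> : - (u t *m chrV g (y t) (u t)) *m g (y t) + u t *m \sum_m u t 0 m *: dM m g (y t) =
   u t *m (g (y t) *m (chrV g (y t) (u t))^T).
  rewrite mulNmx -mulmxA addrC -mulmxBr; congr (_ *m _).
  rewrite /chrV !sum2E !(chrM_metric oU gU _ Uy) [(_ + _)^T]linearD /= ![(_ *: _)^T]linearZ /=.
  move: (chrM g 0 _) (chrM g 1 _) (g (y t)) (u t 0 0) (u t 0 1) => C0 C1 G a b.
  rewrite mulmxDl mulmxDr -!scalemxAl -!scalemxAr.
  move: (C0 *m G) (C1 *m G) (_ *m _) (_ *m _) => X Y Z W.
  by apply/matrixP => k l; rewrite !mxE; ring.
have := rmetric_symE gU 0 1 Uy.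
move: (chrV g (y t) (u t)) (g (y t)) (u t) => C G v G01.
by rewrite !(mxE, sum2E) G01; ring.
Qed.
End ChartGeodesic.

Section SurfaceGeodesic.
Context {R : realType} (M : riemannian_surface R).

(** [geodesic] states the equation in the charts of the atlas only. Differentiating the relation
    between the velocities in the two charts produces the derivative of the Jacobian, which is
    exactly the inhomogeneous term of [chrM_change]. *)
Lemma geodesic_chart (a : chart R M) g lo hi (c : R -> M) (t : R) :
  admissible a g -> geodesic lo hi c -> lo < t < hi -> cdom a (c t) ->
  let y := fun s => cmap a (c s) in
  is_derive t (1 : R) y (derive1 y t) /\
  is_derive t (1 : R) (derive1 y) (- (derive1 y t *m chrV g (y t) (derive1 y t))).
Proof.
move=> ag gc tlh act y; have [gU aC agm] := ag.
set i := index_at (c t); set b := surf_chart i; set h := surf_metric i.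
have bct : cdom b (c t) := cdom_chart_at (c t).
pose z s := cmap b (c s).
have cct : {for t, continuous c} by have [] := gc t tlh.
have nlh : \forall s \near t, lo < s < hi.
  have : nbhs t `]lo, hi[%classic by apply: near_in_itvoo; rewrite in_itv.
  by apply: filterS => s /=; rewrite in_itv.
have dz s : lo < s < hi -> cdom b (c s) -> is_derive s (1 : R) z (derive1 z s).
  by move=> /gc[_ /(_ i) H] /H[dz _ _]; exact: derive1_is_derive.
have N : \forall s \near t, [/\ lo < s < hi, cdom a (c s) & cdom b (c s)].
  by apply: filterS3 nlh (near_cdom cct act) (near_cdom cct bct) => s; split.
have ab1 := Ck_map_le (isT : (1 <= 3)%N) (aC i).1.
have ba1 := Ck_map_le (isT : (1 <= 3)%N) (aC i).2.
have dyz s : lo < s < hi -> cdom a (c s) -> cdom b (c s) ->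
    is_derive s (1 : R) y (derive1 z s *m jac (transition b a) (z s)).
  move=> slh as_ bs; have [cs _] := gc s slh.
  exact: is_derive_transition ba1 cs bs as_ (dz s slh bs).
have dy s : lo < s < hi -> cdom a (c s) -> cdom b (c s) -> is_derive s (1 : R) y (derive1 y s).
  by move=> slh as_ bs; have H := dyz s slh as_ bs; rewrite (is_derive_derive1 H).
have zy s : lo < s < hi -> cdom a (c s) -> cdom b (c s) ->
    derive1 z s = derive1 y s *m jac (transition a b) (y s).
  move=> slh as_ bs; have [cs _] := gc s slh; apply: is_derive_derive1.
  exact: is_derive_transition ab1 cs as_ bs (dy s slh as_ bs).
have [dzt ddz geq] := (gc t tlh).2 i bct.
have ddz' := derive1_is_derive ddz.
have Ob := overlap_cmap bct act; have Oa := overlap_cmap act bct.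
have dyt := dy t tlh act bct.
split; first exact: dyt.
have dJba := jac_diff (@overlap_open _ _ b a) (aC i).2 Ob.
have dJab := jac_diff (@overlap_open _ _ a b) (aC i).1 Oa.
(* Near t the velocity in [a] is the velocity in the atlas chart times a differentiable Jacobian,
   hence is itself derivable; only then may the reverse relation be differentiated. *)
have du : derivable (derive1 y) t 1.
  have [H _] := is_derive_mulmx ddz' (dz t tlh bct) dJba.
  apply: (near_eq_derivable _ H).
  by apply: filterS N => s [s1 s2 s3]; rewrite (is_derive_derive1 (dyz s s1 s2 s3)).
have du' := derive1_is_derive du.
have Z := is_derive_mulmx du' dyt dJab.
have {Z} ZE : derive1 (derive1 z) t = derive1 (derive1 y) t *m jac (transition a b) (y t)
    + derive1 y t *m \sum_m derive1 y t 0 m *: dM m (jac (transition a b)) (y t).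
  apply: is_derive_derive1; apply: (near_eq_is_derive _ Z).
  by apply: filterS N => s [s1 s2 s3]; rewrite (zy s).
have GE : derive1 (derive1 z) t = - (derive1 z t *m chrV h (z t) (derive1 z t)).
  apply/rowP => k; have /eqP := geq k; rewrite addr_eq0 => /eqP ->.
  rewrite [RHS]mxE; congr (- _).
  have -> : \sum_l \sum_m christoffel (surf_metric i) k l m (cmap (surf_chart i) (c t)) *
        (derive1 z t) 0 l * (derive1 z t) 0 m =
      \sum_l \sum_m chrM h l (z t) m k * (derive1 z t) 0 l * (derive1 z t) 0 m.
    by apply: eq_bigr => l _; apply: eq_bigr => m _; rewrite chrM_entry.
  rewrite /chrV !sum2E; move: (derive1 z t) (chrM h 0 (z t)) (chrM h 1 (z t)) => w C0 C1.
  by rewrite !(mxE, sum2E); ring.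
have sub : overlap a b `<=` ccod a by move=> ? [].
have PhiU x : overlap a b x -> ccod b (transition a b x) by move=> [_ ix]; exact: cmap_cod.
have CH m := chrM_change (@overlap_open _ _ a b) (@ccod_open _ _ b)
  (riemannian_metric_subset sub gU) (surf_metric_C2 i) (aC i).1 PhiU (agm i) m Oa.
have Ju := jac_unit (riemannian_metric_subset sub gU) (agm i) Oa.
have E : derive1 (derive1 y) t = - (derive1 y t *m chrV g (y t) (derive1 y t)).
  apply: (can_inj (mulmxK Ju)).
  have zt : transition a b (cmap a (c t)) = z t by rewrite transition_cmap.
  have V : jac (transition a b) (y t) *m chrV h (z t) (derive1 y t *m jac (transition a b) (y t)) =
      \sum_m derive1 y t 0 m *: (jac (transition a b) (y t) *m pulled h (transition a b) m (y t)).
    rewrite /chrV /pulled !sum2E zt !mulmx2E.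
    move: (chrM h 0 (z t)) (chrM h 1 (z t)) (derive1 y t) (jac _ _) => C0 C1 w K.
    by apply/matrixP => k l; rewrite !(mxE, sum2E); ring.
  have CH' m : jac (transition a b) (y t) *m pulled h (transition a b) m (y t) =
      chrM g m (y t) *m jac (transition a b) (y t) - dM m (jac (transition a b)) (y t).
    by rewrite CH addrAC subrr add0r.
  move: ZE; rewrite GE (zy t)// -mulmxA V !sum2E !CH' /chrV !sum2E.
  move: (derive1 (derive1 y) t) (derive1 y t) (jac _ _) => y2 w K ZE.
  move: ZE; move: (dM 0 _ _) (dM 1 _ _) (chrM g 0 _) (chrM g 1 _) => D0 D1 C0 C1 ZE.
  have -> : y2 *m K = (y2 *m K + w *m (w 0 0 *: D0 + w 0 1 *: D1)) - w *m (w 0 0 *: D0 + w 0 1 *: D1).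
    by rewrite addrK.
  rewrite -ZE mulNmx -mulmxA -opprD; congr (- _).
  rewrite -mulmxDr; congr (_ *m _); rewrite mulmxDl -!scalemxAl.
  move: (C0 *m K) (C1 *m K) => X Y.
  by apply/matrixP => k l; rewrite !mxE; ring.
by rewrite -E.
Qed.
End SurfaceGeodesic.

(** * The continuity method on the unit interval *)

Section Continuation.
Context {R : realType}.

Lemma near_real (t : R) (P : R -> Prop) : (\forall s \near t, P s) ->
  exists2 e : R, 0 < e & forall s, `|s - t| < e -> P s.
Proof.
move=> /nbhs_ballP[e /= e0 H]; exists e => // s st; apply: H.
by rewrite -ball_normE /= distrC.
Qed.

(** At the supremum of the times up to which the path stays in O, closedness of K keeps the path in
    O and openness of O carries it further. This turns an estimate valid as long as the path stays
    in O into an unconditional one; it serves for curves in a chart, for Gronwall's inequality and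
    for the segments issued from the centre. *)
Lemma continuation (T : topologicalType) (c : R -> T) (O K : set T) :
  open O -> closed K -> K `<=` O ->
  (forall t : R, 0 <= t <= 1 -> {for t, continuous c}) -> O (c 0) ->
  (forall t : R, 0 <= t <= 1 -> (forall s : R, 0 <= s <= t -> O (c s)) -> K (c t)) ->
  forall t : R, 0 <= t <= 1 -> O (c t).
Proof.
move=> oO cK KO cc O0 OK.
pose A := [set t : R | 0 <= t <= 1 /\ forall s : R, 0 <= s <= t -> O (c s)].
have A0 : A 0 by split=> [|s]; [rewrite lexx ler01|rewrite -eq_le => /eqP <-].
have Aub : ubound A 1 by move=> t [/andP[]].
have hsA : has_sup A by split; [exists 0|exists 1].
set tau := sup A.
have tau0 : 0 <= tau by exact: ub_le_sup hsA.2 _ A0.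
have tau1 : tau <= 1 by exact: ge_sup hsA.1 Aub.
have lt_tau s : 0 <= s -> s < tau -> A s.
  move=> s0 st; have [t [t01 tO] ts] := sup_gt hsA.1 st.
  split=> [|r /andP[r0 rs]]; first by rewrite s0 (le_trans (ltW st)).
  by apply: tO; rewrite r0 (le_trans rs)// ltW.
have tau01 : 0 <= tau <= 1 by rewrite tau0.
have Otau : O (c tau).
  have [t0|tn0] := eqVneq tau 0; first by rewrite t0.
  have tp : 0 < tau by rewrite lt_neqAle eq_sym tn0.
  apply: KO; apply: contrapT => nK.
  have : nbhs (c tau) (~` K) by apply: open_nbhs_nbhs; split=> //; exact: closed_openC.
  move=> /(cc tau tau01) /near_real[e e0 H].
  pose s := Num.max 0 (tau - e / 2).
  have s0 : 0 <= s by rewrite le_max lexx.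
  have st : s < tau by rewrite gt_max tp/= ltrBlDr ltrDl divr_gt0.
  have [s01 sO] := lt_tau s s0 st.
  apply: (H s _ (OK s s01 sO)).
  rewrite distrC ger0_norm ?subr_ge0 ?ltW// ltrBlDr -ltrBlDl /s lt_max.
  by apply/orP; right; lra.
have Atau : A tau.
  split=> // s /andP[s0]; rewrite le_eqVlt => /predU1P[->//|st].
  by have [_] := lt_tau s s0 st; apply; rewrite s0 lexx.
suff tau_eq1 : tau = 1 by move=> t t01; apply: Atau.2; rewrite tau_eq1.
apply/eqP; rewrite eq_le tau1 leNgt; apply/negP => tl1.
have : nbhs (c tau) O by apply: open_nbhs_nbhs.
move=> /(cc tau tau01) /near_real[e e0 H].
pose t := Num.min 1 (tau + e / 2).
have tt : tau < t by rewrite lt_min tl1 ltrDl divr_gt0.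
have At : A t.
  split; first by rewrite (le_trans tau0 (ltW tt)) ge_min lexx.
  move=> s /andP[s0 st]; have [stau|taus] := leP s tau; first by apply: Atau.2; rewrite s0.
  apply: H; rewrite ger0_norm ?subr_ge0 ?ltW// ltrBlDr (le_lt_trans st)// gt_min.
  by apply/orP; right; lra.
by have := ub_le_sup hsA.2 At; rewrite leNgt tt.
Qed.

Lemma is_derive0_cst (F : R -> R) (a b : R) : a <= b ->
  (forall s, a <= s <= b -> is_derive s (1 : R) F 0) -> F a = F b.
Proof.
move=> ab dF; have [c _ /eqP] := mvt_closed ab dF.
by rewrite mul0r subr_eq0 => /eqP.
Qed.

End Continuation.

Section ConstantSpeed.
Context {R : realType} (M : riemannian_surface R).
Implicit Types (c : R -> M).

Lemma qform_ge0 (A : 'M[R]_2) : (forall v, v != 0 -> 0 < qform A v) -> forall v, 0 <= qform A v.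
Proof.
move=> pA v; have [->|/pA/ltW//] := eqVneq v 0.
by rewrite /qform mul0mx mul0mx mxE.
Qed.

Lemma qformZ (A : 'M[R]_2) k v : qform A (k *: v) = k ^+ 2 * qform A v.
Proof. by rewrite !qform2E !mxE; ring. Qed.

Lemma metric_qform_ge0 (a : chart R M) g (p : M) v : admissible a g -> cdom a p ->
  0 <= qform (g (cmap a p)) v.
Proof.
move=> [[_ gP] _ _] ap; apply: qform_ge0 => w w0.
by have [_] := gP _ (cmap_cod ap); exact.
Qed.

Lemma tnorm_ge0 (p : M) v : 0 <= tnorm p v. Proof. exact: sqrtr_ge0. Qed.

Lemma tnormZ (p : M) k v : 0 <= k -> tnorm p (k *: v) = k * tnorm p v.
Proof. by move=> k0; rewrite /tnorm qformZ sqrtrM ?sqr_ge0// sqrtr_sqr ger0_norm. Qed.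

(** [velocity] is read in a chart depending on the time, so its norm is not visibly differentiable.
    Near each time it equals the norm computed in one fixed chart, where the energy has derivative
    zero. *)
Lemma geodesic_speed lo hi c (a b : R) : geodesic lo hi c -> lo < a -> b < hi -> a <= b ->
  tnorm (c a) (velocity c a) = tnorm (c b) (velocity c b).
Proof.
move=> gc la bh ab.
pose S t := tnorm (c t) (velocity c t) ^+ 2.
suff dS s : a <= s <= b -> is_derive s (1 : R) S 0.
  move: (is_derive0_cst ab dS) (tnorm_ge0 (c a) (velocity c a)) (tnorm_ge0 (c b) (velocity c b)).
  rewrite /S; move: (tnorm (c a) _) (tnorm (c b) _) => A B /eqP AB A0 B0.
  by move: AB; rewrite eqrXn2// => /eqP.
move=> /andP[as_ sb].
have slh : lo < s < hi by rewrite (lt_le_trans la)//= (le_lt_trans sb).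
set i := index_at (c s).
have ai := surf_chart_admissible i; have [gU _ _] := ai.
have ics : cdom (surf_chart i) (c s) := cdom_chart_at (c s).
have cs : {for s, continuous c} by have [] := gc s slh.
have [dy du] := geodesic_chart ai gc slh ics.
have dE := energy_is_derive (@ccod_open _ _ (surf_chart i)) gU (cmap_cod ics) dy du.
apply: near_eq_is_derive dE.
have nlh : \forall r \near s, lo < r < hi.
  have : nbhs s `]lo, hi[%classic by apply: near_in_itvoo; rewrite in_itv.
  by apply: filterS => r /=; rewrite in_itv.
apply: filterS2 nlh (near_cdom cs ics) => r rlh icr.
have [dyr _] := geodesic_chart ai gc rlh icr.
have cr : {for r, continuous c} by have [] := gc r rlh.
by rewrite /S (speed_admissible ai cr icr dyr) sqr_sqrtr// metric_qform_ge0.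
Qed.

End ConstantSpeed.

Section Lengths.
Context {R : realType} (M : riemannian_surface R).
Implicit Types (c : R -> M).

Lemma near_eq_continuous (T : topologicalType) (f g : R -> T) (t : R) :
  (\forall s \near t, f s = g s) -> {for t, continuous f} -> {for t, continuous g}.
Proof.
move=> fg cf; rewrite /prop_for /continuous_at -(nbhs_singleton fg).
by apply: cvg_trans cf; apply: near_eq_cvg.
Qed.

Lemma is_derive_continuous (V : normedModType R) (x : R -> V) (t : R) v :
  is_derive t (1 : R) x v -> {for t, continuous x}.
Proof.
move=> [dx _]; apply: differentiable_continuous.
by apply/derivable1_diffP.
Qed.

Lemma is_derive_rescale (x : R -> 'rV[R]_2) (T s : R) v :
  is_derive (T * s) (1 : R) x v -> is_derive s (1 : R) (fun r => x (T * r)) (T *: v).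
Proof.
move=> /is_derive_rV dx; apply/is_derive_rV => k.
have dT : is_derive s (1 : R) (fun r : R => T * r) T.
  have -> : (fun r : R => T * r) = T \*: (id : R -> R) by apply/funext.
  by apply: is_derive_eq; rewrite /GRing.scale/= mulr1.
by rewrite mxE mulrC; apply: (is_derive1_comp (dx k) dT).
Qed.

(** The arc over [0, T] is reparametrised by [0, 1], as the pieces of an admissible curve must be;
    its speed is then the constant T times the initial speed. *)
Lemma rdist_geodesic lo hi c (T : R) : geodesic lo hi c -> lo < 0 -> 1 < hi -> 0 <= T <= 1 ->
  (rdist (c 0%R) (c T) <= (T * tnorm (c 0%R) (velocity c 0%R))%:E)%E.
Proof.
move=> gc l0 h1 /andP[T0 T1].
pose cT (s : R) := c (T * s).
have inlh (s : R) : 0 <= s <= 1 -> lo < T * s < hi.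
  move=> /andP[s0 s1]; rewrite (lt_le_trans l0) ?mulr_ge0//=.
  by rewrite (le_lt_trans _ h1)// -[leRHS]mulr1 ler_pM.
have cTc (s : R) : {for T * s, continuous c} -> {for s, continuous cT}.
  move=> cs; apply: (@continuous_comp _ _ _ (fun r : R => T * r) c) => //.
  exact: mulrl_continuous.
have nlh (s : R) : 0 <= s <= 1 -> \forall r \near s, lo < T * r < hi.
  move=> s01.
  have : \forall r \near (T * s), lo < r < hi.
    have : nbhs (T * s) `]lo, hi[%classic by apply: near_in_itvoo; rewrite in_itv/= inlh.
    by apply: filterS => r /=; rewrite in_itv.
  have cm : {for s, continuous (fun r : R => T * r)}.
    exact: mulrl_continuous.
  by move=> /cm.
have dx i (s : R) : lo < T * s < hi -> cdom (surf_chart i) (cT s) ->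
    let x := fun r => cmap (surf_chart i) (c r) in
    is_derive (T * s) (1 : R) x (derive1 x (T * s)) /\
    is_derive s (1 : R) (fun r => cmap (surf_chart i) (cT r)) (T *: derive1 x (T * s)).
  move=> slh ics x; have [_ /(_ i ics) [d1 _ _]] := gc _ slh.
  have d1' := derive1_is_derive d1.
  split; first exact: d1'.
  exact: is_derive_rescale d1'.
have C1 : C1_curve cT.
  move=> t t01; have tlh := inlh t t01; have [ct gt] := gc _ tlh.
  split=> [|i ict x]; first exact: cTc.
  have N : \forall s \near t, lo < T * s < hi /\ cdom (surf_chart i) (cT s).
    by apply: filterS2 (nlh t t01) (near_cdom (cTc t ct) ict) => s; split.
  split.
    by apply: filterS N => s [slh ics]; have [_ []] := dx i s slh ics.
  have [_ d2 _] := gt i ict.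
  have d2' := is_derive_rescale (derive1_is_derive d2).
  have d3 := is_deriveZ T d2'.
  apply: near_eq_continuous (is_derive_continuous d3).
  apply: filterS N => s [slh ics].
  by have [_ d] := dx i s slh ics; rewrite (is_derive_derive1 d).
have speed (s : R) : 0 <= s <= 1 ->
    tnorm (cT s) (velocity cT s) = T * tnorm (c 0) (velocity c 0).
  move=> s01; have slh := inlh s s01.
  have [_ d] := dx (index_at (cT s)) s slh (cdom_chart_at (cT s)).
  have -> : velocity cT s = T *: velocity c (T * s) by exact: is_derive_derive1 d.
  rewrite (tnormZ _ _ T0).
  have Ts0 : 0 <= T * s by rewrite mulr_ge0//; case/andP: s01.
  have /andP[_ shi] := slh.
  have GS := geodesic_speed gc l0 shi Ts0.
  exact: (congr1 (fun r => T * r) (esym GS)).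
have len : curve_length cT = (T * tnorm (c 0) (velocity c 0))%:E.
  rewrite /curve_length.
  rewrite (@eq_integral _ _ _ _ _ (cst (T * tnorm (c 0) (velocity c 0))%:E)); last first.
    by move=> s; rewrite inE/= in_itv/= => s01; rewrite speed.
  rewrite integral_cst//= lebesgue_measure_itv/= lte_fin ltr01.
  by rewrite sube0 mule1.
apply: ereal_inf_lbound; exists 0%N, (fun=> cT); split.
  by split=> //; rewrite /cT ?mulr0 ?mulr1.
by rewrite big_ord1 len.
Qed.

(** [C1_curve] gives continuity at the times of [0, 1] only, while a neighbourhood of an end point
    contains other times. There continuity is recovered from the derivable coordinate expression. *)
Lemma near_chart_continuous (a : chart R M) c (t : R) : {for t, continuous c} -> cdom a (c t) ->
  (\forall s \near t, derivable (fun r => cmap a (c r)) s 1) ->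
  \forall s \near t, {for s, continuous c}.
Proof.
move=> ct act dx; have N := near_cdom ct act.
have /nbhs_interior NN := N.
apply: filterS3 N NN dx => s as_ NNs dxs.
have xs := is_derive_continuous (derive1_is_derive dxs).
have H : {for s, continuous (fun r => cinv a (cmap a (c r)))}.
  apply: (@continuous_comp _ _ _ (fun r => cmap a (c r)) (cinv a)) => //.
  by apply: cinv_continuous; exact: cmap_cod.
by apply: near_eq_continuous H; apply: filterS NNs => r ar; rewrite cmapK.
Qed.

Lemma speed_continuous c (t : R) : C1_curve c -> 0 <= t <= 1 ->
  {for t, continuous (fun s => tnorm (c s) (velocity c s))}.
Proof.
move=> C1 t01; have [ct Ct] := C1 t t01.
set i := index_at (c t).
have ai := surf_chart_admissible i; have [gU _ _] := ai.
have ict : cdom (surf_chart i) (c t) := cdom_chart_at (c t).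
have [dx cx] := Ct i ict.
pose y s := cmap (surf_chart i) (c s).
set g := surf_metric i.
have Sy : \forall s \near t, Num.sqrt (qform (g (y s)) (derive1 y s)) = tnorm (c s) (velocity c s).
  apply: filterS3 (near_cdom ct ict) dx (near_chart_continuous ct ict dx) => s ics dys cs.
  by rewrite (speed_admissible ai cs ics (derive1_is_derive dys)).
apply: near_eq_continuous Sy _.
have yc : {for t, continuous y}.
  have d := derive1_is_derive (nbhs_singleton dx).
  exact: is_derive_continuous d.
have gc a b : {for t, continuous (fun s => g (y s) a b)}.
  apply: (@continuous_comp _ _ _ y (fun z => g z a b)) => //.
  apply: differentiable_continuous.
  exact: (rmetric_diff (@ccod_open _ _ (surf_chart i)) gU a b (cmap_cod ict)).
have uc k : {for t, continuous (fun s => derive1 y s 0 k)}.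
  apply: (@continuous_comp _ _ _ (derive1 y) (fun z : 'rV[R]_2 => z 0 k)) => //.
  exact: coord_continuous.
apply: (@continuous_comp _ _ _ (fun s => qform (g (y s)) (derive1 y s)) Num.sqrt).
  have -> : (fun s => qform (g (y s)) (derive1 y s)) = fun s =>
     g (y s) 0 0 * (derive1 y s 0 0 * derive1 y s 0 0)
     + (g (y s) 0 1 + g (y s) 1 0) * (derive1 y s 0 0 * derive1 y s 0 1)
     + g (y s) 1 1 * (derive1 y s 0 1 * derive1 y s 0 1).
    by apply/funext => s; rewrite qform2E !expr2.
  by apply: continuousD; [apply: continuousD|]; do ?[apply: continuousM|apply: continuousD|exact: gc|exact: uc].
exact: sqrt_continuous.
Qed.

End Lengths.

(** * Curves and distance in a chart *)

Section EuclideanNorm.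
Context {R : realType}.
Implicit Types u v w : 'rV[R]_2.

Definition dot u v : R := u 0 0 * v 0 0 + u 0 1 * v 0 1.

Lemma enormE v : enorm v = Num.sqrt (dot v v).
Proof. by rewrite /enorm sum2E !expr2. Qed.

Lemma dot_ge0 v : 0 <= dot v v.
Proof. by rewrite /dot -!expr2 addr_ge0 ?sqr_ge0. Qed.

Lemma enorm_ge0 v : 0 <= enorm v. Proof. exact: sqrtr_ge0. Qed.

Lemma sqr_enorm v : enorm v ^+ 2 = dot v v.
Proof. by rewrite enormE sqr_sqrtr// dot_ge0. Qed.

Lemma cauchy_schwarz u v : dot u v <= enorm u * enorm v.
Proof.
rewrite (le_trans (ler_norm _))// -(@ler_pXn2r _ 2)// ?nnegrE ?mulr_ge0 ?enorm_ge0//.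
rewrite real_normK ?num_real// exprMn !sqr_enorm /dot -subr_ge0.
rewrite (_ : _ - _ = (u 0 0 * v 0 1 - u 0 1 * v 0 0) ^+ 2) ?sqr_ge0//; ring.
Qed.

Lemma enormD u v : enorm (u + v) <= enorm u + enorm v.
Proof.
rewrite -(@ler_pXn2r _ 2)// ?nnegrE ?addr_ge0 ?enorm_ge0// sqrrD !sqr_enorm.
have := cauchy_schwarz u v; rewrite /dot !mxE; move: (enorm u * enorm v) => e; lra.
Qed.

Lemma enormN v : enorm (- v) = enorm v.
Proof. by rewrite !enormE /dot !mxE !mulrNN. Qed.

Lemma enormZ k v : enorm (k *: v) = `|k| * enorm v.
Proof.
rewrite !enormE /dot !mxE -sqrtr_sqr -sqrtrM ?sqr_ge0//; congr Num.sqrt; ring.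
Qed.

Lemma enormB u v : enorm (u - v) = enorm (v - u).
Proof. by rewrite -enormN opprB. Qed.

Lemma enorm_triangle u v w : enorm (u - w) <= enorm (u - v) + enorm (v - w).
Proof. by have := enormD (u - v) (v - w); rewrite addrA subrK. Qed.

Lemma enorm0 : enorm (0 : 'rV[R]_2) = 0.
Proof. by rewrite enormE /dot !mxE mulr0 addr0 sqrtr0. Qed.

Lemma coord_le_enorm v i : `|v 0 i| <= enorm v.
Proof.
rewrite enormE -sqrtr_sqr ler_wsqrtr// /dot -!expr2.
by move: i; apply: ord2P; rewrite ?lerDl ?lerDr sqr_ge0.
Qed.

Lemma norm_le_enorm v : `|v| <= enorm v.
Proof. by rewrite norm_rV2_le ?enorm_ge0// !coord_le_enorm. Qed.

Lemma enorm_le_norm v : enorm v <= 2 * `|v|.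
Proof.
rewrite -(@ler_pXn2r _ 2)// ?nnegrE ?mulr_ge0 ?enorm_ge0// sqr_enorm /dot -!expr2.
have h i : v 0 i ^+ 2 <= `|v| ^+ 2.
  by rewrite -[leLHS]real_normK ?num_real// ler_pXn2r ?nnegrE// norm_coord.
have := h 0; have := h 1; rewrite exprMn; have := sqr_ge0 `|v|; lra.
Qed.

Lemma enorm_continuous : continuous (@enorm R).
Proof.
move=> v; apply/(@cvgrPdist_le _ _ _ (nbhs v)) => /= e e0.
have e20 : 0 < e / 2 by rewrite divr_gt0.
apply/nbhs_ballP; exists (e / 2) => //= w; rewrite -ball_normE/= => vw.
have h : enorm (v - w) <= e.
  by rewrite (le_trans (enorm_le_norm _))// mulrC -ler_pdivlMr// ltW.
have := enorm_triangle v w 0; have := enorm_triangle w v 0; rewrite !subr0 (enormB w v) => h1 h2.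
by rewrite ler_norml; apply/andP; split; lra.
Qed.

Lemma enorm_dist_continuous (x0 : 'rV[R]_2) : continuous (fun x : 'rV[R]_2 => enorm (x - x0)).
Proof.
move=> x; apply: (@continuous_comp _ _ _ (fun z : 'rV[R]_2 => z - x0) (@enorm R)).
  by apply: (@continuousB _ _ _ (id : 'rV[R]_2 -> 'rV[R]_2) (cst x0)); [exact: cvg_id|exact: cst_continuous].
exact: enorm_continuous.
Qed.

Lemma eball_open (x0 : 'rV[R]_2) (r : R) : open [set x | enorm (x - x0) < r].
Proof.
rewrite openE => x /= xr; rewrite /interior.
have rx : 0 < r - enorm (x - x0) by rewrite subr_gt0.
apply/nbhs_ballP; exists ((r - enorm (x - x0)) / 2) => /=; first by rewrite divr_gt0.
move=> y; rewrite -ball_normE/= => xy.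
have := enorm_triangle y x x0; have := enorm_le_norm (x - y); rewrite (enormB x y).
lra.
Qed.

Lemma eball_compact (x0 : 'rV[R]_2) (r : R) : compact [set x | enorm (x - x0) <= r].
Proof.
apply: bounded_closed_compact.
  exists (r + `|x0|); split; first exact: num_real.
  move=> N rN x /= xr; rewrite -[x](subrK x0) (le_trans (ler_normD _ _))// ltW//.
  by rewrite (le_lt_trans _ rN)// lerD2r (le_trans (norm_le_enorm _)).
have -> : [set x | enorm (x - x0) <= r] = ((fun x => enorm (x - x0)) @^-1` [set y | y <= r]) by [].
apply: closed_comp; last exact: closed_le.
by move=> x _; exact: enorm_dist_continuous.
Qed.

End EuclideanNorm.

(** * Euclidean displacement is at most twice the Riemannian length *)

Section LengthLowerBound.
Context {R : realType} (M : riemannian_surface R).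
Context (a : chart R M) (g : 'rV[R]_2 -> 'M[R]_2) (ag : admissible a g).
Implicit Types (c : R -> M).

Lemma C1_curve_chart c (t : R) : C1_curve c -> 0 <= t <= 1 -> cdom a (c t) ->
  let y := fun s => cmap a (c s) in
  (\forall s \near t, is_derive s (1 : R) y (derive1 y s)) /\ {for t, continuous (derive1 y)}.
Proof.
move=> C1 t01 act y; have [ct Ct] := C1 t t01; have [_ aC _] := ag.
set i := index_at (c t); set b := surf_chart i.
have bct : cdom b (c t) := cdom_chart_at (c t).
have [dx cx] := Ct i bct.
pose x s := cmap b (c s).
have ba3 := (aC i).2.
have ba1 := Ck_map_le (isT : (1 <= 3)%N) ba3.
have Ob := overlap_cmap bct act.
have dJ := jac_diff (@overlap_open _ _ b a) ba3 Ob.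
have D : \forall s \near t, is_derive s (1 : R) y (derive1 x s *m jac (transition b a) (x s)).
  have N : \forall s \near t, cdom a (c s) /\ cdom b (c s).
    by apply: filterS2 (near_cdom ct act) (near_cdom ct bct) => s; split.
  apply: filterS3 N dx (near_chart_continuous ct bct dx) => s [as_ bs] dxs cs.
  exact: is_derive_transition ba1 cs bs as_ (derive1_is_derive dxs).
split.
  by apply: filterS D => s ds; rewrite (is_derive_derive1 ds).
have xc : {for t, continuous x}.
  exact: is_derive_continuous (derive1_is_derive (nbhs_singleton dx)).
have Jc k l : {for t, continuous (fun s => jac (transition b a) (x s) k l)}.
  apply: (@continuous_comp _ _ _ x (fun z => jac (transition b a) z k l)) => //.
  apply: differentiable_continuous; exact: dJ.
have uc k : {for t, continuous (fun s => derive1 x s 0 k)}.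
  apply: (@continuous_comp _ _ _ (derive1 x) (fun z : 'rV[R]_2 => z 0 k)) => //.
  exact: coord_continuous.
have wc k : {for t, continuous (fun s => derive1 x s 0 0 * jac (transition b a) (x s) 0 k
      + derive1 x s 0 1 * jac (transition b a) (x s) 1 k)}.
  by apply: continuousD; apply: continuousM; do ?[exact: uc|exact: Jc].
have H : {for t, continuous (fun s => derive1 x s *m jac (transition b a) (x s))}.
  have -> : (fun s => derive1 x s *m jac (transition b a) (x s)) =
     (fun s => (derive1 x s 0 0 * jac (transition b a) (x s) 0 0
      + derive1 x s 0 1 * jac (transition b a) (x s) 1 0) *: (delta_mx 0 0 : 'rV[R]_2))
     \+ (fun s => (derive1 x s 0 0 * jac (transition b a) (x s) 0 1
      + derive1 x s 0 1 * jac (transition b a) (x s) 1 1) *: (delta_mx 0 1 : 'rV[R]_2)).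
    by apply/funext => s /=; rewrite [LHS]rV2E !mulmx2E.
  apply: continuousD; apply: (@continuous_comp _ _ _ _ (fun r : R => r *: _)).
  - exact: wc.
  - exact: scalel_continuous.
  - exact: wc.
  - exact: scalel_continuous.
apply: near_eq_continuous H; apply: filterS D => s ds.
by rewrite (is_derive_derive1 ds).
Qed.

Context (x0 : 'rV[R]_2) (rho : R).
Hypothesis good : forall x, enorm (x - x0) <= rho ->
  ccod a x /\ forall v, enorm v ^+ 2 <= 4 * qform (g x) v.

Lemma enorm_le_speed c (t : R) v : {for t, continuous c} -> cdom a (c t) ->
  is_derive t (1 : R) (fun s => cmap a (c s)) v -> enorm (cmap a (c t) - x0) <= rho ->
  enorm v <= 2 * tnorm (c t) (velocity c t).
Proof.
move=> ct act dy near0; rewrite (speed_admissible ag ct act dy).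
have [_ /(_ v) H] := good near0.
have q0 := metric_qform_ge0 v ag act.
rewrite -(@ler_pXn2r _ 2)// ?nnegrE ?mulr_ge0 ?enorm_ge0 ?sqrtr_ge0//.
rewrite exprMn (sqr_sqrtr q0); have -> : 2 ^+ 2 = 4 :> R by ring.
exact: H.
Qed.

(** With w the total displacement, the scalar function <y, w> increases by |w|^2, and its derivative
    is at most |w| times twice the speed. Integrating it and dividing by |w| avoids integrals of
    vector-valued functions. *)
Lemma displacement_le_length c (T l : R) : C1_curve c -> 0 <= T <= 1 ->
  (forall s : R, 0 <= s <= T -> cdom a (c s) /\ enorm (cmap a (c s) - x0) <= rho) ->
  (curve_length c <= l%:E)%E ->
  enorm (cmap a (c T) - cmap a (c 0)) <= 2 * l.
Proof.
move=> C1 /andP[T0 T1] inb lenl.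
pose y s := cmap a (c s).
pose sp s := tnorm (c s) (velocity c s).
have spc (s : R) : 0 <= s <= 1 -> {for s, continuous sp} by move=> s01; exact: speed_continuous.
have sp0 s : 0 <= sp s by exact: tnorm_ge0.
have l0 : 0 <= l.
  rewrite -lee_fin; apply: le_trans lenl; apply: integral_ge0 => s _.
  by rewrite lee_fin; exact: sp0.
set w := y T - y 0.
have [w0|wn0] := eqVneq (enorm w) 0; first by rewrite -/w w0 mulr_ge0.
have wp : 0 < enorm w by rewrite lt_neqAle eq_sym wn0 enorm_ge0.
have Tp : 0 < T.
  rewrite lt_neqAle T0 andbT; apply: contra wn0 => /eqP T00.
  by rewrite /w -T00 subrr enorm0.
have s01 (s : R) : 0 <= s <= T -> 0 <= s <= 1.
  by move=> /andP[-> sT]; rewrite (le_trans sT).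
pose F (s : R) : R := y s 0 0 * w 0 0 + y s 0 1 * w 0 1.
pose f (s : R) : R := derive1 y s 0 0 * w 0 0 + derive1 y s 0 1 * w 0 1.
have dF (s : R) : 0 <= s <= T -> is_derive s (1 : R) F (f s) /\ {for s, continuous f}.
  move=> sT; have [as_ _] := inb s sT.
  have [/nbhs_singleton dy yc] := C1_curve_chart C1 (s01 s sT) as_.
  split.
    have /is_derive_rV dk := dy.
    have dd := is_deriveD (is_deriveM (dk 0) (is_derive_cst (w 0 0) s 1))
       (is_deriveM (dk 1) (is_derive_cst (w 0 1) s 1)).
    apply: (is_derive_eq dd); rewrite /GRing.scale/= /f !mulr0 !add0r.
    by rewrite mulrC [X in _ + X]mulrC.
  have uc k : {for s, continuous (fun s => derive1 y s 0 k)}.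
    apply: (@continuous_comp _ _ _ (derive1 y) (fun z : 'rV[R]_2 => z 0 k)) => //.
    exact: coord_continuous.
  by apply: continuousD; apply: continuousM; do ?[exact: uc|exact: cst_continuous].
have Fc (s : R) : 0 <= s <= T -> {for s, continuous F}.
  by move=> /dF[d _]; exact: is_derive_continuous d.
have T0T : 0 <= T <= T by rewrite T0 lexx.
have O0T : 0 <= (0 : R) <= T by rewrite lexx.
have fcw : {within `[0, T], continuous f}.
  by apply: continuous_in_subspaceT => s; rewrite inE/= in_itv/= => /dF[].
have FTC : (\int[lebesgue_measure]_(s in `[0%R, T]) (f s)%:E = (F T)%:E - (F 0)%:E)%E.
  apply: continuous_FTC2 => //.
    split.
    - by move=> s; rewrite in_itv/= => /andP[s0 sT]; have [|[]] := dF s => //; rewrite !ltW.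
    - by apply: cvg_at_right_filter; exact: Fc.
    - by apply: cvg_at_left_filter; exact: Fc.
  move=> s; rewrite in_itv/= => /andP[s0 sT].
  by have [|d _] := dF s; [rewrite !ltW|exact: is_derive_derive1 d].
have mspc : measurable_fun (`[0, 1]%classic : set R) (EFin \o sp).
  apply/measurable_EFinP; apply: subspace_continuous_measurable_fun => //.
  by apply: continuous_in_subspaceT => s; rewrite inE/= in_itv/= => /spc.
have sub01 : `[0, T]%classic `<=` `[0, 1]%classic.
  by move=> s /=; rewrite !in_itv/=; exact: s01.
have L : (\int[lebesgue_measure]_(s in `[0%R, T]) (f s)%:E <= (2 * enorm w * l)%:E)%E.
  have mT : measurable_fun (`[0, T]%classic : set R) (EFin \o sp) by exact: measurable_funS mspc.
  have k0 : 0 <= 2 * enorm w by rewrite mulr_ge0 ?enorm_ge0.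
  have kT : measurable_fun (`[0, T]%classic : set R) (EFin \o (fun s => 2 * enorm w * sp s)).
    apply/measurable_EFinP; apply: measurable_funM; first exact: measurable_cst.
    by apply/measurable_EFinP.
  have kc : {within `[0, T], continuous (fun s => 2 * enorm w * sp s)}.
    apply: continuous_in_subspaceT => s; rewrite inE/= in_itv/= => sT.
    apply: (@continuousM _ _ (cst (2 * enorm w)) sp); first exact: cst_continuous.
    exact: spc (s01 s sT).
  apply: (@le_trans _ _ (\int[lebesgue_measure]_(s in `[0%R, T]) (2 * enorm w * sp s)%:E)%E).
    apply: le_integral => //.
    - apply: continuous_compact_integrable => //; exact: segment_compact.
    - by apply: (continuous_compact_integrable _ kc); exact: segment_compact.
    - move=> s; rewrite inE/= in_itv/= => sT; rewrite lee_fin.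
      have [as_ ns] := inb s sT.
      have [/nbhs_singleton dy _] := C1_curve_chart C1 (s01 s sT) as_.
      have [cs _] := C1 s (s01 s sT).
      have E := enorm_le_speed cs as_ dy ns.
      rewrite (_ : f s = dot w (derive1 y s)); last by rewrite /f /dot mulrC [X in _ + X]mulrC.
      rewrite (le_trans (cauchy_schwarz _ _))// mulrAC [leRHS]mulrC.
      by rewrite ler_wpM2l ?enorm_ge0// mulrC.
  under eq_integral do rewrite EFinM.
  rewrite ge0_integralZl//; last by move=> s _; rewrite lee_fin; exact: sp0.
  rewrite [leRHS]EFinM lee_wpmul2l ?lee_fin//; apply: le_trans lenl.
  by apply: ge0_subset_integral => // s _; rewrite lee_fin; exact: sp0.
move: L; rewrite FTC -EFinB lee_fin.
have -> : F T - F 0 = enorm w ^+ 2 by rewrite sqr_enorm /dot /F /w !mxE; ring.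
rewrite expr2 (_ : 2 * enorm w * l = enorm w * (2 * l)); last by ring.
by rewrite (ler_pM2l wp).
Qed.

(** The image of a compact ball in a Hausdorff surface is closed in the whole of M, and not only in
    the domain of the chart; a curve can therefore not escape through the boundary of that
    domain. *)
Lemma chart_image_compact (r : R) : r <= rho ->
  closed [set p : M | exists2 x, enorm (x - x0) <= r & p = cinv a x].
Proof.
move=> rr; have -> : [set p : M | exists2 x, enorm (x - x0) <= r & p = cinv a x] =
    cinv a @` [set x | enorm (x - x0) <= r].
  by apply/seteqP; split=> p [x xr]; exists x.
apply: compact_closed; first exact: surf_hausdorff.
apply: continuous_compact; last exact: eball_compact.
apply: continuous_in_subspaceT => x; rewrite inE/= => xr.
by apply: cinv_continuous; have [] := good (le_trans xr rr).
Qed.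

Lemma chart_region_open (r : R) : open [set p : M | cdom a p /\ enorm (cmap a p - x0) < r].
Proof.
rewrite openE => p [ap pr]; rewrite /interior.
have oa : nbhs p (cdom a) by apply: open_nbhs_nbhs; split=> //; exact: cdom_open.
have ob : nbhs p (cmap a @^-1` [set x | enorm (x - x0) < r]).
  apply: (cmap_continuous ap); apply: open_nbhs_nbhs; split=> //; exact: eball_open.
by apply: filterS2 oa ob => q; split.
Qed.

(** As long as the curve stays in the ball of radius rho, its displacement is at most 2 l, which
    places it in a strictly smaller closed ball; [continuation] then applies. *)
Lemma piece_control c (l : R) : C1_curve c -> (curve_length c <= l%:E)%E -> cdom a (c 0) ->
  enorm (cmap a (c 0) - x0) + 2 * l < rho ->
  cdom a (c 1) /\ enorm (cmap a (c 1) - cmap a (c 0)) <= 2 * l.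
Proof.
move=> C1 lenl a0 h.
have l0 : 0 <= l.
  by rewrite -lee_fin; apply: le_trans lenl; apply: integral_ge0 => s _; rewrite lee_fin tnorm_ge0.
set r := enorm (cmap a (c 0) - x0) + 2 * l.
pose O := [set p : M | cdom a p /\ enorm (cmap a p - x0) < rho].
pose K := [set p : M | exists2 x, enorm (x - x0) <= r & p = cinv a x].
have KO : K `<=` O.
  move=> _ [x xr ->]; have xrho := le_lt_trans xr h.
  have [ax _] := good (ltW xrho).
  by split; [exact: cinv_dom|rewrite cinvK].
have D (t : R) : 0 <= t <= 1 -> (forall s : R, 0 <= s <= t -> O (c s)) ->
    enorm (cmap a (c t) - cmap a (c 0)) <= 2 * l.
  move=> t01 H; apply: (displacement_le_length C1 t01 _ lenl) => s st.
  by have [as_ /ltW] := H s st.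
have inO : forall t : R, 0 <= t <= 1 -> O (c t).
  apply: (continuation (chart_region_open _) (chart_image_compact (ltW h)) KO).
  - by move=> t t01; have [] := C1 t t01.
  - split=> //; apply: le_lt_trans h; rewrite lerDl; lra.
  - move=> t t01 H; have [|at_ _] := H t; first by case/andP: t01 => -> _; rewrite lexx.
    exists (cmap a (c t)); last by rewrite cmapK.
    rewrite (le_trans (enorm_triangle _ (cmap a (c 0)) _))// addrC /r lerD2l.
    exact: D.
have l01 : 0 <= (1 : R) <= 1 by rewrite ler01 lexx.
split; first by have [] := inO 1 l01.
by apply: D => // s s01; exact: inO.
Qed.

Lemma curve_length_ge0 c : (0 <= curve_length c)%E.
Proof. by apply: integral_ge0 => s _; rewrite lee_fin tnorm_ge0. Qed.

(** Induction on the pieces of a curve of length less than L: the Euclidean displacement from p is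
    at most twice the length travelled so far, so that every piece starts where [piece_control] is
    applicable. *)
Lemma rdist_control (p q : M) (L : R) : cdom a p ->
  enorm (cmap a p - x0) + 2 * L < rho -> (rdist p q < L%:E)%E ->
  cdom a q /\ enorm (cmap a q - cmap a p) <= 2 * L.
Proof.
move=> ap h /ereal_inf_lt[_ [n [c [pc ->]]] lenL].
have [C1 c0 cn cc] := pc.
pose S m := (\sum_(k < m) curve_length (c k))%E.
have S_le m : (m <= n.+1)%N -> (S m <= S n.+1)%E.
  move=> mn; rewrite /S -(subnKC mn) big_split_ord /=.
  by rewrite leeDl//; apply: sume_ge0 => k _; exact: curve_length_ge0.
have S_fin m : (m <= n.+1)%N -> S m \is a fin_num.
  move=> mn; rewrite ge0_fin_numE; last by apply: sume_ge0 => k _; exact: curve_length_ge0.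
  by apply: le_lt_trans (S_le m mn) (lt_trans lenL _); rewrite ltry.
have SE m : S m.+1 = (S m + curve_length (c m))%E by rewrite /S big_ord_recr.
have cl_fin m : (m <= n)%N -> curve_length (c m) \is a fin_num.
  move=> mn; rewrite ge0_fin_numE ?curve_length_ge0//.
  have : S m.+1 \is a fin_num by exact: S_fin.
  rewrite ge0_fin_numE; last by apply: sume_ge0 => k _; exact: curve_length_ge0.
  apply: le_lt_trans; rewrite SE leeDr//.
  by apply: sume_ge0 => k _; exact: curve_length_ge0.
have SL m : (m <= n)%N -> fine (S m.+1) <= L.
  move=> mn; rewrite -lee_fin fineK ?S_fin//.
  by apply: le_trans (S_le _ _) (ltW lenL).
have step m : (m <= n)%N -> cdom a (c m 0) ->
    enorm (cmap a (c m 0) - cmap a p) <= 2 * fine (S m) ->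
    cdom a (c m 1) /\ enorm (cmap a (c m 1) - cmap a p) <= 2 * fine (S m.+1).
  move=> mn am dm.
  have SS : fine (S m.+1) = fine (S m) + fine (curve_length (c m)).
    by rewrite SE fineD// ?cl_fin// S_fin// leqW.
  have SLm := SL m mn.
  have clf : (curve_length (c m) <= (fine (curve_length (c m)))%:E)%E by rewrite fineK// cl_fin.
  have [|a1 d1] := piece_control (C1 m mn) clf am.
    have := enorm_triangle (cmap a (c m 0)) (cmap a p) x0; lra.
  split=> //.
  have := enorm_triangle (cmap a (c m 1)) (cmap a (c m 0)) (cmap a p); lra.
have all m : (m <= n)%N -> cdom a (c m 1) /\ enorm (cmap a (c m 1) - cmap a p) <= 2 * fine (S m.+1).
  elim: m => [|m IH] mn.
    by apply: step => //; rewrite c0// subrr enorm0 /S big_ord0 mulr0.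
  by have [a1 d1] := IH (ltnW mn); apply: step => //; rewrite -cc.
have [an dn] := all n (leqnn n).
rewrite -cn; split=> //; apply: le_trans dn _.
by rewrite ler_pM2l// SL.
Qed.

End LengthLowerBound.

(** * Variations of geodesics *)

Section FormEstimates.
Context {R : realType}.
Implicit Types (A D P Q G T : 'M[R]_2) (u v w h d p : 'rV[R]_2).

Definition bil A u v : R := \sum_i \sum_j A i j * (u 0 i * v 0 j).

Lemma bil_bound A u v (a b c : R) : (forall i j, `|A i j| <= a) -> `|u| <= b -> `|v| <= c ->
  `|bil A u v| <= 4 * (a * b * c).
Proof.
move=> Aa ub vc.
have h i j : `|A i j * (u 0 i * v 0 j)| <= a * b * c.
  rewrite !normrM -mulrA; apply: ler_pM; rewrite ?mulr_ge0//.
  by apply: ler_pM => //; [exact: le_trans (norm_coord u i) ub|exact: le_trans (norm_coord v j) vc].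
rewrite /bil !sum2E.
have := h 0 0; have := h 0 1; have := h 1 0; have := h 1 1.
move: (A 0 0 * _) (A 0 1 * _) (A 1 0 * _) (A 1 1 * _) (a * b * c) => X Y Z W k.
rewrite !ler_norml => /andP[? ?] /andP[? ?] /andP[? ?] /andP[? ?].
by apply/andP; split; lra.
Qed.

Lemma qform_bil A v : qform A v = bil A v v.
Proof. by rewrite qform2E /bil !sum2E; ring. Qed.

Lemma dot_bound u v (b c : R) : `|u| <= b -> `|v| <= c -> `|dot u v| <= 2 * (b * c).
Proof.
move=> ub vc.
have h i : `|u 0 i * v 0 i| <= b * c.
  rewrite normrM; apply: ler_pM => //.
    exact: le_trans (norm_coord u i) ub.
  exact: le_trans (norm_coord v i) vc.
have := h 0; have := h 1; rewrite /dot.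
move: (u 0 0 * _) (u 0 1 * _) => X Y; rewrite !ler_norml => /andP[? ?] /andP[? ?].
by apply/andP; split; lra.
Qed.

Lemma norm2_le_dot v : `|v| ^+ 2 <= dot v v.
Proof. by rewrite -sqr_enorm ler_pXn2r ?nnegrE ?enorm_ge0// norm_le_enorm. Qed.

Lemma norm_le_bound v (k : R) : (forall i, `|v 0 i| <= k) -> `|v| <= k.
Proof. by move=> h; rewrite norm_rV2_le ?h// (le_trans _ (h 0)). Qed.

(* [d] is a difference of velocities, [p] the difference of the momenta and
   [D] the difference of the metrics. *)
Lemma velocity_difference G D u d p (B la m : R) : 1 <= B -> B^-1 <= la -> 0 <= m ->
  (forall i j, `|D i j| <= 2 * B * m) -> `|u| <= B ->
  la * dot d d <= qform G d -> p = d *m G + u *m D ->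
  `|d| <= 10 * B ^+ 3 * (`|p| + m).
Proof.
move=> B1 Bla m0 Dm uB co pE.
have B0 : 0 < B by lra.
have [->|dn0] := eqVneq d 0.
  by rewrite normr0 !mulr_ge0 ?exprn_ge0 ?addr_ge0// ltW.
have dp : 0 < `|d| by rewrite normr_gt0.
have E : qform G d = dot p d - bil D u d.
  by rewrite pE qform2E /bil /dot !(mxE, sum2E); ring.
have h1 := dot_bound (lexx `|p|) (lexx `|d|).
have h2 := bil_bound Dm uB (lexx `|d|).
have h3 : B^-1 * `|d| ^+ 2 <= 2 * (`|p| * `|d|) + 4 * (2 * B * m * B * `|d|).
  apply: (@le_trans _ _ (la * dot d d)).
    apply: ler_pM; rewrite ?invr_ge0 ?sqr_ge0// ?norm2_le_dot//; lra.
  rewrite (le_trans co)// E.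
  have := ler_norm (dot p d); have := ler_norm (- bil D u d); rewrite normrN; lra.
have {}h3 : `|d| <= B * (2 * `|p| + 8 * B ^+ 2 * m).
  rewrite -(ler_pM2l (_ : 0 < B^-1)) ?invr_gt0// mulrA mulVf ?gt_eqF// mul1r.
  rewrite -(ler_pM2r dp) -mulrA -expr2 (le_trans h3)//.
  by rewrite le_eqVlt; apply/orP; left; apply/eqP; ring.
apply: le_trans h3 _.
have B3 : B <= B ^+ 3 by rewrite ler_eXnr.
have h4 : B * `|p| <= B ^+ 3 * `|p| by rewrite ler_wpM2r.
have h5 : 0 <= B ^+ 3 * m by rewrite mulr_ge0 ?exprn_ge0// ltW.
have h6 : 0 <= B ^+ 3 * `|p| by rewrite mulr_ge0 ?exprn_ge0// ltW.
rewrite (_ : B * _ = 2 * (B * `|p|) + 8 * (B ^+ 3 * m)); last by ring.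
rewrite (_ : 10 * _ * _ = 10 * (B ^+ 3 * `|p|) + 10 * (B ^+ 3 * m)); last by ring.
lra.
Qed.

Lemma qform_difference P Q u v (B m s : R) : 0 <= B ->
  (forall i j, `|P i j - Q i j| <= 2 * B * m) -> (forall i j, `|Q i j| <= B) ->
  `|u| <= B -> `|v| <= B -> `|v - u| <= s ->
  `|qform P v - qform Q u| <= 8 * B ^+ 3 * m + 8 * B ^+ 2 * s.
Proof.
move=> B0 PQ QB uB vB vu.
have E : qform P v - qform Q u = bil (P - Q) v v + (bil Q v (v - u) + bil Q (v - u) u).
  by rewrite !qform2E /bil !(mxE, sum2E); ring.
have PQ' i j : `|(P - Q) i j| <= 2 * B * m by rewrite !mxE; exact: PQ.
have h1 := bil_bound PQ' vB vB.
have h2 := bil_bound QB vB vu.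
have h3 := bil_bound QB vu uB.
rewrite E; apply: (le_trans (ler_normD _ _)).
rewrite (_ : 8 * B ^+ 3 * m = 4 * (2 * B * m * B * B)); last by ring.
apply: lerD => //; apply: (le_trans (ler_normD _ _)).
rewrite (_ : 8 * B ^+ 2 * s = 4 * (B * B * s) + 4 * (B * s * B)); last by ring.
exact: lerD.
Qed.

(* [T] is the first order part of the difference [D] of the metrics. *)
Lemma energy_difference G D T Q u v (B m s : R) : 0 <= B ->
  (forall i j, `|D i j| <= 2 * B * m) -> (forall i j, `|D i j - T i j| <= 4 * B * m ^+ 2) ->
  (forall i j, `|Q i j| <= B) -> Q 0 1 = Q 1 0 -> G = Q + D ->
  `|u| <= B -> `|v| <= B -> `|v - u| <= s ->
  `|2^-1 * qform T u + dot (u *m Q) (v - u) - 2^-1 * (qform G v - qform Q u)|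
  <= 8 * B ^+ 3 * m ^+ 2 + 8 * B ^+ 2 * m * s + 2 * B * s ^+ 2.
Proof.
move=> B0 Dm DT QB Q01 GE uB vB vu.
have E : 2^-1 * qform T u + dot (u *m Q) (v - u) - 2^-1 * (qform G v - qform Q u) =
    - (2^-1 * bil (D - T) u u) + (- (2^-1 * bil D v (v - u)) + (- (2^-1 * bil D (v - u) u)
       - (2^-1 * bil Q (v - u) (v - u)))).
  by rewrite GE !qform2E /bil /dot !(mxE, sum2E) Q01; field.
have DT' i j : `|(D - T) i j| <= 4 * B * m ^+ 2 by rewrite !mxE; exact: DT.
have h1 := bil_bound DT' uB uB.
have h2 := bil_bound Dm vB vu.
have h3 := bil_bound Dm vu uB.
have h4 := bil_bound QB vu vu.
have half (X k : R) : `|X| <= 4 * k -> `|- (2^-1 * X)| <= 2 * k.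
  by rewrite normrN normrM ger0_norm ?invr_ge0// => ?; lra.
have {h1} := half _ _ h1; have {h2} := half _ _ h2.
have {h3} := half _ _ h3; have {h4} := half _ _ h4.
rewrite E; move: (- _) (- _) (- _) (- _) => X Y Z W hX hY hZ hW.
have tri (a b c d : R) : `|a + (b + (c + d))| <= `|a| + (`|b| + (`|c| + `|d|)).
  by rewrite (le_trans (ler_normD _ _))// lerD2l (le_trans (ler_normD _ _))// lerD2l ler_normD.
apply: (le_trans (tri _ _ _ _)).
rewrite (_ : _ + 2 * B * s ^+ 2 = 2 * (4 * B * m ^+ 2 * B * B) + (2 * (2 * B * m * B * s)
   + (2 * (2 * B * m * s * B) + 2 * (B * s * s)))); last by ring.
by do 3! (apply: lerD => //).
Qed.
End FormEstimates.

Section FirstVariation.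
Context {R : realType} (U : set 'rV[R]_2) (g : 'rV[R]_2 -> 'M[R]_2).
Hypotheses (oU : open U) (gU : riemannian_metric U g).
Implicit Types (x h v : 'rV[R]_2).

Lemma segment_mvt (f : 'rV[R]_2 -> R) x h :
  (forall s : R, 0 <= s <= 1 -> differentiable f (x + s *: h)) ->
  exists2 s : R, 0 <= s <= 1 & f (x + h) - f x = \sum_k h 0 k * partial k f (x + s *: h).
Proof.
move=> df.
have dc (s : R) : is_derive s (1 : R) (fun s : R => x + s *: h) h.
  apply/is_derive_rV => k.
  have -> : (fun s : R => (x + s *: h) 0 k) = cst (x 0 k) + h 0 k \*: id.
    by apply/funext => r; rewrite !mxE mulrC.
  by apply: is_derive_eq; rewrite add0r /GRing.scale/= mulr1.
have d (s : R) : 0 <= s <= 1 -> is_derive s (1 : R) (fun s => f (x + s *: h))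
    (\sum_k h 0 k * partial k f (x + s *: h)).
  by move=> s01; exact: is_derive_comp_curve (dc s) (df s s01).
have [c c01] := mvt_closed ler01 d.
by rewrite scale1r scale0r addr0 subr0 mulr1; exists c.
Qed.

Lemma sum2_bound (a b : 'I_2 -> R) (A B : R) : (forall k, `|a k| <= A) -> (forall k, `|b k| <= B) ->
  `|\sum_k a k * b k| <= 2 * (A * B).
Proof.
move=> aA bB; have H k : `|a k * b k| <= A * B by rewrite normrM ler_pM.
rewrite sum2E (le_trans (ler_normD _ _))// (_ : 2 * (A * B) = A * B + A * B); last by ring.
by apply: lerD.
Qed.

Context (B : R).
Hypothesis g0B : forall x, U x -> forall a b, `|g x a b| <= B.
Hypothesis g1B : forall x, U x -> forall k a b, `|partial k (fun y => g y a b) x| <= B.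
Hypothesis g2B : forall x, U x -> forall l k a b,
  `|partial l (partial k (fun y => g y a b)) x| <= B.

Lemma metric_taylor x h : (forall s : R, 0 <= s <= 1 -> U (x + s *: h)) -> forall a b,
  [/\ `|g (x + h) a b - g x a b| <= 2 * B * `|h|,
      forall k, `|partial k (fun y => g y a b) (x + h) - partial k (fun y => g y a b) x|
                <= 2 * B * `|h| &
      `|g (x + h) a b - g x a b - \sum_k h 0 k * partial k (fun y => g y a b) x|
      <= 4 * B * `|h| ^+ 2].
Proof.
move=> segU a b.
have lip (f : 'rV[R]_2 -> R) y : (forall s : R, 0 <= s <= 1 -> differentiable f (x + s *: y)) ->
    (forall s : R, 0 <= s <= 1 -> forall k, `|partial k f (x + s *: y)| <= B) ->
    `|f (x + y) - f x| <= 2 * B * `|y|.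
  move=> df fB; have [s s01 ->] := segment_mvt df.
  apply: (le_trans (sum2_bound (norm_coord y) (fB s s01))).
  by rewrite le_eqVlt; apply/orP; left; apply/eqP; ring.
have L1 k y : (forall s : R, 0 <= s <= 1 -> U (x + s *: y)) ->
    `|partial k (fun y => g y a b) (x + y) - partial k (fun y => g y a b) x| <= 2 * B * `|y|.
  move=> yU; apply: lip => s s01; first exact: (rmetric_partial_diff oU gU k a b (yU s s01)).
  move=> l; exact: g2B (yU s s01) l k a b.
split=> [|k|].
- apply: (lip (fun y => g y a b)) => s s01.
    exact: (rmetric_diff oU gU a b (segU s s01)).
  by move=> k; exact: g1B (segU s s01) k a b.
- exact: L1.
have df (s : R) : 0 <= s <= 1 -> differentiable (fun y => g y a b) (x + s *: h).
  by move=> s01; exact: (rmetric_diff oU gU a b (segU s s01)).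
have [s s01 ->] := segment_mvt df.
have B0 : 0 <= B.
  have Ux : U x by have := segU 0; rewrite scale0r addr0; apply; rewrite lexx ler01.
  by apply: le_trans (normr_ge0 _) (g0B Ux 0 0).
have Ls k : `|partial k (fun y => g y a b) (x + s *: h) - partial k (fun y => g y a b) x|
    <= 2 * B * `|h|.
  have sh : `|s *: h| <= `|h|.
    by case/andP: s01 => s0 s1; rewrite normrZ ger0_norm// ler_piMl.
  apply: le_trans (L1 k (s *: h) _) _; last by rewrite ler_wpM2l ?mulr_ge0.
  move=> r /andP[r0 r1]; rewrite scalerA; apply: segU.
  by case/andP: s01 => s0 s1; rewrite mulr_ge0//= mulr_ile1.
rewrite -sumrB; under eq_bigr do rewrite -mulrBr.
apply: (le_trans (sum2_bound (norm_coord h) Ls)).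
by rewrite le_eqVlt; apply/orP; left; apply/eqP; ring.
Qed.

Lemma gronwall (Y Y' : R -> R) (C T : R) : 0 <= T ->
  (forall t : R, 0 <= t <= T -> is_derive t (1 : R) Y (Y' t)) ->
  (forall t : R, 0 <= t <= T -> Y' t <= C * Y t) ->
  Y T <= Y 0 * expR (C * T).
Proof.
move=> T0 dY hY.
have dE (t : R) : is_derive t (1 : R) (fun t : R => expR (- C * t)) (- C * expR (- C * t)).
  have dl : is_derive t (1 : R) (fun t : R => - C * t) (- C).
    have -> : (fun t : R => - C * t) = - C \*: (id : R -> R) by apply/funext.
    by apply: is_derive_eq; rewrite /GRing.scale/= mulr1.
  by rewrite mulrC; exact: is_derive1_comp (is_derive_expR _) dl.
have dF (t : R) : 0 <= t <= T -> is_derive t (1 : R) (Y * (fun t : R => expR (- C * t)))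
    ((Y' t - C * Y t) * expR (- C * t)).
  move=> tT; have d := is_deriveM (dY t tT) (dE t).
  by apply: (is_derive_eq d); rewrite /GRing.scale/=; ring.
have [c cT] := mvt_closed T0 dF.
rewrite subr0 -[(Y * _) T]/(Y T * expR (- C * T)) -[(Y * _) 0]/(Y 0 * expR (- C * 0)).
rewrite mulr0 expR0 mulr1 => E.
have : Y T * expR (- C * T) <= Y 0.
  rewrite -subr_le0 E -mulrA; apply: mulr_le0_ge0; first by rewrite subr_le0 hY.
  by rewrite mulr_ge0 ?expR_ge0.
rewrite -(ler_pM2r (expR_gt0 (C * T))) -mulrA -expRD.
by rewrite mulNr addNr expR0 mulr1.
Qed.

(** By Cayley-Hamilton tr(G) G - det(G) = G^2, and G^2 is nonnegative, so G is bounded below by det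
    G / tr G, a quotient that is continuous in the point. One number serves both as radius and as
    coercivity constant. *)
Lemma metric_coercive_near x : U x -> exists2 r : R, 0 < r &
  forall y, `|y - x| < r -> U y /\ forall v, r * dot v v <= qform (g y) v.
Proof.
move=> Ux.
have [g00 dg] := posdef_det (rmetric_sym gU Ux) (gU.2 x Ux).2.
have gc a b : {for x, continuous (fun y => g y a b)}.
  by apply: differentiable_continuous; exact: (rmetric_diff oU gU a b Ux).
pose D y : R := g y 0 0 * g y 1 1 - g y 0 1 * g y 1 0.
pose S y : R := g y 0 0 + g y 1 1.
have Dx : 0 < D x by rewrite /D -det2E.
have g11 : 0 < g x 1 1.
  have := sqr_ge0 (g x 0 1); move: Dx; rewrite /D -(rmetric_symE gU 0 1 Ux) -expr2 => h1 h2.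
  by rewrite -(pmulr_rgt0 _ g00); lra.
have Sx : 0 < S x by rewrite /S addr_gt0.
have Dc : {for x, continuous D}.
  by apply: continuousB; apply: continuousM; exact: gc.
have Sc : {for x, continuous S} by apply: continuousD; exact: gc.
have nD : \forall y \near x, D x / 2 < D y.
  apply: (Dc [set z | D x / 2 < z]); apply: open_nbhs_nbhs; split; first exact: open_gt.
  by rewrite /=; lra.
have nS : \forall y \near x, S y < 2 * S x.
  apply: (Sc [set z | z < 2 * S x]); apply: open_nbhs_nbhs; split; first exact: open_lt.
  by rewrite /=; lra.
have nU : nbhs x U by exact: open_nbhs_nbhs.
have : \forall y \near x, [/\ U y, D x / 2 < D y & S y < 2 * S x].
  by apply: filterS3 nU nD nS => y; split.
move=> /nbhs_ballP[r /= r0 rP].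
pose la := D x / (4 * S x).
have la0 : 0 < la by rewrite divr_gt0// mulr_gt0.
exists (Num.min r la); first by rewrite lt_min r0.
move=> y; rewrite lt_min => /andP[yr _].
have [Uy Dy Sy] : [/\ U y, D x / 2 < D y & S y < 2 * S x].
  by apply: rP; rewrite -ball_normE/= distrC.
split=> // v; apply: (@le_trans _ _ (la * dot v v)).
  by rewrite ler_wpM2r ?dot_ge0// ge_min lexx orbT.
have [g00y dgy] := posdef_det (rmetric_sym gU Uy) (gU.2 y Uy).2.
have q0 := qform_ge0 (gU.2 y Uy).2 v.
have E : S y * qform (g y) v - D y * dot v v =
  (g y 0 0 * v 0 0 + g y 0 1 * v 0 1) ^+ 2 + (g y 0 1 * v 0 0 + g y 1 1 * v 0 1) ^+ 2.
  rewrite /S /D qform2E /dot -(rmetric_symE gU 0 1 Uy); ring.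
have H : D y * dot v v <= S y * qform (g y) v.
  by rewrite -subr_ge0 E addr_ge0 ?sqr_ge0.
have H2 : D x / 2 * dot v v <= 2 * S x * qform (g y) v.
  apply: (@le_trans _ _ (D y * dot v v)); first by rewrite ler_wpM2r ?dot_ge0// ltW.
  by apply: le_trans H _; rewrite ler_wpM2r// ltW.
rewrite /la -(ler_pM2l (_ : 0 < 2 * S x)) ?mulr_gt0//.
apply: le_trans H2; rewrite le_eqVlt; apply/orP; left; apply/eqP; field.
by rewrite gt_eqF.
Qed.

(** Compactness of the image of y makes [metric_coercive_near] uniform along the curve. The number e
    depends on the curve: it is not bounded below in terms of the norms of g. *)
Lemma metric_tube (y : R -> 'rV[R]_2) :
  (forall t : R, 0 <= t <= 1 -> U (y t)) -> (forall t : R, 0 <= t <= 1 -> {for t, continuous y}) ->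
  exists2 e : R, 0 < e & forall t : R, 0 <= t <= 1 -> forall x, `|x - y t| < e ->
    U x /\ forall v, e * dot v v <= qform (g x) v.
Proof.
move=> yU yc.
have K : compact (y @` `[0, 1]).
  apply: continuous_compact; last exact: segment_compact.
  by apply: continuous_in_subspaceT => t; rewrite inE/= in_itv/= => /yc.
pose P (e : R) z := forall x, `|x - z| < e -> U x /\ forall v, e * dot v v <= qform (g x) v.
have : \forall e \near 0^'+, y @` `[0, 1] `<=` P e.
  apply: (compact_near_coveringP _).1 K _ _ _ _ _ => z [t /=]; rewrite in_itv/= => t01 <-.
  have [r r0 rP] := metric_coercive_near (yU t t01).
  exists (ball (y t) (r / 2), [set e : R | 0 < e < r / 2]).
    split; first by apply: nbhsx_ballx; rewrite divr_gt0.
    rewrite /=; near=> e; apply/andP; split; near: e; first exact: nbhs_right_gt.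
    by apply: nbhs_right_lt; rewrite divr_gt0.
  move=> [z' e] /= [zz' /andP[e0 er]] x xz'.
  have xr : `|x - y t| < r.
    move: zz'; rewrite -ball_normE/= => zz'.
    have -> : x - y t = (x - z') + (z' - y t) by rewrite addrA subrK.
    rewrite (le_lt_trans (ler_normD _ _))// (distrC z'); lra.
  have [Ux cx] := rP x xr; split=> // v; apply: le_trans (cx v).
  by rewrite ler_wpM2r ?dot_ge0//; lra.
move=> H; have [e [e0 eP]] : exists e : R, 0 < e /\ y @` `[0, 1] `<=` P e.
  have /filter_ex[e [? ?]] : \forall e \near 0^'+, 0 < e /\ y @` `[0, 1] `<=` P e.
    by near=> e; split; near: e; [exact: nbhs_right_gt|exact: H].
  by exists e.
by exists e => // t t01; apply: eP; exists t => //=; rewrite in_itv.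
Unshelve. all: by end_near. Qed.

End FirstVariation.

(** * The first variation formula for two geodesics with the same origin *)

Section GaussLemma.
Context {R : realType} (U : set 'rV[R]_2) (g : 'rV[R]_2 -> 'M[R]_2).
Hypotheses (oU : open U) (gU : riemannian_metric U g).
Implicit Types (x h v : 'rV[R]_2).

(* The geodesic equation in Euler-Lagrange form, for the momentum [u *m g y]; the
   connection does not appear. *)
Definition chart_geodesic (y u : R -> 'rV[R]_2) (E : R) :=
  forall t : R, 0 <= t <= 1 -> [/\ U (y t), is_derive t (1 : R) y (u t),
    forall k, is_derive t (1 : R) (fun s => (u s *m g (y s)) 0 k)
                        (2^-1 * qform (dM k g (y t)) (u t)) &
    qform (g (y t)) (u t) = E].

(** Bookkeeping for [first_variation]: m, p and s bound the differences of positions, momenta and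
    velocities, and q^2 is the squared distance in phase space. All error terms become multiples of
    q^2. *)
Lemma bounds_compare (B K q m p s : R) : 1 <= B -> 0 <= q -> 0 <= m <= q -> 0 <= p <= q ->
  0 <= s -> K = 20 * B ^+ 3 -> s <= 10 * B ^+ 3 * (p + m) ->
  [/\ s <= K * q,
      2 * (2 * (m * s)) + 2 * (2 * (p * (4 * B ^+ 3 * m + 4 * B ^+ 2 * s)))
        <= (4 * K + 16 * B ^+ 3 + 16 * B ^+ 2 * K) * q ^+ 2 &
      8 * B ^+ 3 * m ^+ 2 + 8 * B ^+ 2 * m * s + 2 * B * s ^+ 2
        <= (8 * B ^+ 3 + 8 * B ^+ 2 * K + 2 * B * K ^+ 2) * q ^+ 2].
Proof.
move=> B1 q0 /andP[m0 mq] /andP[p0 pq] s0 KE sp.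
have B0 : 0 <= B by lra.
have B2 : 0 <= B ^+ 2 by rewrite exprn_ge0.
have B3 : 0 <= B ^+ 3 by rewrite exprn_ge0.
have sK : s <= K * q.
  apply: (le_trans sp); rewrite KE (_ : 20 * B ^+ 3 * q = 10 * B ^+ 3 * (q + q)); last by ring.
  by rewrite ler_wpM2l ?mulr_ge0//; lra.
have ms : m * s <= K * q ^+ 2.
  rewrite (_ : K * q ^+ 2 = q * (K * q)); last by ring.
  exact: ler_pM.
have pm : p * m <= q ^+ 2 by rewrite expr2; exact: ler_pM.
have ps : p * s <= K * q ^+ 2.
  rewrite (_ : K * q ^+ 2 = q * (K * q)); last by ring.
  exact: ler_pM.
have mm : m ^+ 2 <= q ^+ 2 by rewrite ler_pXn2r ?nnegrE.
have ss : s ^+ 2 <= K ^+ 2 * q ^+ 2.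
  by rewrite -exprMn ler_pXn2r ?nnegrE//; exact: le_trans sK.
have h1 := ler_wpM2l B3 pm.
have h2 := ler_wpM2l B2 ps.
have h3 := ler_wpM2l B3 mm.
have h4 := ler_wpM2l B2 ms.
have h5 := ler_wpM2l B0 ss.
split=> //.
  rewrite (_ : 2 * (2 * (m * s)) + _ = 4 * (m * s) + 16 * (B ^+ 3 * (p * m))
    + 16 * (B ^+ 2 * (p * s))); last by ring.
  rewrite (_ : (4 * K + _ + _) * _ = 4 * (K * q ^+ 2) + 16 * (B ^+ 3 * q ^+ 2)
    + 16 * (B ^+ 2 * (K * q ^+ 2))); last by ring.
  lra.
rewrite (_ : 8 * B ^+ 3 * m ^+ 2 + _ + _ = 8 * (B ^+ 3 * m ^+ 2) + 8 * (B ^+ 2 * (m * s))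
    + 2 * (B * s ^+ 2)); last by ring.
rewrite (_ : (8 * B ^+ 3 + _ + _) * _ = 8 * (B ^+ 3 * q ^+ 2) + 8 * (B ^+ 2 * (K * q ^+ 2))
    + 2 * (B * (K ^+ 2 * q ^+ 2))); last by ring.
lra.
Qed.

Context (B0 : R).
Hypothesis g0B : forall x, U x -> forall a b, `|g x a b| <= B0.
Hypothesis g1B : forall x, U x -> forall k a b, `|partial k (fun y => g y a b) x| <= B0.
Hypothesis g2B : forall x, U x -> forall l k a b,
  `|partial l (partial k (fun y => g y a b)) x| <= B0.

(* The energies of two geodesics issued from the same point differ to first
   order by the boundary term of the first variation formula. *)
Lemma first_variation y u E : chart_geodesic y u E ->
  exists C r : R, [/\ 0 <= C, 0 < r & forall z w E', chart_geodesic z w E' -> z 0 = y 0 ->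
    `|w 0 - u 0| <= r ->
    `|dot (u 1 *m g (y 1)) (z 1 - y 1) - 2^-1 * (E' - E)| <= C * `|w 0 - u 0| ^+ 2].
Proof.
move=> yG.
have yU (t : R) : 0 <= t <= 1 -> U (y t) by move=> /yG[].
have yc (t : R) : 0 <= t <= 1 -> {for t, continuous y}.
  by move=> /yG[_ d _ _]; exact: is_derive_continuous d.
have [e e0 tube] := metric_tube oU gU yU yc.
have O01 : 0 <= (0 : R) <= 1 by rewrite lexx ler01.
have B00 : 0 <= B0 by apply: le_trans (normr_ge0 _) (g0B (yU 0 O01) 0 0).
pose E1 := 4 * (B0 * (`|u 0| + 1) * (`|u 0| + 1)).
have E10 : 0 <= E1 by rewrite !mulr_ge0// addr_ge0.
have energy_le z w E' : chart_geodesic z w E' -> z 0 = y 0 -> `|w 0| <= `|u 0| + 1 -> E' <= E1.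
  move=> /(_ 0 O01)[_ _ _ <-] -> w0; rewrite qform_bil.
  exact: le_trans (ler_norm _) (bil_bound (g0B (yU 0 O01)) w0 w0).
(* One constant dominating 1, the bounds on the metric, the inverse of the coercivity constant and
   the squared speeds, which are at most E1 / e in the tube. *)
pose B := 1 + B0 + e^-1 + E1 / e.
have ei0 : 0 <= e^-1 by rewrite invr_ge0 ltW.
have Ee0 : 0 <= E1 / e by rewrite mulr_ge0.
have B1 : 1 <= B by rewrite /B; lra.
have BB0 : B0 <= B by rewrite /B; lra.
have B_ge0 : 0 <= B by lra.
have Be : B^-1 <= e.
  rewrite -[leRHS]invrK lef_pV2 ?posrE; [rewrite /B; lra|lra|by rewrite invr_gt0].
have speedB x v E' : (forall v, e * dot v v <= qform (g x) v) -> qform (g x) v = E' -> E' <= E1 ->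
    `|v| <= B.
  move=> co qE EE; rewrite -(@ler_pXn2r _ 2) ?nnegrE//.
  apply: (@le_trans _ _ B); last by rewrite expr2 ler_peMr.
  apply: (le_trans (norm2_le_dot v)); apply: (@le_trans _ _ (E1 / e)); last by rewrite /B; lra.
  by rewrite ler_pdivlMr// mulrC (le_trans (co v))// qE.
pose K := 20 * B ^+ 3.
pose C1 := 4 * K + 16 * B ^+ 3 + 16 * B ^+ 2 * K.
pose C2 := 8 * B ^+ 3 + 8 * B ^+ 2 * K + 2 * B * K ^+ 2.
have K0 : 0 <= K by rewrite mulr_ge0 ?exprn_ge0.
have C20 : 0 <= C2 by rewrite /C2 !addr_ge0 ?mulr_ge0 ?exprn_ge0.
have C10 : 0 <= C1 by rewrite /C1 !addr_ge0 ?mulr_ge0 ?exprn_ge0.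
pose A := 8 * B ^+ 2 * expR C1.
have A0 : 0 < A by rewrite !mulr_gt0 ?expR_gt0//; lra.
(* For d0 <= 1 the bound A d0^2 on the squared distance in phase space is at most A d0, and the
   second entry of the minimum makes this smaller than e^2: the second geodesic stays in the
   tube. *)
exists (C2 * A), (Num.min 1 (e ^+ 2 / (A + 1))); split.
- by rewrite mulr_ge0// ltW.
- by rewrite lt_min ltr01 divr_gt0 ?exprn_gt0//; lra.
move=> z w E' zG zy0; rewrite le_min => /andP[w1 wr].
have w0b : `|w 0| <= `|u 0| + 1.
  by rewrite -[w 0](subrK (u 0)) (le_trans (ler_normD _ _))// addrC lerD2l.
have E'E := energy_le z w E' zG zy0 w0b.
have EE : E <= E1 by apply: (energy_le y u E yG); rewrite ?lerDl.
set d0 := `|w 0 - u 0| in w1 wr *.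
have d00 : 0 <= d0 by exact: normr_ge0.
pose eta t := z t - y t.
pose p t := u t *m g (y t).
pose pi t := w t *m g (z t) - p t.
(* The squared distance in phase space, measured with momenta: their equation contains only first
   derivatives of g, which are Lipschitz thanks to the bound on the second ones. *)
pose Y t : R := eta t 0 0 ^+ 2 + eta t 0 1 ^+ 2 + (pi t 0 0 ^+ 2 + pi t 0 1 ^+ 2).
pose P' k t := 2^-1 * qform (dM k g (z t)) (w t) - 2^-1 * qform (dM k g (y t)) (u t).
pose Y' t : R := 2 * dot (eta t) (w t - u t) + 2 * (pi t 0 0 * P' 0 t + pi t 0 1 * P' 1 t).
have deta (t : R) : 0 <= t <= 1 -> forall k, is_derive t (1 : R) (fun s => eta s 0 k) ((w t - u t) 0 k).
  move=> t01; have [_ dy _ _] := yG t t01; have [_ dz _ _] := zG t t01.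
  have H := is_deriveB dz dy.
  by apply/is_derive_rV.
have dpi (t : R) : 0 <= t <= 1 -> forall k, is_derive t (1 : R) (fun s => pi s 0 k) (P' k t).
  move=> t01 k; have [_ _ /(_ k) dy _] := yG t t01; have [_ _ /(_ k) dz _] := zG t t01.
  have -> : (fun s => pi s 0 k) = (fun s => (w s *m g (z s)) 0 k) - (fun s => p s 0 k).
    by apply/funext => s; rewrite /pi /p mxE [X in _ + X]mxE.
  exact: (is_deriveB dz dy).
have dY (t : R) : 0 <= t <= 1 -> is_derive t (1 : R) Y (Y' t).
  move=> t01; have de := deta t t01; have dp := dpi t t01.
  have d := is_deriveD
    (is_deriveD (is_deriveM (de 0) (de 0)) (is_deriveM (de 1) (de 1)))
    (is_deriveD (is_deriveM (dp 0) (dp 0)) (is_deriveM (dp 1) (dp 1))).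
  have -> : Y = (fun s => eta s 0 0) * (fun s => eta s 0 0) + (fun s => eta s 0 1) * (fun s => eta s 0 1)
     + ((fun s => pi s 0 0) * (fun s => pi s 0 0) + (fun s => pi s 0 1) * (fun s => pi s 0 1)).
    by apply/funext => s; rewrite /Y !expr2.
  apply: (is_derive_eq d); rewrite /GRing.scale/= /Y' /dot.
  move: (eta t 0 0) (eta t 0 1) (pi t 0 0) (pi t 0 1) ((w t - u t) 0 0) ((w t - u t) 0 1).
  by move: (P' 0 t) (P' 1 t) => *; ring.
have Y0 t : 0 <= Y t by rewrite /Y !addr_ge0 ?sqr_ge0.
have YE t : Y t = dot (eta t) (eta t) + dot (pi t) (pi t) by rewrite /Y /dot !expr2.
have eta_le t : `|eta t| <= Num.sqrt (Y t).
  rewrite -[leLHS]ger0_norm// -sqrtr_sqr ler_wsqrtr// YE.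
  by rewrite (le_trans (norm2_le_dot _))// lerDl dot_ge0.
have pi_le t : `|pi t| <= Num.sqrt (Y t).
  rewrite -[leLHS]ger0_norm// -sqrtr_sqr ler_wsqrtr// YE.
  by rewrite (le_trans (norm2_le_dot _))// lerDr dot_ge0.
(* While the distance in phase space is below e, the point [z t] lies in the tube around y. There Y
   satisfies the inequality required by Gronwall, and the first order expansion of half the energy
   has an error of order Y. *)
have key (t : R) : 0 <= t <= 1 -> Y t < e ^+ 2 -> Y' t <= C1 * Y t /\
    `|2^-1 * qform (\sum_k eta t 0 k *: dM k g (y t)) (u t) + dot (p t) (w t - u t) - 2^-1 * (E' - E)|
      <= C2 * Y t.
  move=> t01 Yt; have [Uy _ _ yE] := yG t t01; have [Uz _ _ zE] := zG t t01.
  set m := `|eta t|; set q := Num.sqrt (Y t).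
  have q0 : 0 <= q by exact: sqrtr_ge0.
  have q2 : q ^+ 2 = Y t by rewrite sqr_sqrtr.
  have qe : q < e by rewrite -(@ltr_pXn2r _ 2) ?nnegrE// ?ltW// q2.
  have zE' : y t + eta t = z t by rewrite /eta addrC subrK.
  have seg (s : R) : 0 <= s <= 1 -> U (y t + s *: eta t).
    move=> /andP[s0 s1]; apply: (tube t t01 _ _).1; rewrite addrAC subrr add0r.
    rewrite normrZ ger0_norm// (le_lt_trans _ qe)// (le_trans _ (eta_le t))//.
    by rewrite ler_piMl.
  have tay := metric_taylor oU gU g0B g1B g2B seg; rewrite zE' in tay.
  have m0 : 0 <= m by exact: normr_ge0.
  have B0m : 2 * B0 * m <= 2 * B * m by rewrite ler_wpM2r// ler_wpM2l.
  pose D := g (z t) - g (y t).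
  have DB i j : `|D i j| <= 2 * B * m.
    by rewrite !mxE; have [h _ _] := tay i j; exact: le_trans h B0m.
  have uB : `|u t| <= B.
    apply: (speedB (y t) _ _ _ yE EE); apply: (tube t t01 _ _).2.
    by rewrite subrr normr0.
  have zt : `|z t - y t| < e by exact: le_lt_trans (eta_le t) qe.
  have co := (tube t t01 _ zt).2.
  have wB : `|w t| <= B by exact: speedB co zE E'E.
  set s := `|w t - u t|.
  have s0 : 0 <= s by exact: normr_ge0.
  have sp : s <= 10 * B ^+ 3 * (`|pi t| + m).
    apply: (velocity_difference B1 Be m0 DB uB (co _)).
    rewrite /pi /p /D mulmxBl mulmxBr addrA; congr (_ - _).
    by rewrite -addrA addNr addr0.
  have m0q : 0 <= m <= q by rewrite m0 eta_le.
  have p0q : 0 <= `|pi t| <= q by rewrite normr_ge0 pi_le.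
  have [sK h1 h2] := bounds_compare B1 q0 m0q p0q s0 (erefl K) sp.
  rewrite -q2; split.
    apply: le_trans h1.
    have Pk k : `|P' k t| <= 4 * B ^+ 3 * m + 4 * B ^+ 2 * s.
      have PQ i j : `|dM k g (z t) i j - dM k g (y t) i j| <= 2 * B * m.
        by rewrite !dME; have [_ h _] := tay i j; exact: le_trans (h k) B0m.
      have QB i j : `|dM k g (y t) i j| <= B by rewrite dME (le_trans (g1B Uy _ _ _)).
      have h := qform_difference B_ge0 PQ QB uB wB (lexx s).
      rewrite /P' -mulrBr normrM ger0_norm ?invr_ge0//.
      by move: h; move: (`| _ - _ |) => X h; lra.
    have a1 := dot_bound (lexx m) (lexx s).
    have a2 := sum2_bound (norm_coord (pi t)) Pk; rewrite sum2E in a2.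
    rewrite /Y'; apply: lerD; rewrite ler_wpM2l//; apply: le_trans (ler_norm _) _ => //.
  apply: le_trans h2.
  have DT i j : `|D i j - (\sum_k eta t 0 k *: dM k g (y t)) i j| <= 4 * B * m ^+ 2.
    have [_ _ h] := tay i j.
    have -> : (\sum_k eta t 0 k *: dM k g (y t)) i j =
        \sum_k eta t 0 k * partial k (fun x => g x i j) (y t).
      by rewrite summxE; apply: eq_bigr => k _; rewrite mxE dME.
    rewrite /D !mxE; apply: le_trans h _.
    by rewrite ler_wpM2r ?exprn_ge0// ler_wpM2l.
  have QB i j : `|g (y t) i j| <= B by apply: le_trans (g0B Uy i j) BB0.
  have GE : g (z t) = g (y t) + D by rewrite /D addrC subrK.
  have := energy_difference B_ge0 DB DT QB (rmetric_symE gU 0 1 Uy) GE uB wB (lexx s).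
  by rewrite zE yE.
have zyc0 : eta 0 = 0 by rewrite /eta zy0 subrr.
have Y0d : Y 0 <= 8 * B ^+ 2 * d0 ^+ 2.
  have E0 : pi 0 = (w 0 - u 0) *m g (y 0) by rewrite /pi /p zy0 mulmxBl.
  have z00 i : (0 : 'rV[R]_2) 0 i = 0 by rewrite mxE.
  rewrite YE zyc0 /dot !z00 mulr0 addr0 add0r -!expr2.
  have h k : pi 0 0 k ^+ 2 <= 4 * B ^+ 2 * d0 ^+ 2.
    rewrite -[leLHS]real_normK ?num_real// (_ : 4 * _ * _ = (2 * (d0 * B)) ^+ 2); last by ring.
    rewrite ler_pXn2r ?nnegrE ?mulr_ge0//.
    rewrite E0 mxE; apply: sum2_bound => i; first exact: norm_coord.
    by apply: le_trans (g0B (yU 0 O01) i k) BB0.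
  rewrite (_ : 8 * _ * _ = 4 * B ^+ 2 * d0 ^+ 2 + 4 * B ^+ 2 * d0 ^+ 2); last by ring.
  by apply: lerD; exact: h.
have YA : Y 0 * expR C1 <= A * d0 ^+ 2.
  rewrite /A mulrAC ler_wpM2r ?expR_ge0//.
have Ae : A * d0 ^+ 2 < e ^+ 2.
  have d2 : d0 ^+ 2 <= d0 by rewrite expr2 ler_piMl.
  have A1 : 0 < A + 1 by lra.
  apply: (@le_lt_trans _ _ (A * (e ^+ 2 / (A + 1)))).
    by rewrite (ler_wpM2l (ltW A0))//; exact: le_trans d2 wr.
  rewrite mulrCA -[ltRHS]mulr1 ltr_pM2l ?exprn_gt0//.
  by rewrite (ltr_pdivrMr _ _ A1) mul1r ltrDl ltr01.
have Yc (t : R) : 0 <= t <= 1 -> {for t, continuous Y}.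
  by move=> t01; exact: is_derive_continuous (dY t t01).
have gron (t : R) : 0 <= t <= 1 -> (forall s : R, 0 <= s <= t -> Y s < e ^+ 2) -> Y t <= A * d0 ^+ 2.
  move=> /andP[t0 t1] Hs.
  have s01 (s : R) : 0 <= s <= t -> 0 <= s <= 1.
    by move=> /andP[-> st]; rewrite (le_trans st).
  apply: (@le_trans _ _ (Y 0 * expR (C1 * t))).
    apply: (gronwall t0 (fun s st => dY s (s01 s st))) => s st.
    exact: (key s (s01 s st) (Hs s st)).1.
  apply: le_trans YA; rewrite ler_wpM2l// ler_expR -[leRHS]mulr1 ler_wpM2l//.
have Yall : forall t : R, 0 <= t <= 1 -> Y t < e ^+ 2.
  apply: (@continuation _ _ Y [set r | r < e ^+ 2] [set r | r <= A * d0 ^+ 2]).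
  - exact: open_lt.
  - exact: closed_le.
  - by move=> r /= /le_lt_trans; apply.
  - exact: Yc.
  - rewrite /=; apply: le_lt_trans Ae; apply: le_trans YA.
    by rewrite ler_peMr// -expR0 ler_expR.
  - exact: gron.
have YA' (t : R) : 0 <= t <= 1 -> Y t <= A * d0 ^+ 2.
  move=> t01; apply: gron => // s /andP[s0 st]; apply: Yall; rewrite s0.
  by case/andP: t01 => _ t1; rewrite (le_trans st).
(* By the Euler-Lagrange equation the derivative of <p, eta> is the first order part of the
   variation of half the energy, so H' is the quadratic remainder bounded in [key]. *)
pose H (t : R) : R := dot (p t) (eta t) - 2^-1 * (E' - E) * t.
pose H' (t : R) : R := 2^-1 * qform (\sum_k eta t 0 k *: dM k g (y t)) (u t)
   + dot (p t) (w t - u t) - 2^-1 * (E' - E).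
have dH (t : R) : 0 <= t <= 1 -> is_derive t (1 : R) H (H' t).
  move=> t01; have [_ _ dp _] := yG t t01; have de := deta t t01.
  have dl : is_derive t (1 : R) (fun t : R => 2^-1 * (E' - E) * t) (2^-1 * (E' - E)).
    have -> : (fun t : R => 2^-1 * (E' - E) * t) = (2^-1 * (E' - E)) \*: (id : R -> R).
      by apply/funext.
    by apply: is_derive_eq; rewrite /GRing.scale/= mulr1.
  have d := is_deriveB (is_deriveD (is_deriveM (dp 0) (de 0)) (is_deriveM (dp 1) (de 1))) dl.
  have -> : H = (fun s => p s 0 0) * (fun s => eta s 0 0) + (fun s => p s 0 1) * (fun s => eta s 0 1)
     - (fun t : R => 2^-1 * (E' - E) * t) by [].
  apply: (is_derive_eq d); rewrite /GRing.scale/= /H' /dot.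
  have -> : qform (\sum_k eta t 0 k *: dM k g (y t)) (u t) =
     eta t 0 0 * qform (dM 0 g (y t)) (u t) + eta t 0 1 * qform (dM 1 g (y t)) (u t).
    rewrite sum2E !qform2E; move: (dM 0 g (y t)) (dM 1 g (y t)) (eta t) => D0 D1 et.
    by rewrite !mxE; ring.
  move: (qform _ _) (qform _ _) (eta t 0 0) (eta t 0 1) (p t 0 0) (p t 0 1).
  by move: ((w t - u t) 0 0) ((w t - u t) 0 1) => *; rewrite /p; ring.
have [c c01] := mvt_closed ler01 dH.
rewrite subr0 mulr1 {1}/H mulr1 {1}/H mulr0 subr0.
have -> : dot (p 0) (eta 0) = 0 by rewrite zyc0 /dot !mxE !mulr0 addr0.
rewrite subr0 => ->.
apply: le_trans (key c c01 (Yall c c01)).2 _.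
by rewrite -mulrA ler_wpM2l// YA'.
Qed.

End GaussLemma.

(** * The size of a chart *)

(** Lagrange's identity: the defect in the squared inequality is det G times the square of the
    determinant of u and e. *)
Lemma metric_cauchy_schwarz (R : realType) (G : 'M[R]_2) (u e : 'rV[R]_2) :
  G^T = G -> (forall v, v != 0 -> 0 < qform G v) ->
  `|dot (u *m G) e| <= Num.sqrt (qform G u) * Num.sqrt (qform G e).
Proof.
move=> sG pG; have q0 := qform_ge0 pG.
rewrite -sqrtrM// -sqrtr_sqr ler_wsqrtr// -subr_ge0.
have G01 : G 0 1 = G 1 0 by rewrite -[in LHS]sG mxE.
have [_ dG] := posdef_det sG pG.
have -> : qform G u * qform G e - dot (u *m G) e ^+ 2 =
   \det G * (u 0 0 * e 0 1 - u 0 1 * e 0 0) ^+ 2.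
  by rewrite det2E !qform2E /dot !mulmx2E G01; ring.
by rewrite mulr_ge0 ?sqr_ge0// ltW.
Qed.

Section ExponentialChart.
Context {R : realType} (M : riemannian_surface R) (p0 : M) (delta : R).
Context (phi : chart R M) (g : 'rV[R]_2 -> 'M[R]_2) (n : chart R M) (r : R).
Hypotheses (delta0 : 0 < delta) (dr : delta < r) (ag : admissible phi g).
Hypothesis domE : cdom phi = rball p0 delta.
Hypotheses (nball : ccod n = tball p0 r) (nC : forall i, Ck_compatible 1 n (surf_chart i)).
Hypothesis nexp : forall v, tball p0 r v -> is_exp p0 v (cinv n v).

Notation x0 := (cmap phi p0).
Notation U := (ccod phi).

Let gU : riemannian_metric U g. Proof. by case: ag. Qed.
Let oU : open U. Proof. exact: ccod_open. Qed.

Definition logx x := cmap n (cinv phi x).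

Lemma rdist_self (p : M) : (rdist p p <= 0)%E.
Proof.
apply: ereal_inf_lbound; exists 0%N, (fun _ _ => p); split.
  split=> // k _ t _; split=> [|i ip x]; first exact: cst_continuous.
  split; first by exists 1 => //= s _; exact: derivable_cst.
  have -> : derive1 x = cst 0 by apply/funext => s; rewrite derive1_cst.
  exact: cst_continuous.
rewrite big_ord1 /curve_length.
rewrite (@eq_integral _ _ _ _ _ (cst 0%E)) ?integral0// => s _.
have -> : velocity (fun=> p) s = 0 by rewrite /velocity derive1_cst.
have := tnormZ p 0 (lexx 0); rewrite scale0r mul0r => ->//.
Qed.

Lemma p0_dom : cdom phi p0.
Proof.
rewrite domE; apply: (@le_lt_trans _ _ 0%E); first exact: rdist_self.
by rewrite lte_fin.
Qed.

(** Tangent vectors at p0 are written in the coordinates of [chart_at p0]; multiplication by [J0]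
    rewrites them in those of [phi]. *)
Let J0 := jac (transition (chart_at p0) phi) (cmap (chart_at p0) p0).

(** A radial geodesic of initial speed less than delta stays at distance less than delta from p0.
    Since the domain of [phi] is a distance ball, the whole geodesic can be read in that chart. *)
Lemma exp_chart_geodesic v : tnorm p0 v < delta ->
  exists y u, [/\ chart_geodesic U g y u (tnorm p0 v ^+ 2), y 0 = x0,
     cdom phi (cinv n v), y 1 = cmap phi (cinv n v) & u 0 = v *m J0].
Proof.
move=> vd; have [lo [hi [c [[l0 h1 gc] [c0 cv c1]]]]] := nexp (lt_trans vd dr).
have cin (t : R) : 0 <= t <= 1 -> lo < t < hi.
  by move=> /andP[t0 t1]; rewrite (lt_le_trans l0)//= (le_lt_trans t1).
have cdom_c (t : R) : 0 <= t <= 1 -> cdom phi (c t).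
  move=> t01; rewrite domE; have := rdist_geodesic gc l0 h1 t01.
  rewrite c0 cv => /le_lt_trans; apply; rewrite lte_fin.
  case/andP: t01 => t0 t1; apply: le_lt_trans vd.
  by rewrite ler_piMl// tnorm_ge0.
have O01 : 0 <= (0 : R) <= 1 by rewrite lexx ler01.
have I01 : 0 <= (1 : R) <= 1 by rewrite lexx ler01.
pose y t := cmap phi (c t).
exists y, (derive1 y); split.
- move=> t t01; have [dy du] := geodesic_chart ag gc (cin t t01) (cdom_c t t01).
  have Uy := cmap_cod (cdom_c t t01).
  split=> // [k|]; first exact: (momentum_is_derive oU gU Uy dy du k).
  have ct : {for t, continuous c} by have [] := gc t (cin t t01).
  have S := speed_admissible ag ct (cdom_c t t01) dy.
  case/andP: t01 => t0 t1.
  have GS := geodesic_speed gc l0 (le_lt_trans t1 h1) t0.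
  have q0 := metric_qform_ge0 (derive1 y t) ag (cdom_c t (introT andP (conj t0 t1))).
  by rewrite -cv -c0 GS S (sqr_sqrtr q0).
- by rewrite /y c0.
- by rewrite -c1; exact: cdom_c.
- by rewrite /y c1.
have [_ /(_ (index_at p0))] := gc 0 (cin 0 O01).
rewrite c0 => /(_ (cdom_chart_at p0))[dz _ _].
have c00 : {for 0, continuous c} by have [] := gc 0 (cin 0 O01).
have [_ aC _] := ag.
have dz' := derive1_is_derive dz.
have d := is_derive_transition (Ck_map_le (isT : (1 <= 3)%N) (aC (index_at p0)).2) c00.
have := d; rewrite {1 2 3}c0 => /(_ _ (cdom_chart_at p0) p0_dom dz') H.
rewrite (is_derive_derive1 H); congr (_ *m _).
by rewrite -cv /velocity c0.
Qed.

Lemma tnorm0 : tnorm p0 0 = 0.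
Proof. by have := tnormZ p0 0 (lexx 0); rewrite scale0r mul0r. Qed.

Lemma ccod_n v : tnorm p0 v < delta -> ccod n v.
Proof. by move=> vd; rewrite nball; exact: lt_trans dr. Qed.

(** [is_exp] only provides some geodesic with the given initial velocity. That it is constant for
    the velocity 0 follows from conservation of energy, zero energy forcing zero velocity. *)
Lemma exp_zero : cinv n 0 = p0.
Proof.
have z : tnorm p0 0 < delta by rewrite tnorm0.
have [y [u [yG y0 dn y1 _]]] := exp_chart_geodesic z.
have u0 (t : R) : 0 <= t <= 1 -> u t = 0.
  move=> t01; have [Uy _ _] := yG t t01; rewrite tnorm0 expr0n/= => q0.
  apply/eqP; apply: contraT => un0.
  by have [_ /(_ _ un0)] := gU.2 _ Uy; rewrite q0 ltxx.
have yk k : y 0 0 k = y 1 0 k.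
  apply: (@is_derive0_cst _ (fun t => y t 0 k) 0 1 ler01) => t t01.
  have [_ /is_derive_rV/(_ k) d _ _] := yG t t01.
  by apply: (is_derive_eq d); rewrite u0// mxE.
rewrite -(cmapK dn) -(cmapK p0_dom) -y1 -y0; congr (cinv _ _).
by apply/rowP => k; rewrite yk.
Qed.

Lemma logx_center : logx x0 = 0 /\ cdom n p0.
Proof.
have c0 : ccod n 0 by apply: ccod_n; rewrite tnorm0.
have dn : cdom n p0 by rewrite -exp_zero; exact: cinv_dom.
split; last exact: dn.
have -> : logx x0 = cmap n (cinv n 0) by rewrite /logx (cmapK p0_dom) exp_zero.
exact: cinvK.
Qed.

Definition log_region (rho : R) := [set x | U x /\ cdom n (cinv phi x) /\ tnorm p0 (logx x) < rho].

Lemma tnorm_continuous : continuous (@tnorm R M p0).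
Proof.
move=> v; apply: (@continuous_comp _ _ _ (fun v => qform (surf_metric (index_at p0)
  (cmap (chart_at p0) p0)) v) Num.sqrt); last exact: sqrt_continuous.
move: (surf_metric _ _) => G.
have -> : (fun v => qform G v) = fun v : 'rV[R]_2 => G 0 0 * (v 0 0 * v 0 0)
    + (G 0 1 + G 1 0) * (v 0 0 * v 0 1) + G 1 1 * (v 0 1 * v 0 1).
  by apply/funext => w; rewrite qform2E !expr2.
have cc k : {for v, continuous (fun v : 'rV[R]_2 => v 0 k)} by exact: coord_continuous.
by apply: continuousD; [apply: continuousD|]; (apply: continuousM; [exact: cst_continuous|
  apply: continuousM; exact: cc]).
Qed.

Lemma log_region_open : open (log_region delta).
Proof.
rewrite openE => x [Ux [nx xd]]; rewrite /interior.
have pc := cinv_continuous Ux.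
have nU : nbhs x U by apply: open_nbhs_nbhs.
have nn : nbhs x (cinv phi @^-1` cdom n).
  by apply: pc; apply: open_nbhs_nbhs; split=> //; exact: cdom_open.
have lc : {for x, continuous (fun z => tnorm p0 (logx z))}.
  apply: (@continuous_comp _ _ _ logx (tnorm p0)); last exact: tnorm_continuous.
  by apply: (@continuous_comp _ _ _ (cinv phi) (cmap n)) => //; exact: cmap_continuous.
have nd : nbhs x [set z | tnorm p0 (logx z) < delta].
  apply: (lc [set y | y < delta]); apply: open_nbhs_nbhs; split; first exact: open_lt.
  exact: xd.
by apply: filterS3 nU nn nd => z; split.
Qed.

Lemma tball_compact (rho : R) : compact [set v | tnorm p0 v <= rho].
Proof.
have ic := cdom_chart_at p0.
have [e e0 eP] := metric_coercive_near (@ccod_open _ _ (chart_at p0))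
  (surf_metric_C2 (index_at p0)) (cmap_cod ic).
have co v : e * dot v v <= tnorm p0 v ^+ 2.
  rewrite sqr_sqrtr; last exact: (metric_qform_ge0 _ (surf_chart_admissible (index_at p0)) ic).
  by apply: (eP _ _).2; rewrite subrr normr0.
apply: bounded_closed_compact; last first.
  have -> : [set v | tnorm p0 v <= rho] = tnorm p0 @^-1` [set y | y <= rho] by [].
  apply: closed_comp; last exact: closed_le.
  by move=> x _; exact: tnorm_continuous.
exists (rho ^+ 2 / e + 1); split; first exact: num_real.
move=> N hN v /= vr.
have h1 : `|v| ^+ 2 <= rho ^+ 2 / e.
  rewrite ler_pdivlMr// mulrC (le_trans (ler_wpM2l (ltW e0) (norm2_le_dot v)))//.
  by rewrite (le_trans (co v))// ler_pXn2r ?nnegrE ?tnorm_ge0// (le_trans (tnorm_ge0 p0 v)).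
apply: le_trans (ltW hN).
have [v1|v1] := leP `|v| 1.
  by rewrite (le_trans v1)// lerDr; apply: le_trans h1; rewrite sqr_ge0.
apply: (@le_trans _ _ (`|v| ^+ 2)); first by rewrite expr2 ler_peMr// ltW.
by rewrite (le_trans h1)// lerDl.
Qed.

(** The region is the continuous image of a compact ball of the tangent space, hence closed in the
    plane and not merely relative to U. *)
Lemma log_region_closed (rho : R) : rho < delta ->
  closed [set x | U x /\ cdom n (cinv phi x) /\ tnorm p0 (logx x) <= rho].
Proof.
move=> rd.
have dphi v : tnorm p0 v <= rho -> cdom phi (cinv n v).
  by move=> vr; have [y [u []]] := exp_chart_geodesic (le_lt_trans vr rd).
have -> : [set x | U x /\ cdom n (cinv phi x) /\ tnorm p0 (logx x) <= rho] =
    (cmap phi \o cinv n) @` [set v | tnorm p0 v <= rho].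
  apply/seteqP; split=> [x [Ux [nx xr]]|_ [v vr <-]].
    by exists (logx x) => //=; rewrite /logx cmapK// cinvK.
  have cn := ccod_n (le_lt_trans vr rd); have dv := dphi v vr.
  rewrite /= /logx cmapK// cinvK//; split; first exact: cmap_cod.
  by split=> //; exact: cinv_dom.
apply: compact_closed; first exact: norm_hausdorff.
apply: continuous_compact; last exact: tball_compact.
apply: continuous_in_subspaceT => v; rewrite inE/= => vr.
apply: continuous_comp.
  by apply: cinv_continuous; apply: ccod_n; exact: le_lt_trans rd.
by apply: cmap_continuous; exact: dphi.
Qed.

Context (B0 : R).
Hypothesis g0B : forall x, U x -> forall a b, `|g x a b| <= B0.
Hypothesis g1B : forall x, U x -> forall k a b, `|partial k (fun y => g y a b) x| <= B0.
Hypothesis g2B : forall x, U x -> forall l k a b,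
  `|partial l (partial k (fun y => g y a b)) x| <= B0.
Hypothesis gup : forall x, U x -> forall v, qform (g x) v <= 4 * dot v v.

Lemma line_is_derive (x h : 'rV[R]_2) (s : R) : is_derive s (1 : R) (fun s : R => x + s *: h) h.
Proof.
apply/is_derive_rV => k.
have -> : (fun s : R => (x + s *: h) 0 k) = cst (x 0 k) + h 0 k \*: id.
  by apply/funext => t; rewrite !mxE mulrC.
have d := is_deriveD (is_derive_cst (x 0 k) s 1) (is_deriveZ (h 0 k) (is_derive_id s 1)).
by apply: (is_derive_eq d); rewrite add0r /GRing.scale/= mulr1.
Qed.

(** Both [phi] and [n] are known to be compatible only with the charts of the atlas, so the
    derivative passes through one of these. *)
Lemma logx_line_derive (h : 'rV[R]_2) (s : R) : log_region delta (x0 + s *: h) ->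
  exists v', is_derive s (1 : R) (fun s => logx (x0 + s *: h)) v'.
Proof.
move=> [Ux [nx _]]; have [_ aC _] := ag.
pose c (s : R) := cinv phi (x0 + s *: h).
have dl := line_is_derive x0 h s.
have lc := is_derive_continuous dl.
have cc : {for s, continuous c}.
  apply: (@continuous_comp _ _ _ (fun s : R => x0 + s *: h) (cinv phi)) => //.
  exact: cinv_continuous.
have pc : cdom phi (c s) by exact: cinv_dom.
have ic := cdom_chart_at (c s); set i := index_at (c s) in ic.
have nU : \forall t \near s, U (x0 + t *: h).
  by apply: lc; apply: open_nbhs_nbhs.
have d1 : is_derive s (1 : R) (fun s => cmap phi (c s)) h.
  by apply: near_eq_is_derive dl; apply: filterS nU => t Ut; rewrite /c cinvK.
have d2 := is_derive_transition (Ck_map_le (isT : (1 <= 3)%N) (aC i).1) cc pc ic d1.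
have d3 := is_derive_transition (nC i).2 cc ic nx d2.
by eexists; exact: d3.
Qed.

(** The derivative of |log|^2 turns out to be 2 D, where D is the scalar product of h with the
    terminal velocity of the radial geodesic. Cauchy-Schwarz for g, conservation of energy (the
    terminal speed is |log|) and g <= 4 give the bound. *)
Lemma log_energy_derive (h : 'rV[R]_2) (s : R) : log_region delta (x0 + s *: h) ->
  exists F, is_derive s (1 : R) (fun s => tnorm p0 (logx (x0 + s *: h)) ^+ 2) F /\
    `|F| <= 4 * tnorm p0 (logx (x0 + s *: h)) * enorm h.
Proof.
move=> Os; have [Ux [nx vd]] := Os.
pose v t := logx (x0 + t *: h).
pose f t := tnorm p0 (v t) ^+ 2.
have lc (t : R) := is_derive_continuous (line_is_derive x0 h t).
have nO : \forall t \near s, log_region delta (x0 + t *: h).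
  by apply: (lc s); apply: open_nbhs_nbhs; split=> //; exact: log_region_open.
set G := surf_metric (index_at p0) (cmap (chart_at p0) p0).
have fE t : f t = G 0 0 * (v t 0 0 * v t 0 0) + (G 0 1 + G 1 0) * (v t 0 0 * v t 0 1)
    + G 1 1 * (v t 0 1 * v t 0 1).
  rewrite /f sqr_sqrtr; first by rewrite qform2E !expr2.
  exact: (metric_qform_ge0 _ (surf_chart_admissible (index_at p0)) (cdom_chart_at p0)).
have df t : log_region delta (x0 + t *: h) -> derivable f t 1.
  move=> /logx_line_derive[v' /is_derive_rV dv].
  have dk k : derivable (fun t => v t 0 k) t 1 by have [] := dv k.
  have -> : f = G 0 0 \*: ((fun t => v t 0 0) * (fun t => v t 0 0))
     + (G 0 1 + G 1 0) \*: ((fun t => v t 0 0) * (fun t => v t 0 1))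
     + G 1 1 \*: ((fun t => v t 0 1) * (fun t => v t 0 1)).
    by apply/funext => t'; rewrite fE.
  by apply: derivableD; [apply: derivableD|]; apply: derivableZ; exact: derivableM.
pose F := derive1 f s.
have dF : is_derive s (1 : R) f F by split; [exact: df|rewrite /F derive1E].
exists F; split; first exact: dF.
have [v' dv] := logx_line_derive Os.
have vc := is_derive_continuous dv.
have [y [u [yG y0 dy y1 u0]]] := exp_chart_geodesic vd.
have expE t : log_region delta (x0 + t *: h) -> cmap phi (cinv n (v t)) = x0 + t *: h.
  by move=> [Ut [nt _]]; rewrite /v /logx cmapK// cinvK.
have [C [rr [C0 rr0 FV]]] := first_variation oU gU g0B g1B g2B yG.
pose D := dot (u 1 *m g (y 1)) h.
pose a : R := \sum_i \sum_j `|J0 i j|.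
have a0 : 0 <= a by apply: sumr_ge0 => i _; apply: sumr_ge0.
have aJ i j : `|J0 i j| <= a.
  by rewrite /a (bigD1 i)//= (bigD1 j)//= -addrA lerDl addr_ge0// sumr_ge0// => *; rewrite sumr_ge0.
have dvJ (w : 'rV[R]_2) : `|w *m J0| <= 2 * (`|w| * a).
  apply: norm_le_bound => k; rewrite mxE; apply: sum2_bound => i; first exact: norm_coord.
  exact: aJ.
pose dd t := dot (v t - v s) (v t - v s).
have FVn : \forall t \near s, `|dot (u 1 *m g (y 1)) ((t - s) *: h) - 2^-1 * (f t - f s)|
    <= C * (4 * a ^+ 2) * dd t.
  (* This keeps |w 0 - u 0|, which is at most 2 a |v t - v s|, within the radius [rr] of the first
     variation formula; the added 1 allows a = 0. *)
  have nv : \forall t \near s, `|v s - v t| < rr / (2 * a + 1).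
    have ra : 0 < rr / (2 * a + 1) by rewrite divr_gt0//; lra.
    by have /cvgrPdist_lt/(_ _ ra) := vc.
  apply: filterS2 nO nv => t Ot vst.
  have [Ut [nt vtd]] := Ot.
  have [z [w [zG z0 dz z1 w0]]] := exp_chart_geodesic vtd.
  have wu : w 0 - u 0 = (v t - v s) *m J0 by rewrite w0 u0 mulmxBl.
  have vts : `|w 0 - u 0| <= 2 * (`|v t - v s| * a) by rewrite wu dvJ.
  have wr : `|w 0 - u 0| <= rr.
    apply: le_trans vts _; move: vst; rewrite distrC ltr_pdivlMr; last by lra.
    have := normr_ge0 (v t - v s); move: (`|v t - v s|) => X X0 h1; nra.
  have := FV z w _ zG (etrans z0 (esym y0)) wr.
  rewrite z1 y1 (expE t Ot) (expE s Os).
  have -> : x0 + t *: h - (x0 + s *: h) = (t - s) *: h.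
    by rewrite opprD addrACA subrr add0r scalerBl.
  move=> /le_trans; apply; rewrite -mulrA ler_wpM2l//.
  apply: (@le_trans _ _ ((2 * (`|v t - v s| * a)) ^+ 2)).
    by rewrite ler_pXn2r ?nnegrE ?mulr_ge0.
  rewrite (_ : (2 * _) ^+ 2 = 4 * a ^+ 2 * `|v t - v s| ^+ 2); last by ring.
  by rewrite ler_wpM2l ?mulr_ge0 ?exprn_ge0// norm2_le_dot.
(* The error term is a multiple of |v t - v s|^2, so its derivative at s vanishes. Since psi is
   nonnegative near s and zero at s, its derivative there, - (D - F / 2), is zero as well. One-sided
   control is enough, and no family of geodesics is differentiated. *)
pose psi t := C * (4 * a ^+ 2) * dd t - ((t - s) * D - 2^-1 * (f t - f s)).
have psi0 : psi s = 0.
  by rewrite /psi /dd subrr /dot !mxE subrr !(mul0r, mulr0, addr0, subr0, subrr).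
have psin : \forall t \near s, 0 <= psi t.
  apply: filterS FVn => t; rewrite /psi => ht; rewrite subr_ge0.
  apply: le_trans ht; apply: le_trans (ler_norm _).
  by rewrite /D /dot !mxE le_eqVlt; apply/orP; left; apply/eqP; ring.
have dpsi t : log_region delta (x0 + t *: h) -> derivable psi t 1.
  move=> Ot; have [w /is_derive_rV dw] := logx_line_derive Ot.
  have dk k : derivable (fun t => v t 0 k - v s 0 k) t 1.
    by apply: derivableB; [have [] := dw k|exact: derivable_cst].
  have -> : psi = (C * (4 * a ^+ 2)) \*: ((fun t => v t 0 0 - v s 0 0) * (fun t => v t 0 0 - v s 0 0)
      + (fun t => v t 0 1 - v s 0 1) * (fun t => v t 0 1 - v s 0 1))
      - (D \*: (id - cst s) - 2^-1 \*: (f - cst (f s))).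
    by apply/funext => t'; rewrite /psi /dd /dot !mxE [(t' - s) * D]mulrC.
  have dft := df t Ot.
  have P1 := @derivableZ _ _ _ _ (C * (4 * a ^+ 2)) _ _
    (derivableD (derivableM (dk 0) (dk 0)) (derivableM (dk 1) (dk 1))).
  have I1 : derivable (id : R -> R) t 1 by exact: derivable_id.
  have I2 (k : R) : derivable (cst k : R -> R) t 1 by exact: derivable_cst.
  have P2 := @derivableZ _ _ _ _ D _ _ (derivableB I1 (I2 s)).
  have P3 := @derivableZ _ _ _ _ 2^-1 _ _ (derivableB dft (I2 (f s))).
  exact: (derivableB P1 (derivableB P2 P3)).
have dpsi_s : is_derive s (1 : R) psi (- (D - 2^-1 * F)).
  have /is_derive_rV dw := dv.
  have dk k : is_derive s (1 : R) (fun t => v t 0 k - v s 0 k) (v' 0 k).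
    have H := is_deriveB (dw k) (is_derive_cst (v s 0 k) s 1).
    by apply: (is_derive_eq H); rewrite subr0.
  have Q1 := is_deriveZ (C * (4 * a ^+ 2))
    (is_deriveD (is_deriveM (dk 0) (dk 0)) (is_deriveM (dk 1) (dk 1))).
  have I1 : is_derive s (1 : R) (id : R -> R) 1 by exact: is_derive_id.
  have I2 (k : R) : is_derive s (1 : R) (cst k : R -> R) 0 by exact: is_derive_cst.
  have Q2 := is_deriveZ D (is_deriveB I1 (I2 s)).
  have Q3 := is_deriveZ 2^-1 (is_deriveB dF (I2 (f s))).
  have -> : psi = (C * (4 * a ^+ 2)) \*: ((fun t => v t 0 0 - v s 0 0) * (fun t => v t 0 0 - v s 0 0)
      + (fun t => v t 0 1 - v s 0 1) * (fun t => v t 0 1 - v s 0 1))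
      - (D \*: (id - cst s) - 2^-1 \*: (f - cst (f s))).
    by apply/funext => t'; rewrite /psi /dd /dot !mxE [(t' - s) * D]mulrC.
  apply: (is_derive_eq (is_deriveB Q1 (is_deriveB Q2 Q3))).
  rewrite /GRing.scale/= !subrr !mul0r !addr0 mulr0 sub0r !subr0 mulr1.
  by [].
have [e e0 eP] : exists2 e : R, 0 < e & forall t, `|t - s| < e ->
    log_region delta (x0 + t *: h) /\ 0 <= psi t.
  by apply: near_real; apply: filterS2 nO psin => t; split.
have near_s t : t \in `](s - e), (s + e)[ -> `|t - s| < e.
  by rewrite in_itv/= ltr_norml => /andP[h1 h2]; apply/andP; split; lra.
have min0 : is_derive s (1 : R) psi 0.
  apply: (@derive1_at_min _ psi (s - e) (s + e)).
  - lra.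
  - by move=> t /near_s /eP[Ot _]; exact: dpsi.
  - by rewrite in_itv/=; apply/andP; split; lra.
  - by move=> t /near_s /eP[_]; rewrite psi0.
have FD : F = 2 * D.
  have := etrans (esym (is_derive_derive1 dpsi_s)) (is_derive_derive1 min0); lra.
have I01 : 0 <= (1 : R) <= 1 by rewrite ler01 lexx.
have [Uy _ _ yE] := yG 1 I01.
have CS := metric_cauchy_schwarz (u 1) h (rmetric_sym gU Uy) (gU.2 _ Uy).2.
rewrite FD normrM ger0_norm// -/(v s) -mulrA.
have := gup Uy h; rewrite yE sqrtr_sqr (ger0_norm (tnorm_ge0 p0 (v s))) in CS.
move=> gh; have hh : Num.sqrt (qform (g (y 1)) h) <= 2 * enorm h.
  rewrite enormE -[2]ger0_norm// -sqrtr_sqr -sqrtrM ?sqr_ge0// ler_wsqrtr//.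
  by rewrite (_ : 2 ^+ 2 = 4)//; ring.
have E := le_trans CS (ler_wpM2l (tnorm_ge0 p0 (v s)) hh).
rewrite (_ : 4 * (tnorm p0 (v s) * enorm h) = 2 * (tnorm p0 (v s) * (2 * enorm h))); last by ring.
by rewrite ler_wpM2l.
Qed.

(* At a maximum [s] of [f] along the segment, [f s <= 4 * enorm h * sqrt (f s)]. *)
Lemma log_le_line (h : 'rV[R]_2) (t : R) : 0 <= t <= 1 ->
  (forall s : R, 0 <= s <= t -> log_region delta (x0 + s *: h)) ->
  tnorm p0 (logx (x0 + t *: h)) <= 4 * enorm h.
Proof.
move=> /andP[t0 t1] Ht.
pose f (s : R) := tnorm p0 (logx (x0 + s *: h)) ^+ 2.
have dfE (s : R) : 0 <= s <= t -> exists F, is_derive s (1 : R) f F /\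
    `|F| <= 4 * tnorm p0 (logx (x0 + s *: h)) * enorm h.
  by move=> /Ht; exact: log_energy_derive.
have fc : {within `[0, t], continuous f}.
  apply: continuous_in_subspaceT => s; rewrite inE/= in_itv/= => /dfE[F [dF _]].
  exact: is_derive_continuous dF.
have [s st fmax] := EVT_max t0 fc; rewrite in_itv/= in st.
set a := tnorm p0 (logx (x0 + s *: h)).
have a0 : 0 <= a by exact: tnorm_ge0.
have le_a (r' : R) : 0 <= r' <= t -> tnorm p0 (logx (x0 + r' *: h)) <= a.
  move=> rt; rewrite -(@ler_pXn2r _ 2) ?nnegrE ?tnorm_ge0//.
  by apply: fmax; rewrite in_itv.
have f0 : f 0 = 0 by rewrite /f scale0r addr0 (logx_center.1) tnorm0 expr0n.
suff h4 : a <= 4 * enorm h by apply: le_trans h4; apply: le_a; rewrite t0 lexx.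
have [a00|an0] := eqVneq a 0; first by rewrite a00 mulr_ge0 ?enorm_ge0.
have ap : 0 < a by rewrite lt_neqAle eq_sym an0.
case/andP: st => s0 stt.
have dfs (r' : R) : 0 <= r' <= s -> is_derive r' (1 : R) f (derive1 f r').
  move=> /andP[r0 rs]; have [|F [dF _]] := dfE r'; first by rewrite r0 (le_trans rs).
  by rewrite (is_derive_derive1 dF).
have [c /andP[c0 cs]] := mvt_closed s0 dfs.
have ct : 0 <= c <= t by rewrite c0 (le_trans cs).
have [F [dF Fb]] := dfE c ct.
rewrite f0 !subr0 (is_derive_derive1 dF) => E.
rewrite -(ler_pM2l ap) -expr2 -[leLHS]/(f s) E.
apply: (le_trans (ler_norm _)); rewrite normrM (ger0_norm s0).
apply: (@le_trans _ _ (`|F| * 1)); first by rewrite ler_wpM2l// (le_trans stt).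
rewrite mulr1; apply: (le_trans Fb); rewrite [4 * _]mulrC -mulrA.
by rewrite ler_wpM2r ?mulr_ge0 ?enorm_ge0// le_a.
Qed.

Lemma ball_in_chart (h : 'rV[R]_2) : 4 * enorm h < delta -> U (x0 + h).
Proof.
move=> hd.
have O01 : forall t : R, 0 <= t <= 1 -> log_region delta (x0 + t *: h).
  apply: (continuation log_region_open (log_region_closed hd)).
  - by move=> x [Ux [nx xd]]; split=> //; split=> //; exact: le_lt_trans hd.
  - by move=> t _; exact: is_derive_continuous (line_is_derive x0 h t).
  - rewrite scale0r addr0; have [l0 nd] := logx_center.
    by split; [exact: cmap_cod p0_dom|rewrite l0 tnorm0 cmapK//; exact: p0_dom].
  - move=> t t01 Ht; have [|Ut [nt _]] := Ht t; first by case/andP: t01 => -> _; rewrite lexx.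
    by split=> //; split=> //; exact: log_le_line.
by have [|+ _] := O01 1; rewrite ?scale1r// ler01 lexx.
Qed.

End ExponentialChart.

(** * Hölder bounds for the curvature *)

Section HoelderCalculus.
Context {R : realType} (S : set 'rV[R]_2) (om : 'rV[R]_2 -> 'rV[R]_2 -> R).
Hypothesis om0 : forall x y, 0 <= om x y.
Implicit Types (f : 'rV[R]_2 -> R) (A : R).

(** A single constant bounds the function and its seminorm relative to the modulus [om]; products
    then cost a factor 2 at most, and constants are tracked by arithmetic alone. *)
Definition hoelder_on A f := (forall x, S x -> `|f x| <= A) /\
  (forall x y, S x -> S y -> `|f x - f y| <= A * om x y).

Lemma hoelder_le A A' f : A <= A' -> hoelder_on A f -> hoelder_on A' f.
Proof.
move=> AA [b h]; split=> [x Sx|x y Sx Sy]; first exact: le_trans (b x Sx) AA.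
by apply: le_trans (h x y Sx Sy) _; rewrite ler_wpM2r.
Qed.

Lemma hoelderD A A' f f' : hoelder_on A f -> hoelder_on A' f' -> hoelder_on (A + A') (fun x => f x + f' x).
Proof.
move=> [b h] [b' h']; split=> [x Sx|x y Sx Sy].
  by rewrite (le_trans (ler_normD _ _))// lerD ?b ?b'.
rewrite (_ : f x + f' x - (f y + f' y) = (f x - f y) + (f' x - f' y)); last by ring.
by rewrite (le_trans (ler_normD _ _))// mulrDl lerD ?h ?h'.
Qed.

Lemma hoelderN A f : hoelder_on A f -> hoelder_on A (fun x => - f x).
Proof.
move=> [b h]; split=> [x Sx|x y Sx Sy]; first by rewrite normrN b.
by rewrite -opprD normrN h.
Qed.

Lemma hoelderB A A' f f' : hoelder_on A f -> hoelder_on A' f' -> hoelder_on (A + A') (fun x => f x - f' x).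
Proof. by move=> hf hf'; exact: hoelderD hf (hoelderN hf'). Qed.

Lemma hoelderM A A' f f' : hoelder_on A f -> hoelder_on A' f' -> hoelder_on (2 * A * A') (fun x => f x * f' x).
Proof.
move=> [b h] [b' h']; split=> [x Sx|x y Sx Sy].
  have A0 : 0 <= A by exact: le_trans (b x Sx).
  have A'0 : 0 <= A' by exact: le_trans (b' x Sx).
  rewrite normrM (@le_trans _ _ (A * A'))//; first by rewrite ler_pM ?b ?b'.
  by rewrite -mulrA ler_peMl ?mulr_ge0// (_ : 1 = 1%:R)// ler_nat.
rewrite (_ : f x * f' x - f y * f' y = f x * (f' x - f' y) + (f x - f y) * f' y); last by ring.
rewrite (le_trans (ler_normD _ _))// !normrM.
rewrite (_ : 2 * A * A' * om x y = A * (A' * om x y) + A * om x y * A'); last by ring.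
by apply: lerD; apply: ler_pM; rewrite ?b ?h ?b' ?h'.
Qed.

Lemma hoelderZ A f (c : R) : hoelder_on A f -> hoelder_on (`|c| * A) (fun x => c * f x).
Proof.
move=> [b h]; split=> [x Sx|x y Sx Sy]; first by rewrite normrM ler_wpM2l ?b.
by rewrite -mulrBr normrM -mulrA ler_wpM2l ?h.
Qed.

Lemma hoelderV A f (c : R) : 0 < c -> (forall x, S x -> c <= f x) -> c^-1 <= A / c ^+ 2 -> hoelder_on A f ->
  hoelder_on (A / c ^+ 2) (fun x => (f x)^-1).
Proof.
move=> c0 cf cA [b h]; have fp x : S x -> 0 < f x by move=> /cf; exact: lt_le_trans.
split=> [x Sx|x y Sx Sy].
  have fx := fp x Sx; have fi : 0 < (f x)^-1 by rewrite invr_gt0.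
  by rewrite (gtr0_norm fi); apply: le_trans cA; rewrite lef_pV2 ?posrE// cf.
have fx := fp x Sx; have fy := fp y Sy.
have -> : (f x)^-1 - (f y)^-1 = (f y - f x) / (f x * f y).
  by field; rewrite !gt_eqF.
rewrite normrM normfV (gtr0_norm (mulr_gt0 fx fy)) distrC.
rewrite ler_pdivrMr ?mulr_gt0//; apply: (le_trans (h x y Sx Sy)).
have cc : c ^+ 2 <= f x * f y by rewrite expr2 ler_pM ?cf// ltW.
have A0 : 0 <= A by exact: le_trans (b x Sx).
have -> : A / c ^+ 2 * om x y * (f x * f y) = A * (om x y * ((f x * f y) / c ^+ 2)) by ring.
by rewrite ler_wpM2l// ler_peMr// ler_pdivlMr ?exprn_gt0// mul1r.
Qed.

End HoelderCalculus.

(** * The curvature in a small Euclidean ball, in units of d *)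

Section CurvatureEstimate.
Context {R : realType} (U : set 'rV[R]_2) (g : 'rV[R]_2 -> 'M[R]_2).
Hypotheses (oU : open U) (gU : riemannian_metric U g).
Context (d rho alpha : R) (x0 : 'rV[R]_2).
Hypotheses (d0 : 0 < d) (rho0 : 0 < rho) (rhod : 16 * rho <= d) (alpha01 : 0 < alpha <= 1).
Hypothesis ballU : forall x, enorm (x - x0) <= rho -> U x.
Hypothesis gx0 : g x0 = 1%:M.
Hypothesis g1d : forall x, U x -> forall k a b, d * `|partial k (fun y => g y a b) x| <= 1.
Hypothesis g2d : forall x, U x -> forall l k a b,
  d ^+ 2 * `|partial l (partial k (fun y => g y a b)) x| <= 1.
Hypothesis g3d : forall x y, U x -> U y -> forall l k a b,
  d ^+ 2 * `|partial l (partial k (fun y => g y a b)) x - partial l (partial k (fun y => g y a b)) y|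
  <= (enorm (x - y) / d) `^ alpha.

Definition eball : set 'rV[R]_2 := [set x | enorm (x - x0) <= rho].
Definition modulus (x y : 'rV[R]_2) : R := (enorm (x - y) / d) `^ alpha.

Notation Hol := (hoelder_on eball modulus).

Lemma modulus_ge0 x y : 0 <= modulus x y. Proof. exact: powR_ge0. Qed.

Lemma eball_convex x y (s : R) : eball x -> eball y -> 0 <= s <= 1 -> eball (x + s *: (y - x)).
Proof.
rewrite /eball /= => hx hy /andP[s0 s1].
have -> : x + s *: (y - x) - x0 = (1 - s) *: (x - x0) + s *: (y - x0).
  by apply/rowP => i; rewrite !mxE; ring.
rewrite (le_trans (enormD _ _))// !enormZ !ger0_norm ?subr_ge0//.
have h1 : (1 - s) * enorm (x - x0) <= (1 - s) * rho by rewrite ler_wpM2l ?subr_ge0.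
have h2 : s * enorm (y - x0) <= s * rho by rewrite ler_wpM2l.
lra.
Qed.

Lemma eball_lipschitz (f : 'rV[R]_2 -> R) (c : R) x y :
  (forall z, U z -> differentiable f z) ->
  (forall z, U z -> forall k, d * `|partial k f z| <= c) -> eball x -> eball y ->
  `|f x - f y| <= 2 * c * (enorm (x - y) / d).
Proof.
move=> df fc ex ey.
have seg (s : R) : 0 <= s <= 1 -> U (y + s *: (x - y)) by move=> s01; apply: ballU; exact: eball_convex.
have [s s01] := segment_mvt (fun s s01 => df _ (seg s s01)).
rewrite [y + (x - y)]addrC subrK => ->.
have h1 k : `|(x - y) 0 k| <= enorm (x - y) by exact: coord_le_enorm.
have h2 k : `|partial k f (y + s *: (x - y))| <= c / d.
  by rewrite ler_pdivlMr// mulrC; exact: fc (seg s s01) k.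
apply: (le_trans (sum2_bound h1 h2)); rewrite le_eqVlt; apply/orP; left; apply/eqP; ring.
Qed.

(** Two points of the ball are at distance at most 2 rho <= d, so the ratio lies in [0, 1], where t
    <= t^alpha for alpha <= 1. Lipschitz bounds thus become Hölder bounds with constants independent
    of alpha. *)
Lemma ratio_le_modulus x y : eball x -> eball y -> enorm (x - y) / d <= modulus x y.
Proof.
move=> ex ey; have [->|xy] := eqVneq (enorm (x - y)) 0; first by rewrite mul0r powR_ge0.
have ep : 0 < enorm (x - y) by rewrite lt_neqAle eq_sym xy enorm_ge0.
apply: ger1_powR; last by case/andP: alpha01.
rewrite divr_gt0//= ler_pdivrMr// mul1r.
have tri := enorm_triangle x x0 y; rewrite (enormB x0 y) in tri.
move: ex ey tri rhod rho0; rewrite /eball/=.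
by move: (enorm _) (enorm _) (enorm _) => A B C; lra.
Qed.

Lemma lipschitz_hoelder (f : 'rV[R]_2 -> R) (c c' : R) :
  (forall z, U z -> differentiable f z) -> 0 <= c ->
  (forall z, U z -> forall k, d * `|partial k f z| <= c) -> (forall z, eball z -> `|f z| <= c') ->
  2 * c <= c' -> Hol c' f.
Proof.
move=> df c0 fc b cc; split=> // x y ex ey.
apply: (le_trans (eball_lipschitz df fc ex ey)).
apply: ler_pM => //; [by rewrite mulr_ge0|by rewrite divr_ge0 ?enorm_ge0// ltW|].
exact: ratio_le_modulus.
Qed.

(** Integrating the first derivatives from the centre, where g is the identity, gives a deviation of
    at most 2 rho / d; the hypothesis 16 rho <= d makes this 1/8. *)
Lemma metric_near_id x a b : eball x -> `|g x a b - (a == b)%:R| <= 8^-1.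
Proof.
move=> ex; have e0 : eball x0 by rewrite /eball/= subrr enorm0 ltW.
have -> : (a == b)%:R = g x0 a b by rewrite gx0 !mxE.
have := @eball_lipschitz (fun y => g y a b) 1 x x0 (fun z Uz => rmetric_diff oU gU a b Uz)
  (fun z Uz k => g1d Uz k a b) ex e0.
move=> /le_trans; apply; rewrite mulr1 mulrA ler_pdivrMr//.
by move: ex rhod; rewrite /eball/=; move: (enorm _) => A; lra.
Qed.

Lemma metric_hoelder a b : Hol 2 (fun x => g x a b).
Proof.
apply: (@lipschitz_hoelder _ 1).
- by move=> z Uz; exact: (rmetric_diff oU gU a b Uz).
- exact: ler01.
- by move=> z Uz k; exact: g1d.
- move=> z ez; have := metric_near_id a b ez.
  have : `|(a == b)%:R : R| <= 1 by case: eqP; rewrite ?normr1 ?normr0 ?ler01.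
  rewrite -{2}[g z a b](subrK (a == b)%:R); move: (ler_normD (g z a b - (a == b)%:R) (a == b)%:R); lra.
- by rewrite mulr1.
Qed.

Lemma metric1_hoelder k a b : Hol 2 (fun x => d * partial k (fun y => g y a b) x).
Proof.
have pd z : U z -> differentiable (partial k (fun y => g y a b)) z.
  by move=> Uz; exact: (rmetric_partial_diff oU gU k a b Uz).
have E l z : U z -> partial l (fun x => d * partial k (fun y => g y a b) x) z =
    d * partial l (partial k (fun y => g y a b)) z.
  move=> Uz; rewrite !partialE.
  apply: deriveZ; apply: diff_derivable; exact: pd.
apply: (@lipschitz_hoelder _ 1).
- by move=> z Uz; apply: differentiableM; [exact: differentiable_cst|exact: pd].
- exact: ler01.
- by move=> z Uz l; rewrite E// normrM (gtr0_norm d0) mulrA -expr2; exact: g2d.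
- move=> z ez; rewrite normrM (gtr0_norm d0) (le_trans (g1d (ballU ez) _ _ _))//.
  by rewrite (_ : 1 = 1%:R)// ler_nat.
- by rewrite mulr1.
Qed.

Lemma metric2_hoelder l k a b : Hol 1 (fun x => d ^+ 2 * partial l (partial k (fun y => g y a b)) x).
Proof.
have dd : 0 <= d ^+ 2 by rewrite exprn_ge0// ltW.
split=> [x ex|x y ex ey].
  by rewrite normrM (ger0_norm dd) g2d//; exact: ballU.
by rewrite -mulrBr normrM (ger0_norm dd) mul1r; apply: g3d; exact: ballU.
Qed.

Lemma metric_lower x v : eball x -> enorm v ^+ 2 <= 4 * qform (g x) v.
Proof.
move=> ex; rewrite sqr_enorm qform2E /dot.
have := metric_near_id 0 0 ex; have := metric_near_id 0 1 ex.
have := metric_near_id 1 0 ex; have := metric_near_id 1 1 ex.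
rewrite /= !ler_norml ?mulr1n ?mulr0n ?subr0.
move: (g x 0 0) (g x 0 1) (g x 1 0) (g x 1 1) (v 0 0) (v 0 1) => a b b' c u w.
move=> /andP[c1 c2] /andP[b1 b2] /andP[e1 e2] /andP[a1 a2].
rewrite -subr_ge0.
(* The cross term is absorbed in the squares of u + w and u - w, whose coefficients are nonnegative
   because b and b' are at most 1/8 in absolute value. *)
have -> : 4 * (a * u ^+ 2 + (b + b') * (u * w) + c * w ^+ 2) - (u * u + w * w) =
  (4 * a - 3 / 2) * u ^+ 2 + (4 * c - 3 / 2) * w ^+ 2
  + (4^-1 * (1 + 4 * (b + b')) * (u + w) ^+ 2 + 4^-1 * (1 - 4 * (b + b')) * (u - w) ^+ 2).
  by field.
by rewrite !addr_ge0// mulr_ge0 ?sqr_ge0 ?mulr_ge0 ?invr_ge0//; lra.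
Qed.

Lemma metric_det_lower x : eball x -> 2^-1 <= \det (g x).
Proof.
move=> ex; rewrite det2E.
have := metric_near_id 0 0 ex; have := metric_near_id 0 1 ex.
have := metric_near_id 1 0 ex; have := metric_near_id 1 1 ex.
rewrite /= !ler_norml ?mulr1n ?mulr0n ?subr0.
move: (g x 0 0) (g x 0 1) (g x 1 0) (g x 1 1) => a b b' c.
move=> /andP[c1 c2] /andP[b1 b2] /andP[e1 e2] /andP[a1 a2].
nra.
Qed.

Lemma entry_mul_hoelder (F G : 'rV[R]_2 -> 'M[R]_2) (A B : R) :
  (forall i j, Hol A (fun x => F x i j)) -> (forall i j, Hol B (fun x => G x i j)) ->
  forall i j, Hol (2 * (2 * A * B)) (fun x => (F x *m G x) i j).
Proof.
move=> hF hG i j.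
have -> : (fun x => (F x *m G x) i j) = fun x => F x i 0 * G x 0 j + F x i 1 * G x 1 j.
  by apply/funext => x; rewrite mulmx2E.
rewrite (_ : 2 * (2 * A * B) = 2 * A * B + 2 * A * B); last by ring.
by apply: hoelderD; apply: hoelderM.
Qed.

Lemma lowM_hoelder i k l : Hol 3 (fun x => (d *: lowM g i x) k l).
Proof.
have -> : (fun x => (d *: lowM g i x) k l) = fun x => 2^-1 *
  (d * partial i (fun y => g y k l) x + d * partial k (fun y => g y i l) x
   - d * partial l (fun y => g y i k) x).
  by apply/funext => x; rewrite mxE lowM_entry !dME; ring.
have -> : 3 = `|2^-1| * (2 + 2 + 2) :> R by rewrite ger0_norm ?invr_ge0//; field.
apply: hoelderZ; apply: hoelderB; [apply: hoelderD|]; exact: metric1_hoelder.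
Qed.

Lemma adj2_hoelder i j : Hol 2 (fun x => adj2 (g x) i j).
Proof.
have -> : (fun x => adj2 (g x) i j) =
   if i == j then (fun x => g x (1 - i) (1 - i)) else (fun x => - g x i j).
  by apply/funext => x; rewrite mxE; case: ifP.
by case: ifP => _; [exact: metric_hoelder|apply: hoelderN; exact: metric_hoelder].
Qed.

Lemma inv_det_hoelder : Hol 64 (fun x => (\det (g x))^-1).
Proof.
have h : Hol 16 (fun x => \det (g x)).
  have -> : (fun x => \det (g x)) = fun x => g x 0 0 * g x 1 1 - g x 0 1 * g x 1 0.
    by apply/funext => x; rewrite det2E.
  rewrite (_ : 16 = 2 * 2 * 2 + 2 * 2 * 2); last by ring.
  by apply: hoelderB; apply: hoelderM; exact: metric_hoelder.
rewrite (_ : 64 = 16 / 2^-1 ^+ 2 :> R); last by field.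
apply: hoelderV h; [exact: modulus_ge0|by rewrite invr_gt0|exact: metric_det_lower|].
by rewrite invrK (_ : 16 / _ = 64); [rewrite ler_nat|field].
Qed.

(** In [curvature_hoelder], 64 is the constant of the inverse determinant, 6 that of the part linear
    in the second derivatives and 576 that of the part quadratic in the first ones; each 2 comes
    from a product. *)
Definition curvature_const : R := 2 * 64 * (6 + 2 * 64 * 576).

(** Each derivative of g takes one factor d. One inverse determinant comes from the definition of
    the curvature, the other from the inverse of g, written as adjugate over determinant; what
    remains is polynomial in functions already estimated. *)
Lemma curvature_hoelder : Hol curvature_const (fun x => d ^+ 2 * gauss_curvature_coord g x).
Proof.
pose L i x := d *: lowM g i x.
pose q l k a b x := d ^+ 2 * partial l (partial k (fun y => g y a b)) x.
pose A x := 2^-1 * (q 0 1 1 0 x + q 0 1 1 0 x - q 0 0 1 1 x)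
          - 2^-1 * (q 1 0 1 0 x + q 1 1 0 0 x - q 1 0 0 1 x).
pose Q x := (L 0 x *m (L 1 x *m adj2 (g x))^T) 1 0 - (L 1 x *m (L 0 x *m adj2 (g x))^T) 1 0.
have E x : U x -> d ^+ 2 * gauss_curvature_coord g x =
    (\det (g x))^-1 * (A x + (\det (g x))^-1 * Q x).
  move=> Ux; rewrite gauss_riemM (riemM_low oU gU 0 1 Ux).
  rewrite !(chrME gU _ Ux) invmx2E ?gt_eqF ?(rmetric_det gU Ux)//.
  have EA : A x = d ^+ 2 * (dM 0 (lowM g 1) x 1 0 - dM 1 (lowM g 0) x 1 0).
    have e1 := dM_lowM oU gU 0 1 1 0 Ux; have e2 := dM_lowM oU gU 1 0 1 0 Ux.
    apply: etrans (congr2 (fun a b => d ^+ 2 * (a - b)) (esym e1) (esym e2)).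
    rewrite /A /q; clear e1 e2.
    move: (partial 0 (partial 1 (fun y => g y 1 0)) x) (partial 0 (partial 0 (fun y => g y 1 1)) x).
    move: (partial 1 (partial 0 (fun y => g y 1 0)) x) (partial 1 (partial 0 (fun y => g y 0 1)) x).
    by move: (partial 1 (partial 1 (fun y => g y 0 0)) x) => *; ring.
  rewrite EA /Q /L; move: (dM 0 _ x) (dM 1 _ x) (lowM g 0 x) (lowM g 1 x) (adj2 _) (\det _).
  move=> D0 D1 L0 L1 a2 dt.
  by rewrite !(mxE, sum2E); ring.
have hq l k a b : Hol 1 (q l k a b) by exact: metric2_hoelder.
have hA : Hol 6 A.
  apply: (hoelder_le modulus_ge0 (_ : `|2^-1| * (1 + 1 + 1) + `|2^-1| * (1 + 1 + 1) <= 6)).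
    by rewrite ger0_norm ?invr_ge0//; lra.
  by apply: hoelderB; apply: hoelderZ; apply: hoelderB; do ?[exact: hq|apply: hoelderD].
have hL i j k : Hol 24 (fun x => ((L i x *m adj2 (g x))^T) j k).
  have -> : (fun x => ((L i x *m adj2 (g x))^T) j k) = fun x => (L i x *m adj2 (g x)) k j.
    by apply/funext => x; rewrite mxE.
  rewrite (_ : 24 = 2 * (2 * 3 * 2)); last by ring.
  by apply: entry_mul_hoelder => *; [exact: lowM_hoelder|exact: adj2_hoelder].
have hQ : Hol 576 Q.
  rewrite (_ : 576 = 2 * (2 * 3 * 24) + 2 * (2 * 3 * 24)); last by ring.
  by apply: hoelderB; apply: (@entry_mul_hoelder (L _) (fun x => (L _ x *m adj2 (g x))^T)) => *;
    do ?[exact: lowM_hoelder|exact: hL].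
have hB : Hol curvature_const (fun x => (\det (g x))^-1 * (A x + (\det (g x))^-1 * Q x)).
  exact: hoelderM inv_det_hoelder (hoelderD hA (hoelderM inv_det_hoelder hQ)).
have [b h] := hB; split=> [x ex|x y ex ey]; first by rewrite E ?b//; exact: ballU.
by rewrite !E ?h//; exact: ballU.
Qed.

End CurvatureEstimate.

Section ExtendedSuprema.
Context {R : realType}.
Implicit Types (A : set (\bar R)) (b x : \bar R).
Local Open Scope ereal_scope.

Lemma esup0_ge0 A : 0 <= esup0 A.
Proof. by apply: ereal_sup_ubound; left. Qed.

Lemma esup0_ub A x : A x -> x <= esup0 A.
Proof. by move=> Ax; apply: ereal_sup_ubound; right. Qed.

Lemma esup0_le A b : 0 <= b -> (forall x, A x -> x <= b) -> esup0 A <= b.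
Proof. by move=> b0 Ab; apply: ge_ereal_sup => x [->//|]; exact: Ab. Qed.

End ExtendedSuprema.

(** * Pointwise bounds contained in the weighted Hölder norm *)

Section NormBounds.
Context {R : realType} (U : set 'rV[R]_2) (f : 'rV[R]_2 -> R) (alpha : R).
Local Notation d := (ediam U).
Hypotheses (d0 : 0 < d) (fU : (Cka_norm 2 alpha U f <= 1)%E).

Lemma Dsup_ge0 k : (0 <= Dsup k U f)%E.
Proof. exact: bigmax_ge_id. Qed.

Lemma Dholder_ge0 k : (0 <= Dholder k alpha U f)%E.
Proof. exact: bigmax_ge_id. Qed.

Lemma Cka_norm_term j : (j < 3)%N -> ((d ^+ j)%:E * Dsup j U f <= 1)%E.
Proof.
move=> j3; apply: le_trans fU; rewrite /Cka_norm /Ck_norm.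
have t0 i : (0 <= (d ^+ i)%:E * Dsup i U f)%E.
  by rewrite mule_ge0 ?Dsup_ge0// lee_fin exprn_ge0// ltW.
have h0 : (0 <= (d `^ (2%:R + alpha))%:E * Dholder 2 alpha U f)%E.
  by rewrite mule_ge0 ?Dholder_ge0// lee_fin powR_ge0.
apply: (le_trans _ (leeDl _ h0)).
rewrite (bigD1 (Ordinal j3))//= leeDl// sume_ge0// => i _; exact: t0.
Qed.

Lemma Cka_norm_holder : ((d `^ (2%:R + alpha))%:E * Dholder 2 alpha U f <= 1)%E.
Proof.
apply: le_trans fU; rewrite /Cka_norm leeDr// /Ck_norm sume_ge0// => i _.
by rewrite mule_ge0 ?Dsup_ge0// lee_fin exprn_ge0// ltW.
Qed.

Lemma Dmulti_bound j (b : 'I_j.+1) x : (j < 3)%N -> U x -> d ^+ j * `|Dmulti b (j - b) f x| <= 1.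
Proof.
move=> j3 Ux; have dj : 0 <= d ^+ j by rewrite exprn_ge0// ltW.
rewrite -lee_fin EFinM; apply: le_trans (Cka_norm_term j3).
rewrite lee_pmul ?lee_fin//; apply: (@le_trans _ _ (esup0 [set `|Dmulti b (j - b) f x|%:E | x in U])).
  by apply: esup0_ub; exists x.
exact: (le_bigmax 0%E (fun b : 'I_j.+1 => esup0 [set `|Dmulti b (j - b) f x|%:E | x in U]) b).
Qed.

Lemma Dmulti_holder (b : 'I_3) x y : 0 < alpha -> U x -> U y ->
  d ^+ 2 * `|Dmulti b (2 - b) f x - Dmulti b (2 - b) f y| <= (enorm (x - y) / d) `^ alpha.
Proof.
move=> a0 Ux Uy; have [->|xy] := eqVneq x y; first by rewrite !subrr normr0 mulr0 powR_ge0.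
have e0 : 0 < enorm (x - y).
  rewrite lt_neqAle enorm_ge0 andbT eq_sym; apply: contra xy => /eqP e.
  by have := norm_le_enorm (x - y); rewrite e normr_le0 subr_eq0.
set D := `|_|.
have hD : d `^ (2%:R + alpha) * (D / enorm (x - y) `^ alpha) <= 1.
  rewrite -lee_fin EFinM; apply: le_trans Cka_norm_holder.
  apply: lee_wpmul2l; first by rewrite lee_fin powR_ge0.
  pose F (b : 'I_3) := esup0 [set (`|Dmulti b (2 - b) f z.1 - Dmulti b (2 - b) f z.2|
                  / enorm (z.1 - z.2) `^ alpha)%:E
          | z in [set z : 'rV[R]_2 * 'rV[R]_2 | U z.1 /\ U z.2 /\ z.1 <> z.2]].
  apply: (@le_trans _ _ (F b)); last exact: (le_bigmax 0%E F b).
  by apply: esup0_ub; exists (x, y) => //; split=> //; split=> //; exact/eqP.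
have ea : 0 < enorm (x - y) `^ alpha by exact: powR_gt0.
have da : 0 < d `^ alpha by exact: powR_gt0.
rewrite powRD in hD; last by rewrite (gt_eqF d0) implybT.
rewrite (powR_mulrn _ (ltW d0)) in hD.
have E : enorm (x - y) `^ alpha = (enorm (x - y) / d) `^ alpha * d `^ alpha.
  by rewrite -powRM ?divr_ge0 ?ltW// divfK// gt_eqF.
move: hD; rewrite !mulrA ler_pdivrMr// mul1r E.
by rewrite mulrAC ler_pM2r.
Qed.

End NormBounds.

Section MetricBounds.
Context {R : realType} (U : set 'rV[R]_2) (h : 'rV[R]_2 -> R) (c alpha : R).
Hypotheses (oU : open U) (hU : Ck 2 U h).
Local Notation d := (ediam U).
Hypotheses (d0 : 0 < d) (alpha0 : 0 < alpha) (hn : (Cka_norm 2 alpha U (fun x => (h x - c)%R) <= 1)%E).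

Lemma partial_subC k : partial k (fun x => h x - c) = partial k h.
Proof.
apply/funext => x; rewrite !partialE /derive.
apply: (congr1 (fun u : R -> R => lim (u @ 0^'))).
by apply/funext => t /=; congr (_ *: _); ring.
Qed.

(** [Dmulti] differentiates along 1 before 0; the other mixed derivative is brought to this order by
    Schwarz. *)
Lemma partial2_Dmulti l k : exists b : 'I_3, forall x, U x ->
  partial l (partial k h) x = Dmulti b (2 - b) (fun x => h x - c) x.
Proof.
have E l' k' : partial l' (partial k' (fun x => h x - c)) = partial l' (partial k' h).
  exact: congr1 (partial_subC k').
move: l k; apply: ord2P; apply: ord2P.
- by exists (Ordinal (isT : (2 < 3)%N)) => x _; rewrite -E.
- by exists (Ordinal (isT : (1 < 3)%N)) => x _; rewrite -E.
- exists (Ordinal (isT : (1 < 3)%N)) => x Ux.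
  by rewrite (schwarz 1 0 oU hU Ux) -E.
- by exists (Ordinal (isT : (0 < 3)%N)) => x _; rewrite -E.
Qed.

Lemma norm_bound0 x : U x -> `|h x - c| <= 1.
Proof. by move=> Ux; have := Dmulti_bound d0 hn (0 : 'I_1) isT Ux; rewrite mul1r. Qed.

Lemma norm_bound1 x k : U x -> d * `|partial k h x| <= 1.
Proof.
move=> Ux; move: k; apply: ord2P.
  have := Dmulti_bound d0 hn (Ordinal (isT : (1 < 2)%N)) isT Ux.
  by rewrite expr1 -(partial_subC 0).
have := Dmulti_bound d0 hn (Ordinal (isT : (0 < 2)%N)) isT Ux.
by rewrite expr1 -(partial_subC 1).
Qed.

Lemma norm_bound2 x l k : U x -> d ^+ 2 * `|partial l (partial k h) x| <= 1.
Proof.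
move=> Ux; have [b E] := partial2_Dmulti l k; rewrite (E x Ux).
exact: (Dmulti_bound d0 hn b isT Ux).
Qed.

Lemma norm_bound3 x y l k : U x -> U y ->
  d ^+ 2 * `|partial l (partial k h) x - partial l (partial k h) y| <= (enorm (x - y) / d) `^ alpha.
Proof.
move=> Ux Uy; have [b E] := partial2_Dmulti l k; rewrite (E x Ux) (E y Uy).
exact: (Dmulti_holder d0 hn b alpha0 Ux Uy).
Qed.

End MetricBounds.

Section Diameter.
Context {R : realType} (U : set 'rV[R]_2).
Hypotheses (oU : open U) (bU : bounded_set U).

Lemma enorm_le_ediam x y : U x -> U y -> enorm (x - y) <= ediam U.
Proof.
move=> Ux Uy; apply: ub_le_sup; last by exists (x, y).
have [m [_ mU]] := bU; have m1 : m < m + 1 by rewrite ltrDl.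
exists (2 * ((m + 1) + (m + 1))) => _ [[z w] [/= Uz Uw] <-].
apply: (le_trans (enorm_le_norm _)); rewrite ler_pM2l//.
by apply: (le_trans (ler_normB _ _)); apply: lerD; exact: mU.
Qed.

Lemma ediam_gt0 x : U x -> 0 < ediam U.
Proof.
move=> Ux; have /nbhs_ballP[e /= e0 eU] := open_nbhs_nbhs (conj oU Ux).
pose v : 'rV[R]_2 := (e / 2) *: delta_mx 0 0.
have vn : `|v| = e / 2.
  rewrite normrZ gtr0_norm ?divr_gt0//.
  suff -> : `|delta_mx 0 0 : 'rV[R]_2| = 1 by rewrite mulr1.
  apply/eqP; rewrite eq_le norm_rV2_le// !mxE/= normr1 normr0 lexx ler01/=.
  by have := norm_coord (delta_mx 0 0 : 'rV[R]_2) 0; rewrite mxE normr1.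
have Uv : U (x + v).
  apply: eU; rewrite -ball_normE /= opprD addNKr normrN vn.
  by rewrite ltr_pdivrMr// mulr_natr mulr2n ltrDl.
apply: lt_le_trans (enorm_le_ediam Uv Ux); rewrite addrAC subrr add0r.
by apply: lt_le_trans (norm_le_enorm _); rewrite vn divr_gt0.
Qed.

End Diameter.

(** * The curvature norm of a small Riemannian disc *)

Section ChartCurvature.
Context {R : realType} (M : riemannian_surface R) (p0 : M).
Context (phi : chart R M) (g : 'rV[R]_2 -> 'M[R]_2) (ag : admissible phi g).
Hypothesis p0phi : cdom phi p0.
Local Notation U := (ccod phi).
Local Notation x0 := (cmap phi p0).
Context (d rho alpha : R).
Hypotheses (d0 : 0 < d) (rho0 : 0 < rho) (rhod : 16 * rho <= d) (alpha01 : 0 < alpha <= 1).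
Hypothesis ballU : forall x, enorm (x - x0) <= rho -> U x.
Hypothesis gx0 : g x0 = 1%:M.
Hypothesis g1d : forall x, U x -> forall k a b, d * `|partial k (fun y => g y a b) x| <= 1.
Hypothesis g2d : forall x, U x -> forall l k a b,
  d ^+ 2 * `|partial l (partial k (fun y => g y a b)) x| <= 1.
Hypothesis g3d : forall x y, U x -> U y -> forall l k a b,
  d ^+ 2 * `|partial l (partial k (fun y => g y a b)) x - partial l (partial k (fun y => g y a b)) y|
  <= (enorm (x - y) / d) `^ alpha.
Context (s : R).
Hypotheses (s0 : 0 < s) (srho : 6 * s <= rho).

Let gU : riemannian_metric U g. Proof. by case: ag. Qed.
Let oU : open U. Proof. exact: ccod_open. Qed.

Lemma metric_control x : enorm (x - x0) <= rho ->
  U x /\ forall v, enorm v ^+ 2 <= 4 * qform (g x) v.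
Proof.
move=> hx; split=> [|v]; first exact: ballU.
exact: (metric_lower oU gU d0 rho0 rhod ballU gx0 g1d).
Qed.

Lemma rball_chart q : rball p0 s q -> cdom phi q /\ enorm (cmap phi q - x0) <= 2 * s.
Proof.
apply: (rdist_control ag metric_control p0phi); rewrite subrr enorm0 add0r.
by move: s0 srho; lra.
Qed.

Lemma enorm_le_rdist p q : rball p0 s p -> rball p0 s q -> rdist p q \is a fin_num ->
  enorm (cmap phi p - cmap phi q) <= 2 * fine (rdist p q).
Proof.
move=> bp bq fin; have [cp ep] := rball_chart bp; have [cq eq] := rball_chart bq.
have tri := enorm_triangle (cmap phi p) x0 (cmap phi q).
rewrite (enormB x0) in tri.
rewrite leNgt; apply/negP => lt.
(* L lies strictly between the distance and half the Euclidean distance, so 2 L < |x - y| <= 4 s.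
   The first point being within 2 s of the centre, 2 s + 4 s <= rho makes [rdist_control]
   applicable; this is the origin of the 6 in [srho]. *)
pose L := (fine (rdist p q) + enorm (cmap phi p - cmap phi q) / 2) / 2.
have rL : (rdist p q < L%:E)%E.
  rewrite -(fineK fin) lte_fin /L; move: lt.
  by move: (fine _) (enorm _) => A B; lra.
have [] := rdist_control ag metric_control cp _ rL; last first.
  move=> _; rewrite enormB /L; move: lt.
  by move: (fine _) (enorm _) => A B; lra.
move: lt ep eq tri s0 srho; rewrite /L.
by move: (fine _) (enorm _) (enorm _) (enorm _) => A B C D; lra.
Qed.

Lemma curvature_const_ge0 : 0 <= curvature_const :> R.
Proof. by rewrite /curvature_const; lra. Qed.

Lemma curvature_norm_le : (curvature_norm alpha p0 s <= (2 * (curvature_const / d ^+ 2))%:E)%E.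
Proof.
have K0 := curvature_const_ge0; have dd : 0 < d ^+ 2 by rewrite exprn_gt0.
have a0 : 0 < alpha by case/andP: alpha01.
have [kb kh] := curvature_hoelder oU gU d0 rho0 rhod alpha01 ballU gx0 g1d g2d g3d.
have inb p : rball p0 s p -> cdom phi p /\ eball rho x0 (cmap phi p).
  move=> /rball_chart[cp ep]; split=> //; rewrite /eball/=.
  by move: ep srho s0; move: (enorm _) => A; lra.
have sup_le : (esup0 [set `|gauss_curvature p|%:E | p in rball p0 s] <= (curvature_const / d ^+ 2)%:E)%E.
  apply: esup0_le => [|_ [p /inb[cp ep] <-]]; first by rewrite lee_fin divr_ge0// ltW.
  rewrite lee_fin (gauss_curvature_admissible ag cp) ler_pdivlMr//.
  by have := kb _ ep; rewrite normrM (gtr0_norm dd) mulrC.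
have hol_le : (esup0 [set (`|gauss_curvature z.1 - gauss_curvature z.2|
                  / fine (rdist z.1 z.2) `^ alpha)%:E
          | z in [set z : M * M | rball p0 s z.1 /\ rball p0 s z.2 /\ z.1 <> z.2]]
    <= (curvature_const / d ^+ 2 * (2 / d) `^ alpha)%:E)%E.
  have c0 : 0 <= curvature_const / d ^+ 2 * (2 / d) `^ alpha by rewrite mulr_ge0 ?powR_ge0// divr_ge0// ltW.
  apply: esup0_le => [|_ [[p q] /= [bp [bq _]] <-]]; first by rewrite lee_fin.
  (* [fine] sends an infinite distance to 0; as alpha > 0 the denominator is then 0, and the
     quotient is 0 by convention. A zero distance is handled in the same way. *)
  rewrite lee_fin; have [fin|] := boolP (rdist p q \is a fin_num); last first.
    by rewrite fin_numE negb_and !negbK => /orP[]/eqP->; rewrite /= powR0 ?gt_eqF// invr0 mulr0.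
  have e2 := enorm_le_rdist bp bq fin.
  have r0 : 0 <= fine (rdist p q) by rewrite -(pmulr_rge0 _ (_ : 0 < 2))//; exact: le_trans (enorm_ge0 _) e2.
  have [->|rn] := eqVneq (fine (rdist p q)) 0; first by rewrite powR0 ?gt_eqF// invr0 mulr0.
  have rp : 0 < fine (rdist p q) by rewrite lt_neqAle eq_sym rn.
  have [cp ep] := inb _ bp; have [cq eq] := inb _ bq.
  rewrite ler_pdivrMr ?powR_gt0// (gauss_curvature_admissible ag cp) (gauss_curvature_admissible ag cq).
  have := kh _ _ ep eq; rewrite -mulrBr normrM (gtr0_norm dd) mulrC -ler_pdivlMr// => /le_trans; apply.
  have -> : curvature_const / d ^+ 2 * (2 / d) `^ alpha * fine (rdist p q) `^ alpha =
            curvature_const * (2 / d * fine (rdist p q)) `^ alpha / d ^+ 2.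
    rewrite (@powRM _ (2 / d)) ?divr_ge0//; last exact: ltW.
    by move: (_ `^ _) (_ `^ _) (_^-1) => A B C; ring.
  have di : 0 < d^-1 by rewrite invr_gt0.
  rewrite ler_pM2r ?invr_gt0// ler_wpM2l// /modulus.
  apply: ge0_ler_powR; rewrite ?nnegrE; [exact: ltW|..].
  - by apply: mulr_ge0; [exact: enorm_ge0|exact: ltW].
  - by rewrite !mulr_ge0// ltW.
  - by rewrite mulrAC ler_pM2r.
rewrite /curvature_norm (_ : 2 * (curvature_const / d ^+ 2) = curvature_const / d ^+ 2 + curvature_const / d ^+ 2); last by ring.
rewrite EFinD; apply: leeD => //.
apply: (@le_trans _ _ (((2 * s) `^ alpha)%:E * (curvature_const / d ^+ 2 * (2 / d) `^ alpha)%:E)%E).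
  by apply: lee_wpmul2l => //; rewrite lee_fin powR_ge0.
(* The weight (2 s)^alpha and the factor (2 / d)^alpha combine to (4 s / d)^alpha, which is at most
   1. *)
rewrite -EFinM lee_fin mulrCA -powRM; [|by rewrite mulr_ge0// ltW|by rewrite divr_ge0// ltW].
have f0 : 0 <= curvature_const / d ^+ 2 by rewrite divr_ge0// ltW.
apply: ler_piMr => //.
apply: (@le_trans _ _ (1 `^ alpha)); last by rewrite powR1.
have di : 0 <= d^-1 by rewrite invr_ge0 ltW.
apply: ge0_ler_powR; rewrite ?nnegrE//; [exact: ltW|by rewrite !mulr_ge0// ltW|].
rewrite mulrA ler_pdivrMr// mul1r.
by move: s0 srho rho0 rhod; lra.
Qed.

End ChartCurvature.

(* Otherwise [done] evaluates the numerals. *)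
Opaque curvature_const.

(** * From extrinsic to intrinsic regularity *)

Section Comparison.
Context {R : realType} (M : riemannian_surface R) (p0 : M).
Context (alpha delta : R).
Hypothesis alpha01 : 0 < alpha <= 1.

(* 128 = 2 * 8 ^+ 2: the curvature norm is at most [2 * curvature_const / d ^+ 2]
   for the diameter [d] of the chart, and [delta <= 8 * d]; the term 768 = 6 * 128
   makes the smaller ball lie in the Euclidean ball of radius [delta / 128]. *)
Definition regularity_ratio : R := (768 + 128 * curvature_const)^-1.

Lemma regularity_ratio_gt0 : 0 < regularity_ratio.
Proof. by rewrite invr_gt0; have := @curvature_const_ge0 R; lra. Qed.

Lemma regularity_ratio_le : 768 * regularity_ratio <= 1 /\ 128 * curvature_const * regularity_ratio <= 1.
Proof.
rewrite /regularity_ratio; have := @curvature_const_ge0 R; move: curvature_const => K K0.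
have e0 : 0 < 768 + 128 * K by move: K0; lra.
by split; rewrite ler_pdivrMr//; move: K0; lra.
Qed.

(** The supremum defining the injectivity radius need not be attained, but delta < 2 delta leaves
    room for an exponential chart of radius greater than delta. *)
Lemma exp_diffeo_gt (p : M) : 0 < delta -> ((2 * delta)%:E <= injectivity_radius p)%E ->
  exists2 r, delta < r & exp_diffeo p r.
Proof.
move=> delta0 inj; have : (delta%:E < injectivity_radius p)%E.
  by apply: lt_le_trans inj; rewrite lte_fin; move: delta0; lra.
move=> /ereal_sup_gt[_ [->|[r [r0 er] <-]]].
  by rewrite lte_fin ltNge ltW.
by rewrite lte_fin => dr; exists r.
Qed.

Lemma qform_near_id (G : 'M[R]_2) v : (forall a b, `|G a b - (a == b)%:R| <= 1) ->
  qform G v <= 4 * dot v v.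
Proof.
move=> h; rewrite qform2E /dot.
have := h 0 0; have := h 0 1; have := h 1 0; have := h 1 1.
rewrite /= !ler_norml ?mulr1n ?mulr0n ?subr0.
move: (G 0 0) (G 0 1) (G 1 0) (G 1 1) (v 0 0) (v 0 1) => a b b' c u w.
move=> /andP[c1 c2] /andP[b1 b2] /andP[e1 e2] /andP[a1 a2].
rewrite -subr_ge0.
have -> : 4 * (u * u + w * w) - (a * u ^+ 2 + (b + b') * (u * w) + c * w ^+ 2) =
  (3 - a) * u ^+ 2 + (3 - c) * w ^+ 2
  + (4^-1 * (2 - (b + b')) * (u + w) ^+ 2 + 4^-1 * (2 + (b + b')) * (u - w) ^+ 2).
  by field.
by rewrite !addr_ge0// mulr_ge0 ?sqr_ge0 ?mulr_ge0 ?invr_ge0//; lra.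
Qed.

Lemma extrinsic_intrinsic : extrinsically_regular alpha p0 delta ->
  intrinsically_regular alpha p0 (regularity_ratio * delta).
Proof.
move=> [delta0 inj [U [g [phi [[oU bU gU [domE codE phiC phig]] [gx0 gn]]]]]].
have c0 := regularity_ratio_gt0; have [c1 c2] := regularity_ratio_le.
have a0 : 0 < alpha by case/andP: alpha01.
have ag : admissible phi g by split; rewrite ?codE.
have p00 : rball p0 delta p0 by apply: le_lt_trans (rdist_self p0) _; rewrite lte_fin.
have p0phi : cdom phi p0 by rewrite domE.
have Ux0 : U (cmap phi p0) by rewrite -codE; exact: cmap_cod.
have d0 := ediam_gt0 oU bU Ux0.
have gC a b : Ck 2 U (fun x => g x a b) by case: gU => h _; exact: h.
have n0 x a b : U x -> `|g x a b - (a == b)%:R| <= 1.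
  by move=> Ux; exact: (norm_bound0 d0 (gn a b) Ux).
have n1 x : U x -> forall k a b, ediam U * `|partial k (fun y => g y a b) x| <= 1.
  by move=> Ux k a b; exact: (norm_bound1 d0 (gn a b) k Ux).
have n2 x : U x -> forall l k a b, ediam U ^+ 2 * `|partial l (partial k (fun y => g y a b)) x| <= 1.
  by move=> Ux l k a b; exact: (norm_bound2 oU (gC a b) d0 (gn a b) l k Ux).
have n3 x y : U x -> U y -> forall l k a b, ediam U ^+ 2 *
   `|partial l (partial k (fun y => g y a b)) x - partial l (partial k (fun y => g y a b)) y|
     <= (enorm (x - y) / ediam U) `^ alpha.
  by move=> Ux Uy l k a b; exact: (norm_bound3 oU (gC a b) d0 a0 (gn a b) l k Ux Uy).
have [r dr [n [ncod nC nexp]]] := exp_diffeo_gt delta0 (inj p0 p00).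
have ballU h : 4 * enorm h < delta -> U (cmap phi p0 + h).
  (* The entries of g are at most 2, their derivatives at most 1 / d and 1 / d^2. This bound depends
     on d, but the radius of the ball found below does not depend on it. *)
  pose B0 := 2 + (ediam U)^-1 + (ediam U ^+ 2)^-1.
  have i1 : 0 < (ediam U)^-1 by rewrite invr_gt0.
  have i2 : 0 < (ediam U ^+ 2)^-1 by rewrite invr_gt0 exprn_gt0.
  have := @ball_in_chart _ _ _ _ _ _ _ _ delta0 dr ag domE ncod nC nexp B0.
  rewrite codE; apply.
  - move=> x Ux a b; have := n0 x a b Ux.
    have : `|(a == b)%:R : R| <= 1 by case: eqP; rewrite ?normr1 ?normr0 ?ler01.
    rewrite -{2}[g x a b](subrK (a == b)%:R).
    have := ler_normD (g x a b - (a == b)%:R) (a == b)%:R.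
    by rewrite /B0; move: i1 i2; lra.
  - move=> x Ux k a b; have := n1 x Ux k a b; rewrite mulrC -ler_pdivlMr// mul1r.
    by rewrite /B0; move: i1 i2; lra.
  - move=> x Ux l k a b; have := n2 x Ux l k a b; rewrite mulrC -ler_pdivlMr ?exprn_gt0// mul1r.
    by rewrite /B0; move: i1 i2; lra.
  - by move=> x Ux v; apply: qform_near_id => a b; exact: n0.
have dd : delta <= 8 * ediam U.
  (* Since 4 (delta / 8) < delta this point belongs to U, and its distance delta / 8 from the centre
     is at most the diameter. *)
  have Uh : U (cmap phi p0 + (delta / 8) *: delta_mx 0 0).
    apply: ballU; rewrite enormZ gtr0_norm ?divr_gt0//.
    suff -> : enorm (delta_mx 0 0 : 'rV[R]_2) = 1 by move: delta0; lra.
    by rewrite enormE /dot !mxE/= !mulr0 addr0 mulr1 sqrtr1.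
  have := enorm_le_ediam bU Uh Ux0; rewrite addrAC subrr add0r => le1.
  have := le_trans (coord_le_enorm _ 0) le1; rewrite !mxE/= mulr1.
  by rewrite gtr0_norm ?divr_gt0// ler_pdivrMr// mulrC.
have s0 : 0 < regularity_ratio * delta by rewrite mulr_gt0.
have cd : 768 * (regularity_ratio * delta) <= delta by rewrite mulrA ler_piMl// ltW.
split=> //.
- move=> p bp; apply: (@le_trans _ _ (2 * delta)%:E).
    by rewrite lee_fin ler_pM2l//; move: cd s0; lra.
  by apply: inj; apply: lt_le_trans bp _; rewrite lee_fin; move: cd s0; lra.
(* With delta <= 8 d this gives 16 rho = delta / 8 <= d, the smallness needed for the metric to be
   close to the identity. *)
pose rho := delta / 128.
have rho0 : 0 < rho by rewrite divr_gt0.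
have rd : 16 * rho <= ediam U by rewrite /rho; move: dd; lra.
have srho : 6 * (regularity_ratio * delta) <= rho by rewrite /rho; move: cd; lra.
have bU' x : enorm (x - cmap phi p0) <= rho -> ccod phi x.
  move=> hx; rewrite codE -(subrKC (cmap phi p0) x); apply: ballU.
  by move: hx delta0; rewrite /rho; move: (enorm _) => A; lra.
rewrite -codE in n1 n2 n3 d0 rd dd.
have := curvature_norm_le ag p0phi d0 rho0 rd alpha01 bU' gx0 n1 n2 n3 s0 srho.
move=> /(lee_wpmul2l (_ : (0 <= ((regularity_ratio * delta) ^+ 2)%:E)%E)) h.
apply: (le_trans (h _)); first by rewrite lee_fin sqr_ge0.
rewrite -EFinM lee_fin; move: d0 dd; move: (ediam _) => d d0 dd.
have dp : 0 < d ^+ 2 by rewrite exprn_gt0.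
have -> : (regularity_ratio * delta) ^+ 2 * (2 * (curvature_const / d ^+ 2)) =
    2 * curvature_const * regularity_ratio * regularity_ratio * delta ^+ 2 / d ^+ 2.
  by move: curvature_const regularity_ratio (_^-1) => K c e; ring.
rewrite (ler_pdivrMr _ _ dp) mul1r.
have d2 : delta ^+ 2 <= 64 * d ^+ 2.
  by rewrite (_ : 64 * d ^+ 2 = (8 * d) ^+ 2) ?ler_sqr ?nnegrE ?mulr_ge0//; do ?[exact: ltW|ring].
have := @curvature_const_ge0 R; move: c0 c1 c2; move: regularity_ratio (curvature_const) => c K c0 c1 c2 K0.
have q0 : 0 <= 2 * K * c by rewrite !mulr_ge0// ltW.
apply: (@le_trans _ _ (2 * K * c * delta ^+ 2)).
  by rewrite ler_wpM2r ?sqr_ge0// ler_piMr//; move: c1 c0; lra.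
apply: (@le_trans _ _ (2 * K * c * (64 * d ^+ 2))); first by rewrite ler_wpM2l.
rewrite mulrA ler_piMl ?sqr_ge0//; move: c2.
by move: (K * c) (mulrA 2 K c) (mulrA 128 K c) => A <- <-; lra.
Qed.

End Comparison.

Theorem theorem1p3 (R : realType) :
  exists C1 : R, 0 < C1 /\
    forall (M : riemannian_surface R) (p0 : M) (alpha : R),
      0 < alpha <= 1 ->
      (C1%:E * rho_ext p0 alpha <= rho_int p0 alpha)%E.
Proof.
have c0 := @regularity_ratio_gt0 R.
exists regularity_ratio; split=> // M p0 alpha a01.
rewrite -lee_pdivlMl//; apply: esup0_le.
  by rewrite mule_ge0 ?esup0_ge0// lee_fin invr_ge0 ltW.
move=> _ [delta ed <-]; rewrite lee_pdivlMl// -EFinM.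
apply: esup0_ub; exists (regularity_ratio * delta) => //.
exact: extrinsic_intrinsic.
Qed.
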